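(* Let $U$ be a Hopf algebra, $H\subseteq U$ a sub-bialgebra such that $U$ is faithfully flat as a left and as a right $H$-module, and $C=U/UH^+$. Let $\mathscr{W}_1$ be a $U$-equivariant first-order codifferential calculus over $C$ whose quantum tangent space $T$ is finite dimensional and has trivial right $C$-coaction, i.e. $T\in{}_H\mathcal{M}^0$. Let $\check R=\check\delta_0^{-1}(U\otimes_HT)\subseteq T\otimes T$, where $\check\delta_0\colon T\otimes T\to U\otimes_HC^+$, $[x]\otimes t\mapsto x_{(1)}\otimes_HS(x_{(2)})t$. Then $$\mathscr{W}_\bullet^{\mathrm{max}}\cong U\otimes_H\mathfrak{C}(T,\check R)$$ as coalgebras in the monoidal category ${}_U^C\mathcal{M}^C$, where $\mathscr{W}_\bullet^{\mathrm{max}}$ is the maximal prolongation of $\mathscr{W}_1$.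
   Context: Throughout, $k$ is a field with $\mathrm{char}(k)\ne2$; everything is over $k$. $H^+=\ker(\varepsilon|_H)$; $C=U/UH^+\cong U\otimes_Hk$ is a quotient coalgebra and left $U$-module coalgebra, $x[y]=[xy]$; $C^+=\ker(\varepsilon\colon C\to k)$, $c^+=c-\varepsilon(c)[1]$. In a $C$-bicomodule $W$ write $w_{(-1)}\otimes w_{(0)}$ and $w_{(0)}\otimes w_{(1)}$ for the left and right coactions. A first-order codifferential calculus (FOCC) over $C$ is a $C$-bicomodule $\mathscr{W}_1$ with a linear map $\delta\colon\mathscr{W}_1\to C$ satisfying $\Delta(\delta(w))=\delta(w_{(0)})\otimes w_{(1)}+w_{(-1)}\otimes\delta(w_{(0)})$ (a coderivation) such that $w\mapsto w_{(-1)}\otimes\delta(w_{(0)})\in C\otimes C$ is injective. ${}_U^C\mathcal{M}^C$ is the category of left $U$-modules and $C$-bicomodules $M$ with $(xm)_{(-1)}\otimes(xm)_{(0)}=x_{(1)}m_{(-1)}\otimes x_{(2)}m_{(0)}$ and $(xm)_{(0)}\otimes(xm)_{(1)}=x_{(1)}m_{(0)}\otimes x_{(2)}m_{(1)}$; it is monoidal with product the cotensor product $M\square_CN=\{u\in M\otimes N:(\Delta_M\otimes\mathrm{id})(u)=(\mathrm{id}\otimes{}_N\Delta)(u)\}$ (outer coactions, diagonal $U$-action) and unit $C$. An FOCC is $U$-equivariant if $\mathscr{W}_1\in{}_U^C\mathcal{M}^C$ and $\delta$ is $U$-linear. Its quantum tangent space is $T=\delta(\{w\in\mathscr{W}_1:w_{(-1)}\otimes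 w_{(0)}=[1]\otimes w\})\subseteq C^+$; it satisfies $HT\subseteq T$, $\Delta(T)\subseteq(T\oplus k[1])\otimes C$, has right $C$-coaction $t\mapsto t_{(1)}^+\otimes t_{(2)}$, and $\mathscr{W}_1\cong U\otimes_HT$ with $\delta(x\otimes_Ht)=xt$. $T\in{}_H\mathcal{M}^0$ means $t_{(1)}^+\otimes t_{(2)}=t\otimes[1]$ for all $t\in T$. For $V\in{}_H\mathcal{M}$ with trivial right coaction $v\mapsto v\otimes[1]$, $U\otimes_HV\in{}_U^C\mathcal{M}^C$ with coactions $x\otimes_Hv\mapsto[x_{(1)}]\otimes(x_{(2)}\otimes_Hv)$ and $x\otimes_Hv\mapsto(x_{(1)}\otimes_Hv)\otimes[x_{(2)}]$. Maximal prolongation: let $\mathscr{W}_1^u=(C\otimes C)/\mathrm{im}(\Delta)$ with coactions $[c\otimes d]\mapsto c_{(1)}\otimes[c_{(2)}\otimes d]$, $[c\otimes d]\mapsto[c\otimes d_{(1)}]\otimes d_{(2)}$, and let $\varphi\colon\mathscr{W}_1\hookrightarrow\mathscr{W}_1^u$, $w\mapsto[w_{(-1)}\otimes\delta(w_{(0)})]$. $\mathscr{W}_2^{\mathrm{max}}$ is the largest sub-$C$-bicomodule of $\mathscr{W}_1\square_C\mathscr{W}_1$ mapped into $\varphi(\mathscr{W}_1)$ by $w_1\square_Cw_2\mapsto[\delta(w_1)\otimes\delta(w_2)]$. Put $\mathscr{W}_0^{\mathrm{max}}=C$, $\mathscr{W}_1^{\mathrm{max}}=\mathscr{W}_1$,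 $\mathscr{W}_n^{\mathrm{max}}=\bigcap_{i+j+2=n}\mathscr{W}_1^{\square_Ci}\square_C\mathscr{W}_2^{\mathrm{max}}\square_C\mathscr{W}_1^{\square_Cj}$ for $n\ge2$. $\mathscr{W}^{\mathrm{max}}_\bullet=\bigoplus_n\mathscr{W}_n^{\mathrm{max}}$ is a coalgebra in ${}_U^C\mathcal{M}^C$ with comultiplication deconcatenation of cotensors (including the coactions as outer terms) and counit the projection to $C$. Quadratic coalgebra: for a finite dimensional vector space $V$ and $R\subseteq V\otimes V$, $\mathfrak{C}(V,R)$ is the graded subcoalgebra of the tensor space $\bigoplus_nV^{\otimes n}$ with deconcatenation coproduct, with components $k$, $V$, and $\bigcap_{i+j+2=n}V^{\otimes i}\otimes R\otimes V^{\otimes j}$ for $n\ge2$. Here $\check R$ is an $H$-submodule of $T\otimes T$ (diagonal action), so $\mathfrak{C}(T,\check R)$ is a coalgebra in ${}_H\mathcal{M}$ (with trivial right $C$-coaction). The coalgebra structure on $U\otimes_H\mathfrak{C}(T,\check R)$ comes from the identification $U\otimes_H(V\otimes W)\cong(U\otimes_HV)\square_C(U\otimes_HW)$, $x\otimes_H(v\otimes w)\mapsto(x_{(1)}\otimes_Hv)\otimes(x_{(2)}\otimes_Hw)$, and counit $U\otimes_H\varepsilon\colon U\otimes_H\mathfrak{C}(T,\check R)\to U\otimes_Hk\cong C$. *)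

(* Defs.v *)
From HB Require Import structures.
From mathcomp Require Import all_boot all_order all_algebra.
From mathcomp Require Import boolp classical_sets.
From mathcomp.multinomials Require Import freeg.

Set Implicit Arguments.
Unset Strict Implicit.
Unset Printing Implicit Defensive.

Import GRing.Theory.
Local Open Scope ring_scope.
Local Open Scope classical_set_scope.

Section Span.
Variables (k : fieldType) (V : lmodType k).

Definition is_subspace (N : set V) : Prop :=
  N 0 /\ forall (a : k) (u v : V), N u -> N v -> N (a *: u + v).

Definition span (G : set V) : set V := smallest is_subspace G.

Lemma is_subspace_span (G : set V) : is_subspace (span G).
Proof.
split=> [N [[N0 _] _] //|a u v Gu Gv N hN].
by case: (hN) => [[_ NL] _]; apply: NL; [apply: Gu|apply: Gv].
Qed.

Lemma sub_span (G : set V) : G `<=` span G.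
Proof. by move=> v Gv N [_]; apply. Qed.

Lemma span_min (G N : set V) : is_subspace N -> G `<=` N -> span G `<=` N.
Proof. by move=> hN GN v; apply; split. Qed.

Definition spanb (G : set V) (v : V) : bool := `[< span G v >].

Lemma spanb_closed (G : set V) : GRing.subsemimod_closed (spanb G).
Proof.
have [N0 NL] := is_subspace_span G.
split; first split; first exact/asboolP.
- by move=> u v /asboolP hu /asboolP hv; apply/asboolP; rewrite -[u]scale1r; apply: NL.
- by move=> a v /asboolP hv; apply/asboolP; rewrite -[a *: v]addr0; apply: NL.
Qed.

HB.instance Definition _ (G : set V) :=
  GRing.isSubmodClosed.Build k V (spanb G) (spanb_closed G).

(* The subspace spanned by G, as a vector space; when G is a subspace, this is
   G itself. *)
Record subsp (G : set V) : Type := SubSp { subsp_val : V; _ : spanb G subsp_val }.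

End Span.

HB.instance Definition _ (k : fieldType) (V : lmodType k) (G : set V) :=
  [isSub for @subsp_val k V G].
HB.instance Definition _ (k : fieldType) (V : lmodType k) (G : set V) :=
  [Choice of subsp G by <:].
HB.instance Definition _ (k : fieldType) (V : lmodType k) (G : set V) :=
  [SubChoice_isSubLmodule of subsp G by <:].

(* The quotient V / span G. *)
Section Quo.
Variables (k : fieldType) (V : lmodType k) (G : set V).
Local Open Scope quotient_scope.

Definition quo : Type := 
  Quotient.quot (GRing.ZmodClosed.clone V (spanb G) _).
HB.instance Definition _ := GRing.Zmodule.on quo.

Definition qproj (v : V) : quo := \pi_quo v.

Lemma qprojP (u v : V) : qproj u = qproj v <-> span G (u - v).
Proof.
split=> [/eqmodP|h].
  by rewrite /= /Quotient.equiv => /asboolP.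
by apply/eqmodP; rewrite /= /Quotient.equiv; apply/asboolP.
Qed.

Lemma qprojD (u v : V) : qproj (u + v) = qproj u + qproj v.
Proof. by rewrite /qproj Quotient.pi_add. Qed.

Definition qscale (a : k) (x : quo) : quo := qproj (a *: repr x).

Lemma qscaleE (a : k) (v : V) : qscale a (qproj v) = qproj (a *: v).
Proof.
apply/qprojP; rewrite -scalerBr -[_ *: _]addr0.
have [N0 NL] := is_subspace_span G; apply: NL => //.
by apply/qprojP; rewrite /qproj reprK.
Qed.

Lemma qproj_surj (x : quo) : exists v, qproj v = x.
Proof. by exists (repr x); rewrite /qproj reprK. Qed.

Lemma qscaleA (a b : k) x : qscale a (qscale b x) = qscale (a * b) x.
Proof. by have [v <-] := qproj_surj x; rewrite !qscaleE scalerA. Qed.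
Lemma qscale1 : left_id 1 qscale.
Proof. by move=> x; have [v <-] := qproj_surj x; rewrite qscaleE scale1r. Qed.
Lemma qscaleDr : right_distributive qscale +%R.
Proof.
move=> a x y; have [u <-] := qproj_surj x; have [v <-] := qproj_surj y.
by rewrite -qprojD !qscaleE scalerDr qprojD.
Qed.
Lemma qscaleDl x : {morph qscale^~ x : a b / a + b}.
Proof. by move=> a b; have [v <-] := qproj_surj x; rewrite !qscaleE scalerDl qprojD. Qed.

HB.instance Definition _ :=
  GRing.Zmodule_isLmodule.Build k quo qscaleA qscale1 qscaleDr qscaleDl.

Lemma qproj_is_linear : linear qproj.
Proof. by move=> a u v; rewrite qprojD -qscaleE. Qed.

HB.instance Definition _ := GRing.isLinear.Build k V quo _ qproj qproj_is_linear.

End Quo.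

Section Description.
Variable k : fieldType.

(* The linear map sending e i to f i for all i. Every use below has e spanning
   V, so that there is at most one such map. By convention 0 if there is none. *)
Definition linext (I : Type) (V X : lmodType k) (e : I -> V) (f : I -> X) :
    {linear V -> X} :=
  if pselect (exists g : {linear V -> X}, forall i, g (e i) = f i) is left h
  then projT1 (cid h) else \0.

(* The linear map g such that i \o g = f. Every use below has i injective.
   By convention 0 if f does not factor through i. *)
Definition linfac (X Y Z : lmodType k) (i : Y -> Z) (f : X -> Z) :
    {linear X -> Y} :=
  if pselect (exists g : {linear X -> Y}, forall x, i (g x) = f x) is left h
  then projT1 (cid h) else \0.

Lemma linextE (I : Type) (V X : lmodType k) (e : I -> V) (f : I -> X)
    (g : {linear V -> X}) :
  (forall i, g (e i) = f i) -> forall i, linext e f (e i) = f i.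
Proof.
move=> hg; rewrite /linext; case: pselect => [h|[]]; last by exists g.
exact: (projT2 (cid h)).
Qed.

Lemma linfacE (X Y Z : lmodType k) (i : Y -> Z) (f : X -> Z)
    (g : {linear X -> Y}) :
  (forall x, i (g x) = f x) -> forall x, i (linfac i f x) = f x.
Proof.
move=> hg; rewrite /linfac; case: pselect => [h|[]]; last by exists g.
exact: (projT2 (cid h)).
Qed.

Definition exact_at (X Y Z : lmodType k) (f : X -> Y) (g : Y -> Z) : Prop :=
  forall y, (exists x, f x = y) <-> g y = 0.

Definition finite_dim (V : lmodType k) : Prop :=
  exists s : seq V, forall v, span [set` s] v.

End Description.

Section Tensor.
Variables (k : fieldType) (V W : lmodType k).

Definition tensor_rel : set {freeg (V * W)%type / k} :=
  [set z | (exists a v v' w,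
              z = << (a *: v + v', w) >> - (a *: << (v, w) >> + << (v', w) >>))
        \/ (exists a v w w',
              z = << (v, a *: w + w') >> - (a *: << (v, w) >> + << (v, w') >>))].

Definition tensor : lmodType k := quo tensor_rel.

Definition pure (v : V) (w : W) : tensor := qproj tensor_rel << (v, w) >>.

Lemma pure_linearr (v : V) : linear (pure v).
Proof.
move=> a w w'; rewrite /pure -linearP; apply/qprojP; apply: sub_span; right.
by exists a, v, w, w'.
Qed.

Lemma pure_linearl (w : W) : linear (pure^~ w).
Proof.
move=> a v v'; rewrite /pure -linearP; apply/qprojP; apply: sub_span; left.
by exists a, v, v', w.
Qed.

HB.instance Definition _ (v : V) :=
  GRing.isLinear.Build k W tensor _ (pure v) (pure_linearr v).

Definition purer (w : W) : V -> tensor := pure^~ w.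
HB.instance Definition _ (w : W) :=
  GRing.isLinear.Build k V tensor _ (purer w) (pure_linearl w).

(* The linear map v ⊗ w |-> f v w, for f bilinear (see tliftE). *)
Definition tlift (X : lmodType k) (f : V -> W -> X) : {linear tensor -> X} :=
  linext (fun p : V * W => pure p.1 p.2) (fun p => f p.1 p.2).

Lemma tliftE (X : lmodType k) (f : V -> W -> X) :
  (forall v, linear (f v)) -> (forall w, linear (f^~ w)) ->
  forall v w, tlift f (pure v w) = f v w.
Proof.
move=> fr fl; pose f2 (p : V * W) := f p.1 p.2.
have lf : linear (fglift f2).
  move=> a x y.
  pose F := HB.pack_for {additive {freeg (V * W)%type / k} -> X} (fglift f2)
    (GRing.isZmodMorphism.Build _ _ (fglift f2) (lift_is_additive f2)).
  have FZ : F (a *: x) = a *: F x.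
    have -> : a *: x = \sum_(z <- dom x) << a * coeff z x *g z >> by [].
    rewrite -{3}[x]freeg_sumE !raddf_sum.
    by apply: eq_bigr => z _; rewrite /= !liftU scalerA.
  by have := raddfD F (a *: x) y; rewrite FZ.
pose F := HB.pack_for {linear {freeg (V * W)%type / k} -> X} (fglift f2)
  (GRing.isLinear.Build _ _ _ _ (fglift f2) lf).
have FU p : F << p >> = f2 p by rewrite /= liftU scale1r.
have kerF : span tensor_rel `<=` [set z | F z = 0].
  apply: span_min => [|z []].
  - by split=> [|a u v Fu Fv]; rewrite /mkset ?linear0 // linearP Fu Fv scaler0 addr0.
  - by move=> [a [v [v' [w ->]]]]; rewrite /mkset linearB linearP !FU /f2 /= (fl w a v v') subrr.
  - by move=> [a [v [w [w' ->]]]]; rewrite /mkset linearB linearP !FU /f2 /= (fr v a w w') subrr.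
pose g (z : tensor) : X := F (repr z).
have gE x : g (qproj tensor_rel x) = F x.
  apply/eqP; rewrite -subr_eq0 -linearB; apply/eqP; apply: kerF.
  by apply/qprojP; rewrite /g /qproj reprK.
have lg : linear g.
  move=> a x y; have [u <-] := qproj_surj x; have [v <-] := qproj_surj y.
  by rewrite -linearP !gE linearP.
pose g' := HB.pack_for {linear tensor -> X} g (GRing.isLinear.Build _ _ _ _ g lg).
move=> v w; rewrite /tlift.
apply: (linextE (e := fun p : V * W => pure p.1 p.2) (g := g') _ (v, w)).
by move=> p; rewrite /= /pure gE FU.
Qed.

Lemma tensor_ext (X : lmodType k) (f g : {linear tensor -> X}) :
  (forall v w, f (pure v w) = g (pure v w)) -> forall z, f z = g z.
Proof.
move=> fg z; have [x <-] := qproj_surj z; rewrite -[x]freeg_sumE !raddf_sum.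
apply: eq_bigr => -[v w] _; set c := coeff _ _.
have -> : << c *g (v, w) >> = c *: << (v, w) >> :> {freeg (V * W)%type / k}.
  by apply/eqP/freeg_eqP => t; rewrite coeffZ !coeffU mulrA mulr1.
have key (h : {linear tensor -> X}) :
    h (qproj tensor_rel (c *: << (v, w) >>)) = c *: h (pure v w).
  by rewrite !linearZ.
by apply: etrans (key f) _; rewrite fg; apply/esym/key.
Qed.

End Tensor.

(* V ⨂ W is the tensor product over k of spaces, v ⊗ w that of vectors. *)
Notation "V ⨂ W" := (tensor V W) (at level 40, left associativity) : type_scope.
Notation "V ⨂ W" := (tensor V W) (at level 40, left associativity) : ring_scope.
Notation "v ⊗ w" := (pure v w) (at level 40, left associativity) : ring_scope.

Section TensorMaps.
Variable k : fieldType.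

Definition tmap (V W V' W' : lmodType k) (f : V -> V') (g : W -> W') :
    {linear V ⨂ W -> V' ⨂ W'} :=
  tlift (fun v w => f v ⊗ g w).

Definition tassoc (V W X : lmodType k) : {linear (V ⨂ W) ⨂ X -> V ⨂ (W ⨂ X)} :=
  tlift (fun z x => tmap id (fun w => w ⊗ x) z).

(* The subspace A ⊗ B of V ⨂ W. *)
Definition tsub (V W : lmodType k) (A : set V) (B : set W) : set (V ⨂ W) :=
  span [set z | exists v w, [/\ A v, B w & z = v ⊗ w]].

End TensorMaps.

Section DirectSum.
Variables (k : fieldType) (E : nat -> lmodType k).

Record dsum : Type := DSum {
  dcomp : forall n, E n;
  dsum_fin : exists N, forall n, (N <= n)%N -> dcomp n = 0 }.

Lemma dsum_eq (x y : dsum) : (forall n, dcomp x n = dcomp y n) -> x = y.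
Proof.
case: x y => [f hf] [g hg] /= fg.
have {}fg : f = g by apply: functional_extensionality_dep.
by case: _ / fg hg => hg; congr DSum; apply: Prop_irrelevance.
Qed.

HB.instance Definition _ := gen_eqMixin dsum.
HB.instance Definition _ := gen_choiceMixin dsum.

Lemma dsum0_fin : exists N, forall n, (N <= n)%N -> (0 : E n) = 0.
Proof. by exists 0%N. Qed.

Lemma dsumN_fin (x : dsum) : exists N, forall n, (N <= n)%N -> - dcomp x n = 0.
Proof. by have [N hN] := dsum_fin x; exists N => n /hN ->; rewrite oppr0. Qed.

Lemma dsumD_fin (x y : dsum) :
  exists N, forall n, (N <= n)%N -> dcomp x n + dcomp y n = 0.
Proof.
have [N hN] := dsum_fin x; have [M hM] := dsum_fin y; exists (maxn N M) => n.
by rewrite geq_max => /andP[/hN -> /hM ->]; rewrite addr0.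
Qed.

Lemma dsumZ_fin (a : k) (x : dsum) :
  exists N, forall n, (N <= n)%N -> a *: dcomp x n = 0.
Proof. by have [N hN] := dsum_fin x; exists N => n /hN ->; rewrite scaler0. Qed.

Definition dsum_zero : dsum := DSum dsum0_fin.
Definition dsum_opp (x : dsum) : dsum := DSum (dsumN_fin x).
Definition dsum_add (x y : dsum) : dsum := DSum (dsumD_fin x y).
Definition dsum_scale (a : k) (x : dsum) : dsum := DSum (dsumZ_fin a x).

Lemma dsum_addA : associative dsum_add.
Proof. by move=> x y z; apply: dsum_eq => n; apply: addrA. Qed.
Lemma dsum_addC : commutative dsum_add.
Proof. by move=> x y; apply: dsum_eq => n; apply: addrC. Qed.
Lemma dsum_add0 : left_id dsum_zero dsum_add.
Proof. by move=> x; apply: dsum_eq => n; apply: add0r. Qed.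
Lemma dsum_addN : left_inverse dsum_zero dsum_opp dsum_add.
Proof. by move=> x; apply: dsum_eq => n; apply: addNr. Qed.

HB.instance Definition _ :=
  GRing.isZmodule.Build dsum dsum_addA dsum_addC dsum_add0 dsum_addN.

Lemma dsum_scaleA (a b : k) (x : dsum) :
  dsum_scale a (dsum_scale b x) = dsum_scale (a * b) x.
Proof. by apply: dsum_eq => n; apply: scalerA. Qed.
Lemma dsum_scale1 : left_id 1 dsum_scale.
Proof. by move=> x; apply: dsum_eq => n; apply: scale1r. Qed.
Lemma dsum_scaleDr : right_distributive dsum_scale +%R.
Proof. by move=> a x y; apply: dsum_eq => n; apply: scalerDr. Qed.
Lemma dsum_scaleDl (x : dsum) : {morph dsum_scale^~ x : a b / a + b}.
Proof. by move=> a b; apply: dsum_eq => n; apply: scalerDl. Qed.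

HB.instance Definition _ :=
  GRing.Zmodule_isLmodule.Build k dsum
    dsum_scaleA dsum_scale1 dsum_scaleDr dsum_scaleDl.

Definition dinj_fun (n : nat) (u : E n) (m : nat) : E m :=
  if @eqP _ n m is ReflectT e then ecast i (E i) e u else 0.

Lemma dinj_fin n (u : E n) : exists N, forall m, (N <= m)%N -> dinj_fun u m = 0.
Proof.
exists n.+1 => m; rewrite /dinj_fun; case: eqP => // e.
by case: _ / e; rewrite ltnn.
Qed.

Definition dinj (n : nat) (u : E n) : dsum := DSum (dinj_fin u).

Lemma dinj_linear n : linear (@dinj n).
Proof.
move=> a u v; apply: dsum_eq => m /=; rewrite /dinj_fun.
by case: eqP => [e|_]; [case: _ / e | rewrite scaler0 addr0].
Qed.

HB.instance Definition _ n :=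
  GRing.isLinear.Build k (E n) dsum _ (@dinj n) (@dinj_linear n).

(* The linear map restricting to f n on the n-th summand. *)
Definition dlift (X : lmodType k) (f : forall n, E n -> X) : {linear dsum -> X} :=
  linext (fun p : {n : nat & E n} => dinj (projT2 p)) (fun p => f _ (projT2 p)).

End DirectSum.

(* A bialgebra X, of which only the comultiplication is recorded besides the
   algebra structure, and a left X-module coalgebra B. Together they determine
   the category of left X-modules with compatible B-bicomodule structure; it is
   used below for (U, C) and for (H, k), where it is the category of left
   H-modules. *)
Record modcoalg (k : fieldType) := ModCoalg {
  mc_alg : algType k;
  mc_delta : {linear mc_alg -> mc_alg ⨂ mc_alg};
  mc_coalg :> lmodType k;
  mc_act : mc_alg -> mc_coalg -> mc_coalg;
  mc_comul : {linear mc_coalg -> mc_coalg ⨂ mc_coalg};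
  mc_counit : {linear mc_coalg -> k^o} }.

Arguments mc_delta {k} B : rename.
Arguments mc_act {k} B : rename.
Arguments mc_comul {k} B : rename.
Arguments mc_counit {k} B : rename.

Section Bimodules.
Variables (k : fieldType) (B : modcoalg k).
Local Notation X := (mc_alg B).

Record bimod := Bimod {
  bcar :> lmodType k;
  bact : X -> bcar -> bcar;
  blam : {linear bcar -> B ⨂ bcar};
  brho : {linear bcar -> bcar ⨂ B} }.

(* x_(1) m ⊗ x_(2) n *)
Definition diag_act (M N : lmodType k) (aM : X -> M -> M) (aN : X -> N -> N)
    (x : X) : {linear M ⨂ N -> M ⨂ N} :=
  tlift (fun m n => tlift (fun y z => aM y m ⊗ aN z n) (mc_delta B x)).

(* M is a left X-module and a B-bicomodule, both coactions being X-linear. *)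
Record is_bimod (M : bimod) : Prop := IsBimod {
  bact_linear : forall x, linear (@bact M x);
  bact_linearl : forall m : M, linear ((@bact M)^~ m);
  bact1 : forall m : M, bact 1 m = m;
  bactM : forall x y (m : M), bact (x * y) m = bact x (bact y m);
  blam_coassoc : forall m : M,
    tassoc _ _ _ (tmap (mc_comul B) id (blam M m)) = tmap id (blam M) (blam M m);
  blam_counit : forall m : M,
    tlift (fun b n => mc_counit B b *: n) (blam M m) = m;
  brho_coassoc : forall m : M,
    tassoc _ _ _ (tmap (brho M) id (brho M m)) = tmap id (mc_comul B) (brho M m);
  brho_counit : forall m : M,
    tlift (fun n b => mc_counit B b *: n) (brho M m) = m;
  blam_brho : forall m : M,
    tassoc _ _ _ (tmap (blam M) id (brho M m)) = tmap id (brho M) (blam M m);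
  blam_act : forall x (m : M),
    blam M (bact x m) = diag_act (mc_act B) (@bact M) x (blam M m);
  brho_act : forall x (m : M),
    brho M (bact x m) = diag_act (@bact M) (mc_act B) x (brho M m) }.

Record is_bimod_mor (M N : bimod) (f : {linear M -> N}) : Prop := IsBimodMor {
  mor_act : forall x m, f (bact x m) = bact x (f m);
  mor_lam : forall m, blam N (f m) = tmap id f (blam M m);
  mor_rho : forall m, brho N (f m) = tmap f id (brho M m) }.

Definition unit_bimod : bimod :=
  Bimod (mc_act B) (mc_comul B) (mc_comul B).

(* M ⨂ N with the diagonal action and the outer coactions; the product of the
   category is its subspace cotensor M N. *)
Definition tens_bimod (M N : bimod) : bimod :=
  Bimod (diag_act (@bact M) (@bact N))
    (tlift (fun m n => tmap id (fun m' => m' ⊗ n) (blam M m)))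
    (tlift (fun m n => tmap (pure m) id (brho N n))).

Definition cotensor (M N : bimod) : set (M ⨂ N) :=
  [set u | tassoc _ _ _ (tmap (brho M) id u) = tmap id (blam N) u].
Arguments cotensor : clear implicits.

(* For N stable under the structure maps; linfac restricts them to N. *)
Definition sub_bimod (M : bimod) (N : set M) : bimod :=
  let i : subsp N -> M := val in
  @Bimod (subsp N)
    (fun x => linfac i (fun n => bact x (i n)))
    (linfac (tmap id i) (fun n => blam M (i n)))
    (linfac (tmap i id) (fun n => brho M (i n))).

Record coalg := Coalg {
  cobj :> bimod;
  comul : {linear cobj -> cobj ⨂ cobj};
  counit : {linear cobj -> B} }.

Record is_coalg (D : coalg) : Prop := IsCoalg {
  coalg_bimod : is_bimod D;
  comul_mor : @is_bimod_mor D (tens_bimod D D) (comul D);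
  comul_cotensor : forall d, cotensor D D (comul D d);
  counit_mor : @is_bimod_mor D unit_bimod (counit D);
  comul_coassoc : forall d,
    tassoc _ _ _ (tmap (comul D) id (comul D d)) = tmap id (comul D) (comul D d);
  comul_counitl : forall d, tmap (counit D) id (comul D d) = blam D d;
  comul_counitr : forall d, tmap id (counit D) (comul D d) = brho D d }.

Definition coalg_isomorphic (D E : coalg) : Prop :=
  [/\ is_coalg D, is_coalg E &
   exists f : {linear D -> E},
     [/\ bijective f, is_bimod_mor f,
         forall d, comul E (f d) = tmap f f (comul D d) &
         forall d, counit E (f d) = counit D d]].

Definition sub_coalg (D : coalg) (N : set D) : coalg :=
  let i : subsp N -> D := val in
  @Coalg (sub_bimod N)
    (linfac (tmap i i) (fun d => comul D (i d)))
    (counit D \o (val : {linear subsp N -> D})).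

Section TensorCoalgebra.
Variable V : bimod.

(* tpow m is the tensor power of exponent m + 1, bracketed to the right. *)
Fixpoint tpow (m : nat) : bimod :=
  if m is m'.+1 then tens_bimod V (tpow m') else V.

Definition tcomp (n : nat) : bimod :=
  if n is m.+1 then tpow m else unit_bimod.

Definition tspace : lmodType k := dsum tcomp.

Local Notation inj n := (@dinj k tcomp n).

Definition tspace_bimod : bimod :=
  @Bimod tspace
    (fun x => dlift (fun n u => inj n (bact x u)))
    (dlift (fun n u => tmap id (inj n) (blam (tcomp n) u)))
    (dlift (fun n u => tmap (inj n) id (brho (tcomp n) u))).

(* Concatenation with v on the left, in positive degrees. *)
Definition tcons (v : V) : {linear tspace -> tspace} :=
  dlift (fun n => match n return tcomp n -> tspace with
                  | 0 => fun _ => 0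
                  | m.+1 => fun u => inj m.+2 (v ⊗ u)
                  end).

(* The sum over the inner cuts: v_0 ⊗ ... ⊗ v_m is sent to the sum over
   0 < i <= m of (v_0 ⊗ ... ⊗ v_(i-1)) ⊗ (v_i ⊗ ... ⊗ v_m). *)
Fixpoint inner_cuts (m : nat) : {linear tpow m -> tspace ⨂ tspace} :=
  match m return {linear tpow m -> tspace ⨂ tspace} with
  | 0 => \0
  | m'.+1 => tlift (fun (v : V) (u : tpow m') =>
      inj 1 v ⊗ inj m'.+1 u + tmap (tcons v) id (inner_cuts m' u))
  end.

Definition deconc_comp (n : nat) : tcomp n -> tspace ⨂ tspace :=
  match n return tcomp n -> tspace ⨂ tspace with
  | 0 => fun b => tmap (inj 0) (inj 0) (mc_comul B b)
  | m.+1 => fun u => tmap (inj 0) (inj m.+1) (blam (tpow m) u)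
                     + inner_cuts m u
                     + tmap (inj m.+1) (inj 0) (brho (tpow m) u)
  end.

(* The direct sum of B and all tensor powers of V with deconcatenation. It is
   coassociative on the sum of the cotensor powers only. *)
Definition tspace_coalg : coalg :=
  @Coalg tspace_bimod (dlift deconc_comp)
    (dlift (fun n => match n return tcomp n -> B with
                     | 0 => fun b => b
                     | _.+1 => fun _ => 0
                     end)).

(* V^(⊗ i) ⊗ R ⊗ V^(⊗ j) in tpow m, where m + 1 = i + 2 + j. *)
Fixpoint tensor_at (R : set (V ⨂ V)) (i m : nat) : set (tpow m) :=
  match m return set (tpow m) with
  | 0 => set0
  | m'.+1 =>
    match i with
    | 0 => match m' return set (tens_bimod V (tpow m')) with
           | 0 => R
           | m''.+1 => tassoc V V (tpow m'') @` tsub R setT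
           end
    | i'.+1 => tsub setT (@tensor_at R i' m')
    end
  end.

(* The quadratic coalgebra with components B, V and, for n >= 2, the
   intersection of the V^(⊗ i) ⊗ R ⊗ V^(⊗ j), i + j + 2 = n. *)
Definition quad_coalg (R : set (V ⨂ V)) : coalg :=
  @sub_coalg tspace_coalg
    [set z | forall m i, (i < m)%N -> tensor_at R i (dcomp z m.+1)].

(* The cotensor power of exponent m + 1. *)
Fixpoint cotensor_pow (m : nat) : set (tpow m) :=
  match m return set (tpow m) with
  | 0 => setT
  | m'.+1 => tsub setT (@cotensor_pow m') `&` cotensor V (tpow m')
  end.

(* V^(□ i) □ R □ V^(□ j) in tpow m, where m + 1 = i + 2 + j. *)
Fixpoint cotensor_at (R : set (V ⨂ V)) (i m : nat) : set (tpow m) :=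
  match m return set (tpow m) with
  | 0 => set0
  | m'.+1 =>
    match i with
    | 0 => match m' return set (tens_bimod V (tpow m')) with
           | 0 => R
           | m''.+1 => tassoc V V (tpow m'') @`
               (tsub R (@cotensor_pow m'')
                `&` cotensor (tens_bimod V V) (tpow m''))
           end
    | i'.+1 => tsub setT (@cotensor_at R i' m') `&` cotensor V (tpow m')
    end
  end.

(* As quad_coalg, with cotensor products over B in place of tensor products. *)
Definition coquad_coalg (R : set (V ⨂ V)) : coalg :=
  @sub_coalg tspace_coalg
    [set z | forall m i, (i < m)%N -> cotensor_at R i (dcomp z m.+1)].

End TensorCoalgebra.

End Bimodules.

Arguments cotensor {k B} M N : rename.

Section RelativeTensor.
Variable k : fieldType.

Record is_lmodule (A : algType k) (N : lmodType k) (la : A -> N -> N) : Prop :=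
  IsLmodule {
    la_linear : forall a, linear (la a);
    la_linearl : forall n, linear (la^~ n);
    la1 : forall n, la 1 n = n;
    laM : forall a b n, la (a * b) n = la a (la b n) }.

Record is_rmodule (A : algType k) (M : lmodType k) (ra : M -> A -> M) : Prop :=
  IsRmodule {
    ra_linear : forall m, linear (ra m);
    ra_linearl : forall a, linear (ra^~ a);
    ra1 : forall m, ra m 1 = m;
    raM : forall m a b, ra m (a * b) = ra (ra m a) b }.

Section Balanced.
Variables (A : Type) (M N : lmodType k) (ra : M -> A -> M) (la : A -> N -> N).

Definition balanced_rel : set (M ⨂ N) :=
  [set z | exists m a n, z = ra m a ⊗ n - m ⊗ la a n].

Definition rtensor : lmodType k := quo balanced_rel.

Definition rpure (m : M) (n : N) : rtensor := qproj balanced_rel (m ⊗ n).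

(* The linear map m ⊗_A n |-> f m n, for f bilinear and balanced. *)
Definition rlift (X : lmodType k) (f : M -> N -> X) : {linear rtensor -> X} :=
  linext (fun p : M * N => rpure p.1 p.2) (fun p => f p.1 p.2).
End Balanced.

Arguments rpure {A M N} ra la m n.
Arguments rlift {A M N} ra la {X} f.

Definition rfaithfully_flat (A : algType k) (M : lmodType k) (ra : M -> A -> M) :=
  forall (N1 N2 N3 : lmodType k)
    (l1 : A -> N1 -> N1) (l2 : A -> N2 -> N2) (l3 : A -> N3 -> N3)
    (f : {linear N1 -> N2}) (g : {linear N2 -> N3}),
  is_lmodule l1 -> is_lmodule l2 -> is_lmodule l3 ->
  (forall a n, f (l1 a n) = l2 a (f n)) ->
  (forall a n, g (l2 a n) = l3 a (g n)) ->
  (exact_at f g <->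
   exact_at (rlift ra l1 (fun m n => rpure ra l2 m (f n)))
            (rlift ra l2 (fun m n => rpure ra l3 m (g n)))).

Definition lfaithfully_flat (A : algType k) (N : lmodType k) (la : A -> N -> N) :=
  forall (M1 M2 M3 : lmodType k)
    (r1 : M1 -> A -> M1) (r2 : M2 -> A -> M2) (r3 : M3 -> A -> M3)
    (f : {linear M1 -> M2}) (g : {linear M2 -> M3}),
  is_rmodule r1 -> is_rmodule r2 -> is_rmodule r3 ->
  (forall m a, f (r1 m a) = r2 (f m) a) ->
  (forall m a, g (r2 m a) = r3 (g m) a) ->
  (exact_at f g <->
   exact_at (rlift r1 la (fun m n => rpure r2 la (f m) n))
            (rlift r2 la (fun m n => rpure r3 la (g m) n))).

End RelativeTensor.

Arguments rpure {k A M N} ra la m n.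
Arguments rlift {k A M N} ra la {X} f.

Record hopfAlg (k : fieldType) := HopfAlg {
  hopf_alg :> algType k;
  hdelta : {linear hopf_alg -> hopf_alg ⨂ hopf_alg};
  heps : {linear hopf_alg -> k^o};
  hS : {linear hopf_alg -> hopf_alg};
  hdelta_coassoc : forall x,
    tassoc _ _ _ (tmap hdelta id (hdelta x)) = tmap id hdelta (hdelta x);
  heps_counitl : forall x, tlift (fun y z => heps y *: z) (hdelta x) = x;
  heps_counitr : forall x, tlift (fun y z => heps z *: y) (hdelta x) = x;
  hdelta1 : hdelta 1 = 1 ⊗ 1;
  hdeltaM : forall x y,
    hdelta (x * y) =
    tlift (fun x1 x2 => tlift (fun y1 y2 => (x1 * y1) ⊗ (x2 * y2)) (hdelta y))
          (hdelta x);
  heps1 : heps 1 = 1;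
  hepsM : forall x y, heps (x * y) = heps x * heps y;
  hSl : forall x, tlift (fun y z => hS y * z) (hdelta x) = heps x *: 1;
  hSr : forall x, tlift (fun y z => y * hS z) (hdelta x) = heps x *: 1 }.

Record subalg (k : fieldType) (A : algType k) (S : subalgClosed A) : Type :=
  SubAlg { subalg_val : A; _ : subalg_val \in S }.

HB.instance Definition _ (k : fieldType) (A : algType k) (S : subalgClosed A) :=
  [isSub for @subalg_val k A S].
HB.instance Definition _ (k : fieldType) (A : algType k) (S : subalgClosed A) :=
  [Choice of subalg S by <:].
HB.instance Definition _ (k : fieldType) (A : algType k) (S : subalgClosed A) :=
  [SubChoice_isSubAlgebra of subalg S by <:].

(* A subalgebra H of U to which the comultiplication restricts; sb_delta is
   determined by sb_deltaE, since H ⨂ H embeds in U ⨂ U. *)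
Record subBialg (k : fieldType) (U : hopfAlg k) := SubBialg {
  sb_set : subalgClosed U;
  sb_delta : {linear subalg sb_set -> subalg sb_set ⨂ subalg sb_set};
  sb_deltaE : forall h, tmap val val (sb_delta h) = hdelta U (val h) }.

Section Calculus.
Variables (k : fieldType) (U : hopfAlg k) (H : subBialg U).
Local Notation HT := (subalg (sb_set H)).

Definition quot_coalg : lmodType k :=
  quo [set z : U | exists x (h : HT), heps U (val h) = 0 /\ z = x * val h].
Local Notation C := quot_coalg.

Definition cls : {linear U -> C} := @qproj k U _.

Definition C_act (x : U) : {linear C -> C} := linext cls (fun y => cls (x * y)).
Definition C_delta : {linear C -> C ⨂ C} :=
  linext cls (fun x => tmap cls cls (hdelta U x)).
Definition C_eps : {linear C -> k^o} := linext cls (heps U).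

Definition UC_modcoalg : modcoalg k :=
  @ModCoalg k U (hdelta U) C C_act C_delta C_eps.

(* The pair (H, k), where k^o has h c = eps(h) c and Delta(c) = c ⊗ 1. *)
Definition Hk_modcoalg : modcoalg k :=
  @ModCoalg k HT (sb_delta H) k^o (fun h c => heps U (val h) * c)
    (@purer k k^o k^o 1) idfun.

Definition U_ract (x : U) (h : HT) : U := x * val h.
Definition U_lact (h : HT) (x : U) : U := val h * x.

Section Induction.
Variable D : coalg Hk_modcoalg.
Local Notation "x ⊗_H d" := (rpure U_ract (@bact k Hk_modcoalg D) x d)
  (at level 40).
Local Notation lift_H := (rlift U_ract (@bact k Hk_modcoalg D)).

(* U ⊗_H D, where D is a coalgebra in left H-modules. *)
Definition ind_car : lmodType k := rtensor U_ract (@bact k Hk_modcoalg D).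

Definition ind_bimod : bimod UC_modcoalg :=
  @Bimod k UC_modcoalg ind_car
    (fun y => lift_H (fun x d => (y * x) ⊗_H d))
    (lift_H (fun x d => tlift (fun x1 x2 => cls x1 ⊗ (x2 ⊗_H d)) (hdelta U x)))
    (lift_H (fun x d => tlift (fun x1 x2 => (x1 ⊗_H d) ⊗ cls x2) (hdelta U x))).

Definition ind_coalg : coalg UC_modcoalg :=
  @Coalg k UC_modcoalg ind_bimod
    (lift_H (fun x d =>
       tlift (fun x1 x2 =>
         tlift (fun d1 d2 => (x1 ⊗_H d1) ⊗ (x2 ⊗_H d2)) (comul D d))
       (hdelta U x)))
    (lift_H (fun x d => (counit D d : k^o) *: cls x)).
End Induction.

Record focc := Focc {
  fo_bimod :> bimod UC_modcoalg;
  fo_delta : {linear fo_bimod -> C};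
  fo_is_bimod : is_bimod fo_bimod;
  fo_deltaM : forall x w, fo_delta (bact x w) = C_act x (fo_delta w);
  fo_coderivation : forall w,
    C_delta (fo_delta w) =
    tmap fo_delta id (brho fo_bimod w) + tmap id fo_delta (blam fo_bimod w);
  fo_injective : injective (fun w => tmap id fo_delta (blam fo_bimod w)) }.

Variable W : focc.

Definition tangent : set C :=
  [set c | exists w : W, blam W w = cls 1 ⊗ w /\ c = fo_delta W w].
Definition T_car : lmodType k := subsp tangent.

Definition T_act (h : HT) : {linear T_car -> T_car} :=
  linfac (val : T_car -> C) (fun t => C_act (val h) (val t)).

Definition T_bimod : bimod Hk_modcoalg :=
  @Bimod k Hk_modcoalg T_car T_act (@pure k k^o T_car 1) (@purer k T_car k^o 1).

Definition cplus (c : C) : C := c - C_eps c *: cls 1.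

Definition trivial_right_coaction : Prop :=
  forall t : T_car, tmap cplus id (C_delta (val t)) = val t ⊗ cls 1.

Definition Cplus : lmodType k := subsp [set c : C | C_eps c = 0].
Definition Cplus_act (x : U) : {linear Cplus -> Cplus} :=
  linfac (val : Cplus -> C) (fun c => C_act x (val c)).
Definition Cplus_hact (h : HT) : Cplus -> Cplus := Cplus_act (val h).
Definition T_Cplus : {linear T_car -> Cplus} :=
  linfac (val : Cplus -> C) (val : T_car -> C).

Local Notation "x ⊗_H c" := (rpure U_ract Cplus_hact x c) (at level 40).

(* [x] ⊗ t |-> x_(1) ⊗_H S(x_(2)) t *)
Definition delta0 : {linear T_car ⨂ T_car -> rtensor U_ract Cplus_hact} :=
  tlift (fun s t =>
    linext cls (fun x =>
      tlift (fun x1 x2 => x1 ⊗_H Cplus_act (hS U x2) (T_Cplus t)) (hdelta U x))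
    (val s)).

(* The image of U ⊗_H T in U ⊗_H C^+. *)
Definition UT : set (rtensor U_ract Cplus_hact) :=
  span [set z | exists x t, z = x ⊗_H T_Cplus t].

Definition Rcheck : set (T_car ⨂ T_car) := delta0 @^-1` UT.

Definition W1u : lmodType k := quo (range C_delta).
Definition W1u_cls : {linear C ⨂ C -> W1u} := @qproj k _ (range C_delta).

Definition phi (w : W) : W1u := W1u_cls (tmap id (fo_delta W) (blam W w)).

Definition is_subbicomodule (N : set (W ⨂ W)) : Prop :=
  [/\ is_subspace N,
      forall u, N u -> tsub setT N (blam (tens_bimod W W) u) &
      forall u, N u -> tsub N setT (brho (tens_bimod W W) u)].

Definition W2_admissible (N : set (W ⨂ W)) : Prop :=
  [/\ is_subbicomodule N, N `<=` cotensor W W &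
      forall u, N u ->
        range phi (W1u_cls (tmap (fo_delta W) (fo_delta W) u))].

(* Admissible subspaces are closed under sums, so that their sum is the
   largest one. *)
Definition W2max : set (W ⨂ W) := span (\bigcup_(N in W2_admissible) N).

Definition Wmax : coalg UC_modcoalg := coquad_coalg W2max.

End Calculus.

(* Main.v *)
From HB Require Import structures.
From mathcomp Require Import all_boot all_order all_algebra.
From mathcomp Require Import boolp classical_sets.
From mathcomp.multinomials Require Import freeg.
Require Import Defs.


(** Let [W] be the calculus, [C] the quotient coalgebra and [T] the tangent space.
    The two coalgebras are compared through their left coinvariants, the vectors
    [m] with left coaction [[1] ⊗ m].

    Descent: a left [U]-module with a compatible left [C]-coaction is induced from
    its coinvariants, by [x ⊗_H v |-> x v] ([induced_map_inj], [induced_map_surj]).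
    Indeed [U ⊗_H M] is isomorphic to [C ⊗ M] for every [U]-module [M], by
    [x ⊗ m |-> [x_(1)] ⊗ x_(2) m], with an inverse built from the antipode
    ([canon_mapK], [canon_invK]); and flatness of [U] preserves the kernel of
    [m |-> blam m - [1] ⊗ m], which consists of the coinvariants. So it suffices to
    identify the coinvariants of the maximal prolongation.

    In degree one they are [T]: the codifferential is injective on coinvariants,
    with inverse [j = tangent_lift]. Triviality of the right coaction of [T] means
    that [j t] has right coaction [j t ⊗ [1]] ([lift_rho]).

    In degree two, [u] satisfies the condition on [W2max] exactly if
    [(delta ⊗ delta) u] lies in the space [L] of the
    [w_(-1) ⊗ delta(w_(0))] ([phi_rangeE]). For [u = (j ⊗ j) r] this tensor is [r]
    itself in [C ⊗ C]. The canonical isomorphism for [C^+] takes the image of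
    [U ⊗_H T] to [L], as [W] is spanned by the [x (j t)], and it takes [delta0 r]
    to [r]; hence the condition says that [r] lies in [Rcheck]
    ([UT_differentials], [RcheckE]). Conversely the [U]-span of these [(j ⊗ j) r]
    is admissible, and so it is contained in [W2max] ([act_span_admissible],
    [lift2_W2max]).

    In higher degrees, a coinvariant of a cotensor product has both factors
    coinvariant as soon as the coinvariants of the first factor have trivial right
    coaction ([coinv_cotensor]). So the coinvariants of cotensor powers of [W] are
    the tensor powers of [T], and the relations correspond
    ([quad_coquad], [coinv_coquad]).

    It remains to compare comultiplications. Deconcatenation is equivariant
    ([act_deconc]) and commutes with the embedding of words in [T] into words in
    [W] ([jsp_deconc]). The quadratic coalgebra satisfies the coalgebra axioms by
    recursion on the first letter ([comul_lcons], [comul_quad]); the induced one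
    inherits them because equivariant maps out of an induced module are determined
    by their values on the [1 ⊗_H d] ([ind_ext], [ind_is_coalg]); and the bijection
    carries them to the maximal prolongation ([transport_isomorphic]). *)

Set Implicit Arguments.
Unset Strict Implicit.
Unset Printing Implicit Defensive.

Import GRing.Theory.
Local Open Scope ring_scope.
Local Open Scope classical_set_scope.

(** * Linear algebra *)

Section LinearAlgebra.
Variable k : fieldType.
Implicit Types V W : lmodType k.

Definition mklin V W (f : V -> W) (lf : linear f) : {linear V -> W} :=
  HB.pack_for {linear V -> W} f (GRing.isLinear.Build _ _ _ _ f lf).

Lemma lm0 V W (f : {linear V -> W}) : f 0 = 0. Proof. exact: linear0. Qed.
Lemma lmD V W (f : {linear V -> W}) u v : f (u + v) = f u + f v.
Proof. exact: linearD. Qed.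
Lemma lmB V W (f : {linear V -> W}) u v : f (u - v) = f u - f v.
Proof. exact: linearB. Qed.
Lemma lmZ V W (f : {linear V -> W}) a v : f (a *: v) = a *: f v.
Proof. exact: linearZ. Qed.
Lemma lmP V W (f : {linear V -> W}) a u v : f (a *: u + v) = a *: f u + f v.
Proof. exact: linearP. Qed.
Lemma lm_sum V W (f : {linear V -> W}) (I : Type) (s : seq I) (F : I -> V) :
  f (\sum_(i <- s) F i) = \sum_(i <- s) f (F i).
Proof. exact: raddf_sum. Qed.

Lemma linear_fun0 V W (g : V -> W) : linear g -> g 0 = 0.
Proof. by move=> lg; apply: (lm0 (mklin lg)). Qed.
Lemma linear_funD V W (g : V -> W) u v : linear g -> g (u + v) = g u + g v.
Proof. by move=> lg; apply: (lmD (mklin lg)). Qed.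
Lemma linear_funZ V W (g : V -> W) a v : linear g -> g (a *: v) = a *: g v.
Proof. by move=> lg; apply: (lmZ (mklin lg)). Qed.

Definition bilinear_op V W (X : lmodType k) (f : V -> W -> X) :=
  (forall v, linear (f v)) /\ (forall w, linear (f^~ w)).

Lemma subspaceD V (N : set V) u v : is_subspace N -> N u -> N v -> N (u + v).
Proof. by move=> [_ h] Nu Nv; rewrite -[u]scale1r; apply: h. Qed.

Lemma subspaceZ V (N : set V) a v : is_subspace N -> N v -> N (a *: v).
Proof. by move=> [h0 h] Nv; rewrite -[a *: v]addr0; apply: h. Qed.

Lemma subspaceB V (N : set V) u v : is_subspace N -> N u -> N v -> N (u - v).
Proof.
by move=> hN Nu Nv; rewrite -scaleN1r; apply: subspaceD => //; apply: subspaceZ.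
Qed.

Lemma subspace_sum V (N : set V) (I : eqType) (s : seq I) (F : I -> V) :
  is_subspace N -> (forall i, i \in s -> N (F i)) -> N (\sum_(i <- s) F i).
Proof.
move=> hN; elim: s => [|i s IH] h; first by rewrite big_nil; case: hN.
rewrite big_cons; apply: subspaceD => //; first by apply: h; rewrite inE eqxx.
by apply: IH => j js; apply: h; rewrite inE js orbT.
Qed.

Lemma subspaceT V : is_subspace [set: V].
Proof. by []. Qed.

Lemma subspaceI V (M N : set V) :
  is_subspace M -> is_subspace N -> is_subspace (M `&` N).
Proof.
move=> [M0 ML] [N0 NL]; split=> // a u v [Mu Nu] [Mv Nv].
by split; [apply: ML|apply: NL].
Qed.

Lemma subspace_ker V W (f : {linear V -> W}) : is_subspace [set v | f v = 0].
Proof.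
split=> [|a u v]; rewrite /mkset ?linear0 // => fu fv.
by rewrite linearP fu fv scaler0 addr0.
Qed.

Lemma subspace_preim V W (f : {linear V -> W}) (N : set W) :
  is_subspace N -> is_subspace (f @^-1` N).
Proof.
move=> [N0 NL]; split=> [|a u v]; rewrite /preimage /mkset ?linear0 // linearP.
exact: NL.
Qed.

Lemma subspace_im V W (f : {linear V -> W}) (N : set V) :
  is_subspace N -> is_subspace (f @` N).
Proof.
move=> [N0 NL]; split=> [|a _ _ [u Nu <-] [v Nv <-]]; first by exists 0; rewrite ?linear0.
by exists (a *: u + v); rewrite ?linearP //; apply: NL.
Qed.

Lemma span_id V (N : set V) : is_subspace N -> span N = N.
Proof. by move=> hN; apply/seteqP; split; [apply: span_min|apply: sub_span]. Qed.

Lemma span_mono V (M N : set V) : M `<=` N -> span M `<=` span N.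
Proof.
by move=> MN; apply: span_min => [|v /MN]; [apply: is_subspace_span|apply: sub_span].
Qed.

(** A maximal subspace avoiding a vector is a hyperplane complementary to it. *)
Lemma separating_functional V (S : set V) (x : V) : is_subspace S -> ~ S x ->
  exists xi : {linear V -> k^o}, (forall y, S y -> xi y = 0) /\ xi x = 1.
Proof.
move=> hS nSx.
have [F FP Ftot|A [nA Amax]] := @Zorn_bigcup V [set A | ~ span (S `|` A) x].
  move=> hx.
  pose N := [set y | S y \/ exists2 X, F X & span (S `|` X) y].
  have SN X y : S y -> span (S `|` X) y by move=> Sy; apply: sub_span; left.
  have hN : is_subspace N.
    split; first by left; case: hS.
    move=> a u v [Su|[X FX Xu]] [Sv|[Y FY Yv]].
    - by left; case: hS => _; apply.
    - right; exists Y => //; apply: (is_subspace_span _).2 => //; exact: SN.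
    - right; exists X => //; apply: (is_subspace_span _).2 => //; exact: SN.
    - case: (Ftot X Y FX FY) => XY; right; [exists Y|exists X] => //;
        apply: (is_subspace_span _).2 => //.
        by move: Xu; apply: span_mono; apply: setUS.
      by move: Yv; apply: span_mono; apply: setUS.
  have : N x.
    move: hx; apply: span_min => // y [Sy|[X FX Xy]]; first by left.
    by right; exists X => //; apply: sub_span; right.
  by case=> [//|[X /FP]].
pose M := span (S `|` A); have hM : is_subspace M := is_subspace_span _.
have SM : S `<=` M by move=> y Sy; apply: sub_span; left.
have ex y : exists c : k, M (y - c *: x).
  have [My|nMy] := pselect (M y); first by exists 0; rewrite scale0r subr0.
  have : ~ ~ span (S `|` (A `|` [set y])) x.
    apply: (Amax (A `|` [set y])); split; first by move=> z; left.
    by move=> h; apply: nMy; apply: sub_span; right; apply: h; right.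
  move=> /contrapT hx.
  have [a Ma] : exists a : k, M (x - a *: y).
    have hN : is_subspace [set z | exists a : k, M (z - a *: y)].
      split; first by exists 0; rewrite scale0r subr0; case: hM.
      move=> b u v [c Mc] [d Md]; exists (b * c + d).
      rewrite scalerDl -scalerA opprD addrACA -scalerBr.
      by case: hM => _; apply.
    suff hs : S `|` (A `|` [set y]) `<=` [set z | exists a : k, M (z - a *: y)].
      exact: (span_min hN hs hx).
    move=> z [Sz|[Az|->]].
    - by exists 0; rewrite scale0r subr0; apply: SM.
    - by exists 0; rewrite scale0r subr0; apply: sub_span; right.
    - by exists 1; rewrite scale1r subrr; case: hM.
  have a0 : a != 0.
    by apply/eqP => a0; apply: nA; move: Ma; rewrite a0 scale0r subr0.
  exists a^-1; have := subspaceZ (- a^-1) hM Ma.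
  by rewrite scalerBr !scaleNr scalerA mulVf // scale1r opprK addrC.
pose xi y : k^o := projT1 (cid (ex y)).
have xiP y : M (y - xi y *: x) := projT2 (cid (ex y)).
have uniq y c : M (y - c *: x) -> xi y = c.
  move=> h; apply/eqP; rewrite -subr_eq0; apply/eqP; apply: contrapT => /eqP d0.
  apply: nA; have := subspaceZ (xi y - c)^-1 hM (subspaceB hM h (xiP y)).
  have -> : y - c *: x - (y - xi y *: x) = (xi y - c) *: x.
    by rewrite opprB [LHS]addrC addrA subrK -scalerBl.
  by rewrite scalerA mulVf // scale1r.
have lxi : linear xi.
  move=> a u v; apply: uniq.
  rewrite scalerDl -scalerA opprD addrACA -scalerBr.
  by case: hM => _; apply; apply: xiP.
exists (mklin lxi); split=> [y Sy|] /=; apply: uniq.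
  by rewrite scale0r subr0; apply: SM.
by rewrite scale1r subrr; case: hM.
Qed.

Lemma linfacP (X Y Z : lmodType k) (i : {linear Y -> Z}) (f : {linear X -> Z}) :
  injective i -> (forall x, exists y, i y = f x) ->
  forall x, i (linfac i f x) = f x.
Proof.
move=> inj ex; pose g x := projT1 (cid (ex x)).
have gE x : i (g x) = f x := projT2 (cid (ex x)).
have lg : linear g by move=> a u v; apply: inj; rewrite linearP !gE linearP.
exact: (@linfacE _ _ _ _ i f (mklin lg)).
Qed.

Lemma injective_lin V W (f : {linear V -> W}) :
  (forall v, f v = 0 -> v = 0) -> injective f.
Proof.
move=> h u v e; apply/eqP; rewrite -subr_eq0; apply/eqP/h.
by rewrite linearB e subrr.
Qed.

Lemma injective0 V W (f : {linear V -> W}) v : injective f -> f v = 0 -> v = 0.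
Proof. by move=> inj e; apply: inj; rewrite e linear0. Qed.

End LinearAlgebra.

Section SubQuo.
Variables (k : fieldType) (V : lmodType k) (G : set V).

Lemma subspP (x : subsp G) : is_subspace G -> G (val x).
Proof. by move=> hG; have /asboolP := valP x; rewrite span_id. Qed.

Definition insubsp (v : V) (hv : G v) : subsp G :=
  SubSp (asboolT (sub_span hv) : spanb G v).

Lemma qprojE0 (v : V) : qproj G v = 0 <-> span G v.
Proof.
have -> : 0 = qproj G 0 by rewrite linear0.
by rewrite qprojP subr0.
Qed.

End SubQuo.

(** * Tensor products *)

Section Sweedler.
Variable k : fieldType.
Implicit Types V W X Y : lmodType k.

Lemma tensor_sum V W (z : V ⨂ W) :
  exists s : seq (V * W), z = \sum_(p <- s) p.1 ⊗ p.2.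
Proof.
have [x <-] := qproj_surj z.
exists [seq (coeff p x *: p.1, p.2) | p <- dom x].
rewrite big_map -{1}[x]freeg_sumE raddf_sum; apply: eq_bigr => -[v w] _ /=.
set c := coeff _ _.
have -> : << c *g (v, w) >> = c *: << (v, w) >> :> {freeg (V * W)%type / k}.
  by apply/eqP/freeg_eqP => t; rewrite coeffZ !coeffU mulrA mulr1.
by rewrite lmZ -[(c *: v) ⊗ w]/(purer w (c *: v)) [in RHS]lmZ.
Qed.

Lemma tensor_ind V W (P : V ⨂ W -> Prop) :
  (forall v w, P (v ⊗ w)) -> (forall y z, P y -> P z -> P (y + z)) ->
  forall z, P z.
Proof.
move=> Pp PD z; have [s ->] := tensor_sum z.
elim: s => [|p s IH]; last by rewrite big_cons; apply: PD.
by rewrite big_nil; have := Pp 0 0; rewrite lm0.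
Qed.

(** Sweedler summation: [sws z F] is the sum of the [F a b] over a chosen
    expression of [z] as a sum of pure tensors [a ⊗ b]; for bilinear [F] it does
    not depend on the choice, and otherwise it may still be rearranged like any
    finite sum. *)
Definition sw V W (z : V ⨂ W) : seq (V * W) := projT1 (cid (tensor_sum z)).

Definition sws V W (X : lmodType k) (z : V ⨂ W) (F : V -> W -> X) : X :=
  \sum_(p <- sw z) F p.1 p.2.

Lemma swsE V W (z : V ⨂ W) : z = sws z (fun a b => a ⊗ b).
Proof. exact: projT2 (cid (tensor_sum z)). Qed.

Lemma sws_lin V W X Y (g : {linear X -> Y}) (z : V ⨂ W) (F : V -> W -> X) :
  g (sws z F) = sws z (fun a b => g (F a b)).
Proof. exact: raddf_sum. Qed.

Lemma eq_sws V W X (z : V ⨂ W) (F G : V -> W -> X) :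
  (forall a b, F a b = G a b) -> sws z F = sws z G.
Proof. by move=> FG; apply: eq_bigr. Qed.

Lemma sws_exch V W V' W' X (z : V ⨂ W) (z' : V' ⨂ W')
    (F : V -> W -> V' -> W' -> X) :
  sws z (fun a b => sws z' (fun c d => F a b c d)) =
  sws z' (fun c d => sws z (fun a b => F a b c d)).
Proof. exact: exchange_big. Qed.

Lemma swsD V W X (z : V ⨂ W) (F G : V -> W -> X) :
  sws z F + sws z G = sws z (fun a b => F a b + G a b).
Proof. by rewrite /sws big_split. Qed.

Lemma sws_tlift V W X (z : V ⨂ W) (F : V -> W -> X) :
  bilinear_op F -> tlift F z = sws z F.
Proof.
by case=> Fr Fl; rewrite {1}(swsE z) sws_lin; apply: eq_sws => a b; apply: tliftE.
Qed.

Lemma sws_pure V W X v w (F : V -> W -> X) :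
  bilinear_op F -> sws (v ⊗ w) F = F v w.
Proof. by move=> hF; rewrite -sws_tlift //; case: hF => hr hl; rewrite tliftE. Qed.

Lemma tlift_pure V W X v w (F : V -> W -> X) :
  bilinear_op F -> tlift F (v ⊗ w) = F v w.
Proof. by case=> hr hl; rewrite tliftE. Qed.

Lemma bilinear_scalel V W (f : {linear V -> k^o}) :
  bilinear_op (fun (a : V) (b : W) => (f a : k) *: b).
Proof. by split=> ? a u v; rewrite ?lmP /= ?scalerDl ?scalerA // scalerDr !scalerA mulrC. Qed.

Lemma bilinear_scaler V W (f : {linear W -> k^o}) :
  bilinear_op (fun (a : V) (b : W) => (f b : k) *: a).
Proof. by split=> ? a u v; rewrite ?lmP /= ?scalerDl ?scalerA // scalerDr !scalerA mulrC. Qed.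

Lemma tensor_ext3 V W X Y (f g : {linear (V ⨂ W) ⨂ X -> Y}) :
  (forall v w x, f ((v ⊗ w) ⊗ x) = g ((v ⊗ w) ⊗ x)) -> forall z, f z = g z.
Proof.
move=> e; apply: tensor_ext => y x.
by apply: (tensor_ext (f := f \o purer x) (g := g \o purer x)) => v w; apply: e.
Qed.

Lemma sws_linear V W X (F : V -> W -> X) :
  bilinear_op F -> linear (fun z => sws z F).
Proof. by move=> hF a u v; rewrite -!sws_tlift // lmP. Qed.

Lemma swsE_tmap V W V' W' X (f : V -> V') (g : W -> W') z (F : V' -> W' -> X) :
  linear f -> linear g -> bilinear_op F ->
  sws (tmap f g z) F = sws z (fun a b => F (f a) (g b)).
Proof.
move=> lf lg hF; rewrite -sws_tlift //.
have hfg : bilinear_op (fun v w => f v ⊗ g w).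
  by split=> [v|w] a x y; rewrite ?lf ?lg ?pure_linearl ?pure_linearr.
rewrite [tmap _ _ _]sws_tlift // sws_lin; apply: eq_sws => a b.
by rewrite sws_tlift // sws_pure.
Qed.

Lemma linP V W (f : {linear V -> W}) : linear f.
Proof. exact: lmP. Qed.

Lemma linear_id V : linear (id : V -> V).
Proof. by []. Qed.

Lemma tmapE V W V' W' (f : {linear V -> V'}) (g : {linear W -> W'}) v w :
  tmap f g (v ⊗ w) = f v ⊗ g w.
Proof.
by rewrite /tmap tliftE // => *; move=> a x y;
  rewrite lmP ?pure_linearr ?pure_linearl.
Qed.

Lemma tmapG V W V' W' (f : V -> V') (g : W -> W') v w : linear f -> linear g ->
  tmap f g (v ⊗ w) = f v ⊗ g w.
Proof. by move=> lf lg; apply: (tmapE (mklin lf) (mklin lg)). Qed.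

Lemma tmap_sq (V1 V2 V2' V3 W1 W2 W2' W3 : lmodType k)
    (f : V1 -> V2) (f' : V2 -> V3) (g : V1 -> V2') (g' : V2' -> V3)
    (h : W1 -> W2) (h' : W2 -> W3) (l : W1 -> W2') (l' : W2' -> W3) :
  linear f -> linear f' -> linear g -> linear g' ->
  linear h -> linear h' -> linear l -> linear l' ->
  (forall v, f' (f v) = g' (g v)) -> (forall w, h' (h w) = l' (l w)) ->
  forall z, tmap f' h' (tmap f h z) = tmap g' l' (tmap g l z).
Proof.
move=> lf lf' lg lg' lh lh' ll ll' ef eh; elim/tensor_ind => [v w|y z hy hz].
  by rewrite (tmapG _ _ lf lh) (tmapG _ _ lf' lh') (tmapG _ _ lg ll) (tmapG _ _ lg' ll') ef eh.
by rewrite !lmD hy hz.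
Qed.

Lemma tmap_tri (V1 V2 V3 W1 W2 W3 : lmodType k)
    (f : V1 -> V2) (f' : V2 -> V3) (g : V1 -> V3)
    (h : W1 -> W2) (h' : W2 -> W3) (l : W1 -> W3) :
  linear f -> linear f' -> linear g -> linear h -> linear h' -> linear l ->
  (forall v, f' (f v) = g v) -> (forall w, h' (h w) = l w) ->
  forall z, tmap f' h' (tmap f h z) = tmap g l z.
Proof.
move=> lf lf' lg lh lh' ll ef eh; elim/tensor_ind => [v w|y z hy hz].
  by rewrite (tmapG _ _ lf lh) (tmapG _ _ lf' lh') (tmapG _ _ lg ll) ef eh.
by rewrite !lmD hy hz.
Qed.

Lemma pureDl V W (u v : V) (w : W) : (u + v) ⊗ w = u ⊗ w + v ⊗ w.
Proof. exact: (lmD (purer w)). Qed.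

Lemma pureDr V W (v : V) (u w : W) : v ⊗ (u + w) = v ⊗ u + v ⊗ w.
Proof. exact: (lmD (pure v)). Qed.

Lemma pureZl V W a (v : V) (w : W) : (a *: v) ⊗ w = a *: (v ⊗ w).
Proof. exact: (lmZ (purer w)). Qed.

Lemma pureZr V W a (v : V) (w : W) : v ⊗ (a *: w) = a *: (v ⊗ w).
Proof. exact: (lmZ (pure v)). Qed.

Lemma pure0l V W (w : W) : (0 : V) ⊗ w = 0.
Proof. exact: (lm0 (purer w)). Qed.

Lemma pure0r V W (v : V) : v ⊗ (0 : W) = 0.
Proof. exact: (lm0 (pure v)). Qed.

Lemma tmapE_idl V W W' (g : {linear W -> W'}) (v : V) w :
  tmap id g (v ⊗ w) = v ⊗ g w.
Proof. exact: (tmapE idfun g). Qed.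

Lemma tmapE_idr V W V' (f : {linear V -> V'}) v (w : W) :
  tmap f id (v ⊗ w) = f v ⊗ w.
Proof. exact: (tmapE f idfun). Qed.

Lemma tmap_sws V W V' W' (f : {linear V -> V'}) (g : {linear W -> W'}) z :
  tmap f g z = sws z (fun a b => f a ⊗ g b).
Proof. by rewrite {1}(swsE z) sws_lin; apply: eq_sws => a b; rewrite tmapE. Qed.

Lemma tmap_sws_idl V W W' (g : {linear W -> W'}) (z : V ⨂ W) :
  tmap id g z = sws z (fun a b => a ⊗ g b).
Proof. exact: (tmap_sws idfun g). Qed.

Lemma tmap_sws_idr V W V' (f : {linear V -> V'}) (z : V ⨂ W) :
  tmap f id z = sws z (fun a b => f a ⊗ b).
Proof. exact: (tmap_sws f idfun). Qed.

Lemma tassocE V W X v w x : tassoc V W X ((v ⊗ w) ⊗ x) = v ⊗ (w ⊗ x).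
Proof.
rewrite /tassoc tliftE.
- exact: (tmapE_idl (purer x)).
- move=> z; elim/tensor_ind: z => [v' w'|y z hy hz] a p q.
    rewrite -[fun w => w ⊗ (a *: p + q)]/(purer (a *: p + q)).
    rewrite -[fun w => w ⊗ p]/(purer p) -[fun w => w ⊗ q]/(purer q).
    by rewrite !tmapE_idl /= /purer !pure_linearr.
  by rewrite !lmD hy hz addrACA.
- by move=> p a y z; rewrite lmP.
Qed.

Definition tassocV V W X : {linear V ⨂ (W ⨂ X) -> (V ⨂ W) ⨂ X} :=
  tlift (fun v z => tmap (pure v) id z).

Lemma tassocVE V W X v w x : tassocV V W X (v ⊗ (w ⊗ x)) = (v ⊗ w) ⊗ x.
Proof.
rewrite /tassocV tliftE ?tmapE_idr //; first by move=> p a y z; rewrite lmP.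
move=> z; elim/tensor_ind: z => [v' w'|y z hy hz] a p q.
  by rewrite !tmapE_idr /= !pure_linearl.
by rewrite !lmD hy hz addrACA.
Qed.

Lemma tassocK V W X : cancel (tassoc V W X) (@tassocV V W X).
Proof.
elim/tensor_ind => [z x|y z]; last by rewrite !lmD => -> ->.
elim/tensor_ind: z => [v w|y z hy hz]; first by rewrite tassocE tassocVE.
by rewrite -[_ ⊗ x]/(purer x _) !lmD /= hy hz.
Qed.

Lemma tassocVK V W X : cancel (@tassocV V W X) (tassoc V W X).
Proof.
elim/tensor_ind => [x z|y z]; last by rewrite !lmD => -> ->.
elim/tensor_ind: z => [v w|y z hy hz]; first by rewrite tassocVE tassocE.
by rewrite !lmD /= hy hz.
Qed.

Definition tswap V W : {linear V ⨂ W -> W ⨂ V} := tlift (fun v w => w ⊗ v).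

Lemma tswapE V W v w : tswap V W (v ⊗ w) = w ⊗ v.
Proof. by rewrite /tswap tliftE => // *; move=> a x y; rewrite ?lmP ?pure_linearl. Qed.

Lemma tswapK V W : cancel (@tswap V W) (@tswap W V).
Proof.
by elim/tensor_ind => [v w|y z]; [rewrite !tswapE|rewrite !lmD => -> ->].
Qed.

End Sweedler.

#[global] Hint Extern 0 (GRing.linear_for _ _) =>
  first [exact: linear_id | exact: pure_linearl | exact: linP] : core.

Section Subspaces.
Variable k : fieldType.
Implicit Types V W X Y : lmodType k.

Definition slice_l V W (xi : V -> k^o) : {linear V ⨂ W -> W} :=
  tlift (fun v w => (xi v : k) *: w).
Definition slice_r V W (xi : W -> k^o) : {linear V ⨂ W -> V} :=
  tlift (fun v w => (xi w : k) *: v).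

Lemma slice_lE V W (xi : {linear V -> k^o}) v (w : W) :
  slice_l W xi (v ⊗ w) = (xi v : k) *: w.
Proof.
rewrite /slice_l tliftE // => v' a x y; rewrite ?lmP /= ?scalerDl ?scalerA //.
Qed.

Lemma slice_rE V W (xi : {linear W -> k^o}) (v : V) w :
  slice_r V xi (v ⊗ w) = (xi w : k) *: v.
Proof.
rewrite /slice_r tliftE // => v' a x y; rewrite ?lmP /= ?scalerDl ?scalerA //.
Qed.

Lemma slice_l_swap V W (xi : {linear V -> k^o}) (z : V ⨂ W) :
  slice_r W xi (tswap V W z) = slice_l W xi z.
Proof.
elim/tensor_ind: z => [v w|y z]; last by rewrite !lmD => -> ->.
by rewrite tswapE slice_lE slice_rE.
Qed.

Lemma tsub_pure V W (A : set V) (B : set W) v w : A v -> B w -> tsub A B (v ⊗ w).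
Proof. by move=> Av Bw; apply: sub_span; exists v, w. Qed.

Lemma subspace_tsub V W (A : set V) (B : set W) : is_subspace (tsub A B).
Proof. exact: is_subspace_span. Qed.

Lemma tsub_sub V W (A : set V) (B : set W) (N : set (V ⨂ W)) :
  is_subspace N -> (forall v w, A v -> B w -> N (v ⊗ w)) -> tsub A B `<=` N.
Proof. by move=> hN h; apply: span_min => // _ [v [w [Av Bw ->]]]; apply: h. Qed.

Lemma tsub_mono V W (A A' : set V) (B B' : set W) :
  A `<=` A' -> B `<=` B' -> tsub A B `<=` tsub A' B'.
Proof.
move=> AA BB; apply: tsub_sub; first exact: subspace_tsub.
by move=> v w /AA Av /BB Bw; apply: tsub_pure.
Qed.

Lemma tsubT V W (z : V ⨂ W) : tsub setT setT z.
Proof.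
elim/tensor_ind: z => [v w|y z hy hz]; first exact: tsub_pure.
exact: (subspaceD (@subspace_tsub _ _ _ _)).
Qed.

Lemma tsub_map V W V' W' (f : {linear V -> V'}) (g : {linear W -> W'})
    (A : set V) (B : set W) (A' : set V') (B' : set W') z :
  (forall v, A v -> A' (f v)) -> (forall w, B w -> B' (g w)) ->
  tsub A B z -> tsub A' B' (tmap f g z).
Proof.
move=> fA gB; apply: (@tsub_sub _ _ A B (tmap f g @^-1` tsub A' B')) => [|v w Av Bw].
  exact: (subspace_preim (tmap f g) (@subspace_tsub _ _ _ _)).
by rewrite /preimage /mkset tmapE; apply: tsub_pure; [apply: fA|apply: gB].
Qed.

(** The last vector of an expression of minimal length is outside the span of
    the others, so that a functional extracts its coefficient. *)
Lemma slice_r_tsub V W (A : set V) (z : V ⨂ W) : is_subspace A ->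
  (forall xi : {linear W -> k^o}, A (slice_r V xi z)) -> tsub A setT z.
Proof.
move=> hA.
have hT := @subspace_tsub V W A setT.
suff H n : forall (f : 'I_n -> V) (w : 'I_n -> W),
    (forall xi : {linear W -> k^o}, A (slice_r V xi (\sum_i f i ⊗ w i))) ->
    tsub A setT (\sum_i f i ⊗ w i).
  have [s ->] := tensor_sum z => hz.
  rewrite (big_nth 0) big_mkord; apply: H; move: hz.
  by rewrite (big_nth 0) big_mkord.
elim: n => [|n IH] f w; first by rewrite big_ord0 => _; case: hT.
set v := f ord_max; set x := w ord_max.
set f0 := fun i => f (widen_ord (leqnSn n) i).
set w0 := fun i => w (widen_ord (leqnSn n) i).
have -> : \sum_i f i ⊗ w i = \sum_(i < n) f0 i ⊗ w0 i + v ⊗ x.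
  by rewrite big_ord_recr.
pose N := [set y : W | exists g : 'I_n -> V, v ⊗ y = \sum_i g i ⊗ w0 i].
have hN : is_subspace N.
  split; first by exists (fun=> 0); rewrite lm0 big1 // => i _; exact: (lm0 (purer _)).
  move=> a y y' [g hg] [g' hg']; exists (fun i => a *: g i + g' i).
  rewrite pure_linearr hg hg' scaler_sumr -big_split; apply: eq_bigr => i _.
  by rewrite pure_linearl.
have [[g hg]|nN] := pselect (N x).
  have -> : \sum_(i < n) f0 i ⊗ w0 i + v ⊗ x = \sum_(i < n) (f0 i + g i) ⊗ w0 i.
    rewrite hg -big_split; apply: eq_bigr => i _.
    by rewrite -[f0 i]scale1r pure_linearl !scale1r.
  exact: IH.
have [xi [xiN xix]] := separating_functional hN nN.
have xiw i : xi (w0 i) = 0.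
  apply: xiN; exists (fun j => if j == i then v else 0).
  rewrite (bigD1 i) //= eqxx big1 ?addr0 // => j /negPf ->.
  exact: (lm0 (purer _)).
move=> h; have Av : A v.
  have := h xi; rewrite lmD lm_sum big1 /= => [|i _].
    by rewrite add0r slice_rE xix scale1r.
  by rewrite slice_rE xiw scale0r.
apply: (subspaceD hT); last exact: tsub_pure.
apply: IH => eta; have := h eta; rewrite lmD slice_rE => h'.
by have := subspaceB hA h' (subspaceZ (eta x) hA Av); rewrite addrK.
Qed.

Lemma slice_l_tsub V W (B : set W) (z : V ⨂ W) : is_subspace B ->
  (forall xi : {linear V -> k^o}, B (slice_l W xi z)) -> tsub setT B z.
Proof.
move=> hB h; have : tsub B setT (tswap _ _ z).
  by apply: slice_r_tsub => // xi; rewrite slice_l_swap.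
move=> hz; rewrite -[z]tswapK.
suff : tsub B setT `<=` (@tswap k W V) @^-1` (tsub setT B) by apply.
apply: tsub_sub => [|w v Bw _]; first exact: subspace_preim (@subspace_tsub _ _ _ _).
by rewrite /preimage /mkset tswapE; apply: tsub_pure.
Qed.

Lemma tsub_slice_r V W (A : set V) (B : set W) (z : V ⨂ W) (xi : {linear W -> k^o}) :
  is_subspace A -> tsub A B z -> A (slice_r V xi z).
Proof.
move=> hA; apply: (@tsub_sub _ _ A B (slice_r V xi @^-1` A)) => [|v w Av _]; first exact: subspace_preim.
by rewrite /preimage /mkset slice_rE; apply: subspaceZ.
Qed.

Lemma tsub_slice_l V W (A : set V) (B : set W) (z : V ⨂ W) (xi : {linear V -> k^o}) :
  is_subspace B -> tsub A B z -> B (slice_l W xi z).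
Proof.
move=> hB; apply: (@tsub_sub _ _ A B (slice_l W xi @^-1` B)) => [|v w _ Bw]; first exact: subspace_preim.
by rewrite /preimage /mkset slice_lE; apply: subspaceZ.
Qed.

Lemma slice_r_tmap V V' W (f : {linear V -> V'}) (xi : {linear W -> k^o}) z :
  slice_r V' xi (tmap f id z) = f (slice_r V xi z).
Proof.
elim/tensor_ind: z => [v w|y z]; last by rewrite !lmD => -> ->.
by rewrite tmapG // !slice_rE lmZ.
Qed.

Lemma slice_l_tmap V W W' (f : {linear W -> W'}) (xi : {linear V -> k^o}) z :
  slice_l W' xi (tmap id f z) = f (slice_l W xi z).
Proof.
elim/tensor_ind: z => [v w|y z]; last by rewrite !lmD => -> ->.
by rewrite tmapG // !slice_lE lmZ.
Qed.

(** Tensoring over a field is exact: [f] kills each slice of [z], and slices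
    detect membership in [V ⊗ X]. *)
Lemma tmap_ker_r V W W' (f : {linear W -> W'}) (z : V ⨂ W) :
  tmap id f z = 0 -> tsub setT [set x | f x = 0] z.
Proof.
move=> h; apply: slice_l_tsub => [|xi]; first exact: subspace_ker.
by rewrite /mkset -slice_l_tmap h lm0.
Qed.

Lemma tmap_ker_l V V' W (f : {linear V -> V'}) (z : V ⨂ W) :
  tmap f id z = 0 -> tsub [set x | f x = 0] setT z.
Proof.
move=> h; apply: slice_r_tsub => [|xi]; first exact: subspace_ker.
by rewrite /mkset -slice_r_tmap h lm0.
Qed.

Lemma tsub0r V W (z : V ⨂ W) : tsub setT [set 0] z -> z = 0.
Proof.
apply: (@tsub_sub _ _ _ _ [set z | z = 0]) => [|v w _ ->]; last by rewrite /mkset lm0.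
by split=> // a u v -> ->; rewrite scaler0 addr0.
Qed.

Lemma tsub0l V W (z : V ⨂ W) : tsub [set 0] setT z -> z = 0.
Proof.
apply: (@tsub_sub _ _ _ _ [set z | z = 0]) => [|v w -> _]; last exact: (lm0 (purer _)).
by split=> // a u v -> ->; rewrite scaler0 addr0.
Qed.

Lemma tmap_inj_r V W W' (f : {linear W -> W'}) :
  injective f -> injective (tmap (id : V -> V) f).
Proof.
move=> inj; apply: injective_lin => z /tmap_ker_r hz; apply: tsub0r.
by move: hz; apply: tsub_mono => // x /injective0; apply.
Qed.

Lemma tmap_inj_l V V' W (f : {linear V -> V'}) :
  injective f -> injective (tmap f (id : W -> W)).
Proof.
move=> inj; apply: injective_lin => z /tmap_ker_l hz; apply: tsub0l.
by move: hz; apply: tsub_mono => // x /injective0; apply.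
Qed.

Lemma tmap_lr V V' W W' (f : {linear V -> V'}) (g : {linear W -> W'}) z :
  tmap f g z = tmap f id (tmap id g z).
Proof.
by elim/tensor_ind: z => [v w|y z]; [rewrite !tmapG //|rewrite !lmD => -> ->].
Qed.

Lemma tmap_rl V V' W W' (f : {linear V -> V'}) (g : {linear W -> W'}) z :
  tmap f g z = tmap id g (tmap f id z).
Proof.
by elim/tensor_ind: z => [v w|y z]; [rewrite !tmapG //|rewrite !lmD => -> ->].
Qed.

Lemma tmap_inj V V' W W' (f : {linear V -> V'}) (g : {linear W -> W'}) :
  injective f -> injective g -> injective (tmap f g).
Proof.
by move=> fi gi x y; rewrite !tmap_lr => /(tmap_inj_l fi) /(tmap_inj_r gi).
Qed.

Lemma tsub_val_l V W (A : set V) (B : set W) z : tsub A B z ->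
  exists2 z' : subsp A ⨂ W, tsub setT B z' & tmap val id z' = z.
Proof.
move=> hz; suff : (tmap (val : subsp A -> V) id @` tsub setT B) z.
  by case=> z' h e; exists z'.
move: hz; apply: tsub_sub => [|v w Av Bw].
  exact: subspace_im (@subspace_tsub _ _ _ _).
exists (insubsp Av ⊗ w); first exact: tsub_pure.
by rewrite tmapG //.
Qed.

(** Lift [z] to [A ⊗ W]. There the projection of [W] modulo [B] kills it, since
    tensoring with [A] into [V] is injective. *)
Lemma tsubI V W (A : set V) (B : set W) (z : V ⨂ W) :
  is_subspace A -> is_subspace B ->
  tsub A setT z -> tsub setT B z -> tsub A B z.
Proof.
move=> hA hB /tsub_val_l[z' _ <-] hz.
have hq : tmap id (qproj B) (tmap (val : subsp A -> V) id z') = 0.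
  move: hz; apply: (@tsub_sub _ _ _ _ [set z | tmap id (qproj B) z = 0]).
    exact: subspace_ker.
  move=> v w _ Bw; rewrite /mkset tmapG // /=.
  by rewrite (proj2 (qprojE0 B w) (sub_span Bw)) lm0.
rewrite -tmap_rl tmap_lr in hq.
have /tmap_ker_r hz' := injective0 (@tmap_inj_l _ _ _ (val : {linear subsp A -> V}) val_inj) hq.
suff : tsub A B (tmap (val : {linear subsp A -> V}) (idfun : {linear W -> W}) z') by [].
move: hz'; apply: tsub_map => [v _|w]; first exact: subspP.
by move/qprojE0; rewrite span_id.
Qed.

Lemma im_tmap V V' W W' (f : {linear V -> V'}) (g : {linear W -> W'})
    (A : set V) (B : set W) z :
  tsub (f @` A) (g @` B) z -> exists2 y, tsub A B y & tmap f g y = z.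
Proof.
move=> hz; suff : (tmap f g @` tsub A B) z by case=> y; exists y.
move: hz; apply: tsub_sub => [|_ _ [v Av <-] [w Bw <-]].
  exact: subspace_im (@subspace_tsub _ _ _ _).
by exists (v ⊗ w); [apply: tsub_pure|rewrite tmapE].
Qed.

End Subspaces.

(** * Sweedler sums, direct sums and diagonal actions *)

Definition trilinear_op (k : fieldType) (V W X Y : lmodType k) (F : V -> W -> X -> Y) :=
  (forall a, bilinear_op (F a)) /\ (forall c, bilinear_op (fun a b => F a b c)).

Section SweedlerMore.
Variable k : fieldType.
Implicit Types V W X Y : lmodType k.

Lemma lin_sws V W X Y (z : V ⨂ W) (F : X -> V -> W -> Y) :
  (forall a b, linear (fun v => F v a b)) -> linear (fun v => sws z (F v)).
Proof.
move=> h a u v; rewrite /sws scaler_sumr -big_split; apply: eq_bigr => p _ /=.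
by rewrite h.
Qed.

Lemma sws_coassoc X Y (d : {linear X -> X ⨂ X}) (F : X -> X -> X -> Y) x :
  (forall x, tassoc _ _ _ (tmap d id (d x)) = tmap id d (d x)) ->
  trilinear_op F ->
  sws (d x) (fun a b => sws (d a) (fun a1 a2 => F a1 a2 b)) =
  sws (d x) (fun a b => sws (d b) (fun b1 b2 => F a b1 b2)).
Proof.
move=> co [h1 h2].
have hb : bilinear_op (fun a z => tlift (F a) z).
  split=> [a|z] s u v; first by rewrite lmP.
  rewrite !sws_tlift //.
  by rewrite (@lin_sws _ _ _ _ z (fun v a b => F v a b)) // => a b; case: (h2 b) => _.
have hG a z : tlift (fun a z => tlift (F a) z) (a ⊗ z) = sws z (F a).
  by rewrite tliftE ?sws_tlift //; case: hb.
have := congr1 (tlift (fun a z => tlift (F a) z)) (co x).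
rewrite tmap_sws_idl sws_lin tmap_sws_idr !sws_lin => e.
transitivity (sws (d x) (fun a b => tlift (fun a z => tlift (F a) z) (tassoc X X X (d a ⊗ b)))).
  apply: eq_sws => a b; rewrite {2}(swsE (d a)) -[_ ⊗ b]/(purer b _) !sws_lin.
  apply: eq_sws => a1 a2; rewrite /= /purer tassocE hG sws_pure //.
rewrite e; apply: eq_sws => a b; exact: hG.
Qed.

End SweedlerMore.

Section DirectSumMaps.
Variables (k : fieldType) (E : nat -> lmodType k).

Lemma dsum_ind (P : dsum E -> Prop) : P 0 ->
  (forall n (u : E n), P (dinj u)) -> (forall y z, P y -> P z -> P (y + z)) ->
  forall z, P z.
Proof.
move=> P0 Pi PD z; have [N hN] := dsum_fin z.
have dE m n (u : E m) : dcomp (dinj u : dsum E) n = if @eqP _ m n is ReflectT e then ecast i (E i) e u else 0 by [].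
elim: N z hN => [|N IH] z hN.
  suff -> : z = 0 by [].
  by apply: dsum_eq => n; rewrite hN.
rewrite -[z](subrK (dinj (dcomp z N))); apply: PD => //.
apply: IH => n; rewrite leq_eqVlt => /orP[/eqP <-|lNn].
  by rewrite /= /dinj_fun; case: eqP => // e; rewrite eq_axiomK /= subrr.
rewrite /= hN // /dinj_fun; case: eqP => [e|_]; last by rewrite subr0.
by exfalso; move: lNn; rewrite e ltnn.
Qed.

Definition dproj_fun n (z : dsum E) : E n := dcomp z n.
Lemma dproj_linear n : linear (dproj_fun n). Proof. by []. Qed.
HB.instance Definition _ n :=
  GRing.isLinear.Build k (dsum E) (E n) _ (dproj_fun n) (@dproj_linear n).
Definition dproj n : {linear dsum E -> E n} := dproj_fun n.

Lemma dprojE n z : dproj n z = dcomp z n. Proof. by []. Qed.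

Lemma dproj_inj n (u : E n) : dproj n (dinj u) = u.
Proof. by rewrite dprojE /= /dinj_fun; case: eqP => // e; rewrite eq_axiomK. Qed.

Lemma dproj_inj_neq m n (u : E m) : m != n -> dproj n (dinj u) = 0.
Proof. by rewrite dprojE /= /dinj_fun; case: eqP. Qed.

Lemma dliftE (X : lmodType k) (f : forall n, E n -> X) :
  (forall n, linear (f n)) -> forall n u, dlift f (dinj u : dsum E) = f n u.
Proof.
move=> lf.
pose N (z : dsum E) := projT1 (cid (dsum_fin z)).
have NP z : forall n, (N z <= n)%N -> dcomp z n = 0 := projT2 (cid (dsum_fin z)).
have f0 n : f n 0 = 0 by apply: (linear0 (mklin (lf n))).
pose g (z : dsum E) := \sum_(i < N z) f i (dcomp z i).
have gE z M : (forall n, (M <= n)%N -> dcomp z n = 0) ->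
    g z = \sum_(0 <= i < M) f i (dcomp z i).
  have big M1 M2 : (M1 <= M2)%N -> (forall n, (M1 <= n)%N -> dcomp z n = 0) ->
      \sum_(0 <= i < M2) f i (dcomp z i) = \sum_(0 <= i < M1) f i (dcomp z i).
    move=> le h; rewrite (big_cat_nat (n := M1)) //= [X in _ + X]big_nat_cond.
    rewrite [X in _ + X]big1 ?addr0 //.
    by move=> i /andP[/andP[/h -> _] _]; rewrite f0.
  move=> hM; rewrite /g -(big_mkord xpredT (fun i => f i (dcomp z i))).
  by case: (leqP (N z) M) => [le|/ltnW le]; rewrite (big _ _ le) //; apply: NP.
have lg : linear g.
  move=> a u v; pose M := maxn (N u) (N v).
  have hu n : (M <= n)%N -> dcomp u n = 0 by rewrite geq_max => /andP[/NP].
  have hv n : (M <= n)%N -> dcomp v n = 0 by rewrite geq_max => /andP[_ /NP].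
  rewrite (gE u M) // (gE v M) // (gE _ M) => [|n Mn]; last first.
    by rewrite /= hu // hv // scaler0 addr0.
  by rewrite scaler_sumr -big_split; apply: eq_bigr => i _ /=; rewrite lf.
have gi n u : g (dinj u) = f n u.
  rewrite (gE _ n.+1) => [|m]; last first.
    by rewrite ltnNge => h; apply: (dproj_inj_neq u); apply: contraNneq h => ->.
  rewrite big_nat_recr //= big_nat_cond big1 ?add0r => [|i /andP[/andP[_ lin] _]].
    by rewrite (dproj_inj u : dinj_fun u n = u).
  have -> : dinj_fun u i = 0 by apply: (dproj_inj_neq u); rewrite neq_ltn lin orbT.
  exact: f0.
move=> n u; exact: (linextE (g := mklin lg) (e := fun p : {n : nat & E n} => dinj (projT2 p)) (fun p => gi _ (projT2 p)) (existT _ n u)).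
Qed.

End DirectSumMaps.

Record is_mc (k : fieldType) (B : modcoalg k) : Prop := IsMc {
  mc_coassoc : forall x,
    tassoc _ _ _ (tmap (mc_delta B) id (mc_delta B x)) =
    tmap id (mc_delta B) (mc_delta B x);
  mc_delta1 : mc_delta B 1 = 1 ⊗ 1;
  mc_deltaM : forall x y, mc_delta B (x * y) =
    sws (mc_delta B x) (fun x1 x2 =>
      sws (mc_delta B y) (fun y1 y2 => (x1 * y1) ⊗ (x2 * y2))) }.

Lemma lmod_bilinear (k : fieldType) (A : algType k) (N : lmodType k) (la : A -> N -> N) :
  is_lmodule la -> bilinear_op la.
Proof. by move=> h; split; [apply: la_linear|apply: la_linearl]. Qed.

Section Diagonal.
Variables (k : fieldType) (B : modcoalg k).
Local Notation X := (mc_alg B).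
Implicit Types M N P : lmodType k.

Lemma bilinear_diag2 M N (aM : X -> M -> M) (aN : X -> N -> N) m n :
  bilinear_op aM -> bilinear_op aN -> bilinear_op (fun y z => aM y m ⊗ aN z n).
Proof.
move=> [_ hM] [_ hN]; split=> ? a u v; first by rewrite hN pure_linearr.
by rewrite hM pure_linearl.
Qed.

Lemma diag_actE M N (aM : X -> M -> M) (aN : X -> N -> N) x m n :
  bilinear_op aM -> bilinear_op aN ->
  diag_act aM aN x (m ⊗ n) = sws (mc_delta B x) (fun y z => aM y m ⊗ aN z n).
Proof.
move=> hM hN; have h m' n' := bilinear_diag2 m' n' hM hN.
case: hM hN => hM _ [hN _].
rewrite /diag_act tliftE ?sws_tlift // => [v|w] a u v'; rewrite !sws_tlift //.
  rewrite (@lin_sws _ _ _ _ _ _ (fun v' y z => aM y v ⊗ aN z v')) // => y z b p q.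
  by rewrite hN pure_linearr.
rewrite (@lin_sws _ _ _ _ _ _ (fun v' y z => aM y v' ⊗ aN z w)) // => y z b p q.
by rewrite hM pure_linearl.
Qed.

Lemma diag_bilinear M N (aM : X -> M -> M) (aN : X -> N -> N) :
  bilinear_op aM -> bilinear_op aN -> bilinear_op (diag_act aM aN).
Proof.
move=> hM hN; split=> [x|z] a u v; first by rewrite lmP.
elim/tensor_ind: z => [m n|y z hy hz]; last by rewrite !lmD hy hz addrACA.
rewrite !diag_actE // lmP.
by rewrite (sws_linear (bilinear_diag2 m n hM hN)).
Qed.

Lemma diag_tmap M N M' N' (aM : X -> M -> M) (aN : X -> N -> N)
    (aM' : X -> M' -> M') (aN' : X -> N' -> N')
    (f : {linear M -> M'}) (g : {linear N -> N'}) x z :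
  bilinear_op aM -> bilinear_op aN -> bilinear_op aM' -> bilinear_op aN' ->
  (forall x m, f (aM x m) = aM' x (f m)) ->
  (forall x n, g (aN x n) = aN' x (g n)) ->
  tmap f g (diag_act aM aN x z) = diag_act aM' aN' x (tmap f g z).
Proof.
move=> hM hN hM' hN' hf hg.
elim/tensor_ind: z => [m n|y z hy hz]; last by rewrite !lmD hy hz.
rewrite diag_actE // tmapE diag_actE // sws_lin; apply: eq_sws => a b.
by rewrite tmapE hf hg.
Qed.

Hypothesis hB : is_mc B.

Lemma sws_mc_coassoc (Y : lmodType k) (F : X -> X -> X -> Y) x : trilinear_op F ->
  sws (mc_delta B x) (fun a b => sws (mc_delta B a) (fun a1 a2 => F a1 a2 b)) =
  sws (mc_delta B x) (fun a b => sws (mc_delta B b) (fun b1 b2 => F a b1 b2)).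
Proof. by move=> hF; apply: sws_coassoc => //; apply: mc_coassoc. Qed.

Lemma diag_assoc M N P (aM : X -> M -> M) (aN : X -> N -> N) (aP : X -> P -> P) x z :
  bilinear_op aM -> bilinear_op aN -> bilinear_op aP ->
  tassoc M N P (diag_act (diag_act aM aN) aP x z) =
  diag_act aM (diag_act aN aP) x (tassoc M N P z).
Proof.
move=> hM hN hP; have hMN := diag_bilinear hM hN; have hNP := diag_bilinear hN hP.
elim/tensor_ind: z => [y p|y z hy hz]; last by rewrite !lmD hy hz.
elim/tensor_ind: y => [m n|y z hy hz]; last by rewrite !(pureDl, lmD) hy hz.
rewrite tassocE !diag_actE // sws_lin.
pose F a b c := aM a m ⊗ (aN b n ⊗ aP c p).
transitivity (sws (mc_delta B x) (fun a b => sws (mc_delta B a) (fun a1 a2 => F a1 a2 b))).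
  apply: eq_sws => a b; rewrite diag_actE // -[_ ⊗ aP b p]/(purer _ _) !sws_lin.
  by apply: eq_sws => c d; rewrite /= /purer tassocE.
rewrite sws_mc_coassoc; last first.
  case: hM hN hP => [_ hM] [_ hN] [_ hP].
  split=> c; split=> ? a u v; rewrite /F ?hM ?hN ?hP ?pure_linearl ?pure_linearr //.
by apply: eq_sws => a b; rewrite diag_actE // sws_lin.
Qed.

Lemma diag_assocV M N P (aM : X -> M -> M) (aN : X -> N -> N) (aP : X -> P -> P) x z :
  bilinear_op aM -> bilinear_op aN -> bilinear_op aP ->
  tassocV M N P (diag_act aM (diag_act aN aP) x z) =
  diag_act (diag_act aM aN) aP x (tassocV M N P z).
Proof.
move=> hM hN hP; rewrite -{1}[z](@tassocVK _ M N P) -diag_assoc //.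
exact: tassocK.
Qed.

Lemma diag_lmod M N (aM : X -> M -> M) (aN : X -> N -> N) :
  is_lmodule aM -> is_lmodule aN -> is_lmodule (diag_act aM aN).
Proof.
move=> lM lN; have hM := lmod_bilinear lM; have hN := lmod_bilinear lN.
have [h1 h2] := diag_bilinear hM hN.
split=> //.
  elim/tensor_ind => [m n|y z hy hz]; last by rewrite !lmD hy hz.
  rewrite diag_actE // mc_delta1 // sws_pure ?(la1 lM) ?(la1 lN) //.
  exact: bilinear_diag2.
move=> x y; elim/tensor_ind => [m n|z z' hz hz']; last by rewrite !lmD hz hz'.
rewrite !diag_actE // mc_deltaM // sws_lin.
have hb := bilinear_diag2 m n hM hN.
rewrite -[LHS](sws_tlift _ hb) sws_lin.
transitivity (sws (mc_delta B x) (fun a b => sws (mc_delta B y) (fun c d =>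
    aM a (aM c m) ⊗ aN b (aN d n)))).
  apply: eq_sws => a b; rewrite sws_lin; apply: eq_sws => c d.
  by rewrite sws_tlift // sws_pure // (laM lM) (laM lN).
rewrite sws_exch; apply: eq_sws => c d.
by rewrite diag_actE.
Qed.

End Diagonal.

(** * Equivariant left comodules *)

Section TensorNaturality.
Variable k : fieldType.
Implicit Types V W X Y : lmodType k.

Lemma subspace_sws V W X (N : set X) (z : V ⨂ W) (F : V -> W -> X) :
  is_subspace N -> (forall a b, N (F a b)) -> N (sws z F).
Proof. by move=> hN h; apply: subspace_sum. Qed.

Lemma tassoc_nat V W X V' W' X' (f : {linear V -> V'}) (g : {linear W -> W'})
    (h : {linear X -> X'}) z :
  tassoc _ _ _ (tmap (tmap f g) h z) = tmap f (tmap g h) (tassoc _ _ _ z).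
Proof.
elim/tensor_ind: z => [y x|y z hy hz]; last by rewrite !lmD hy hz.
elim/tensor_ind: y => [v w|y z hy hz]; last by rewrite !pureDl !lmD hy hz.
by rewrite !tmapE !tassocE !tmapE.
Qed.

Lemma tmap_id V W (z : V ⨂ W) : tmap id id z = z.
Proof.
elim/tensor_ind: z => [v w|y z hy hz]; last by rewrite !lmD hy hz.
exact: (tmapE idfun idfun).
Qed.

Lemma tassoc_purer V W X (y : V ⨂ W) (x : X) :
  tassoc V W X (y ⊗ x) = tmap id (purer x) y.
Proof.
elim/tensor_ind: y => [v w|y z hy hz]; first by rewrite tassocE tmapG //.
by rewrite !pureDl !lmD hy hz.
Qed.

Lemma tassocV_pure V W X (v : V) (y : W ⨂ X) :
  tassocV V W X (v ⊗ y) = tmap (pure v) id y.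
Proof.
elim/tensor_ind: y => [w x|y z hy hz]; first by rewrite tassocVE tmapG //.
by rewrite !lmD hy hz.
Qed.

(** A family of linear maps separating the points of a space still does so
    after tensoring with another space. *)
Lemma jointly_injective_tmap V W (I : Type) (Y : I -> lmodType k)
    (f : forall i, {linear W -> Y i}) :
  (forall w, (forall i, f i w = 0) -> w = 0) ->
  forall z : V ⨂ W, (forall i, tmap id (f i) z = 0) -> z = 0.
Proof.
move=> fI z h; apply: tsub0r; apply: slice_l_tsub => [|xi].
  by split=> // a u v -> ->; rewrite scaler0 addr0.
by apply: fI => i; rewrite -slice_l_tmap h lm0.
Qed.

Lemma jointly_injective_eq W (I : Type) (Y : I -> lmodType k)
    (f : forall i, {linear W -> Y i}) :
  (forall w, (forall i, f i w = 0) -> w = 0) ->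
  forall u v : W, (forall i, f i u = f i v) -> u = v.
Proof.
move=> fI u v h; apply/eqP; rewrite -subr_eq0; apply/eqP; apply: fI => i.
by rewrite lmB h subrr.
Qed.

End TensorNaturality.

Section LeftObjects.
Variables (k : fieldType) (B : modcoalg k).
Implicit Types M N P : bimod B.

(** The axioms on the action and the left coaction, which are all that descent
    uses. They are kept apart from the right coaction because subobjects are first
    known to be stable on the left only. *)
Record is_left M : Prop := IsLeft {
  left_lmod : is_lmodule (@bact k B M);
  left_coassoc : forall m : M,
    tassoc _ _ _ (tmap (mc_comul B) id (blam M m)) = tmap id (blam M) (blam M m);
  left_counit : forall m : M,
    tlift (fun b n => mc_counit B b *: n) (blam M m) = m;
  left_act : forall x (m : M),
    blam M (bact x m) = diag_act (mc_act B) (@bact k B M) x (blam M m) }.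

Definition rho_equivariant M := forall x (m : M),
  brho M (bact x m) = diag_act (@bact k B M) (mc_act B) x (brho M m).

Definition lam_rho_commute M := forall m : M,
  tassoc _ _ _ (tmap (blam M) id (brho M m)) = tmap id (brho M) (blam M m).

Lemma is_bimod_left M : is_bimod M -> is_left M.
Proof.
case=> h1 h2 h3 h4 h5 h6 h7 h8 h9 h10 h11; split=> //.
Qed.

Lemma left_bil M : is_left M -> bilinear_op (@bact k B M).
Proof. by case=> /lmod_bilinear. Qed.

(** The axioms are identities between linear maps into tensor products with [M],
    where a separating family still separates. *)
Lemma is_left_family M (I : Type) (N : I -> bimod B) (f : forall i, {linear M -> N i}) :
  (forall m, (forall i, f i m = 0) -> m = 0) ->
  (forall i x m, f i (bact x m) = bact x (f i m)) ->
  (forall i m, blam (N i) (f i m) = tmap id (f i) (blam M m)) ->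
  bilinear_op (mc_act B) -> (forall i, is_left (N i)) -> is_left M.
Proof.
move=> fI fact flam hC hN.
have fE := jointly_injective_eq fI.
have fI2 := @jointly_injective_tmap _ B _ _ _ _ fI.
have fE2 := @jointly_injective_eq _ _ _ _ (fun i => tmap (id : B -> B) (f i)) fI2.
have fI3 := @jointly_injective_tmap _ B _ _ _ (fun i => tmap (id : B -> B) (f i)) fI2.
have fE3 := @jointly_injective_eq _ _ _ _
   (fun i => tmap (id : B -> B) (tmap (id : B -> B) (f i))) fI3.
have lM : is_lmodule (@bact k B M).
  split=> [x|m|m|x y m].
  - by move=> a u v; apply: fE => i; rewrite lmP !fact lmP (la_linear (left_lmod (hN i))).
  - by move=> a u v; apply: fE => i; rewrite lmP !fact (la_linearl (left_lmod (hN i))).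
  - by apply: fE => i; rewrite fact (la1 (left_lmod (hN i))).
  - by apply: fE => i; rewrite !fact (laM (left_lmod (hN i))).
have bM := lmod_bilinear lM.
split=> // [m|m|x m].
- apply: fE3 => i.
  have -> : tmap id (tmap id (f i)) (tmap id (blam M) (blam M m)) =
            tmap id (blam (N i)) (tmap id (f i) (blam M m)).
    elim/tensor_ind: (blam M m) => [b n|y z hy hz]; last by rewrite !lmD hy hz.
    by rewrite !tmapG // flam.
  rewrite -flam -(left_coassoc (hN i)) flam.
  elim/tensor_ind: (blam M m) => [b n|y z hy hz]; last by rewrite !lmD hy hz.
  rewrite !tmapG //; elim/tensor_ind: (mc_comul B b) => [c d|y z hy hz].
    by rewrite !tassocE !tmapG //.
  by rewrite !pureDl !lmD hy hz.
- apply: fE => i; rewrite -[RHS](left_counit (hN i)) flam.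
  have eb N0 : bilinear_op (fun (b : B) (n : N0) => (mc_counit B b : k) *: n).
    by split=> ? a u v; rewrite ?lmP /= ?scalerDl ?scalerA // scalerDr !scalerA mulrC.
  elim/tensor_ind: (blam M m) => [b n|y z hy hz]; last by rewrite !lmD hy hz.
  by rewrite tmapG // !(sws_tlift _ (eb _)) !sws_pure // lmZ.
- apply: fE2 => i; rewrite -flam fact (left_act (hN i)) flam.
  by rewrite (@diag_tmap _ _ _ _ _ _ _ _ (mc_act B) (@bact k B (N i)) idfun (f i)) //;
    apply: left_bil.
Qed.

Lemma sub_bimod_left M (N : set M) : bilinear_op (mc_act B) -> is_left M ->
  is_subspace N -> (forall x u, N u -> N (bact x u)) ->
  (forall u, N u -> tsub setT N (blam M u)) ->
  [/\ is_left (sub_bimod N),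
      forall x (n : subsp N), val (@bact k B (sub_bimod N) x n) = bact x (val n) &
      forall n : subsp N, tmap id val (blam (sub_bimod N) n) = blam M (val n)].
Proof.
move=> hC hM hN Nact Nlam; pose i : {linear subsp N -> M} := val.
have ii : injective i by apply: val_inj.
have act x (n : subsp N) : val (@bact k B (sub_bimod N) x n) = bact x (val n).
  have lb : linear (fun n => bact x (i n)).
    by move=> a u v; rewrite lmP (la_linear (left_lmod hM)).
  apply: (@linfacP _ _ _ _ i (mklin lb)) => // u.
  by exists (insubsp (Nact x _ (subspP u hN))).
have lam (n : subsp N) : tmap id val (blam (sub_bimod N) n) = blam M (val n).
  apply: (@linfacP _ _ _ _ (tmap id i) (blam M \o i)) => [|u].
    exact: tmap_inj_r.
  have h : tsub (range idfun) (i @` setT) (blam M (val u)).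
    move: (Nlam _ (subspP u hN)); apply: tsub_mono => [c _|v Nv]; first by exists c.
    by exists (insubsp Nv).
  by have [y _ e] := im_tmap h; exists y.
split=> //.
pose f (_ : unit) : {linear sub_bimod N -> M} := val.
apply: (@is_left_family _ unit (fun=> M) f) => // m /(_ tt).
exact: (injective0 ii).
Qed.

Lemma blam_tensE M N (z : M ⨂ N) :
  blam (tens_bimod M N) z = tassoc _ _ _ (tmap (blam M) id z).
Proof.
elim/tensor_ind: z => [m n|y z hy hz]; last by rewrite !lmD hy hz.
rewrite tmapG // tassoc_purer /= tliftE // => [v|w] a u v'; last by rewrite !lmP.
elim/tensor_ind: (blam M v) => [c p|y z hy hz]; last by rewrite !lmD hy hz addrACA.
by rewrite !tmapG // !pure_linearr.
Qed.

Lemma brho_tensE M N (z : M ⨂ N) :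
  brho (tens_bimod M N) z = tassocV _ _ _ (tmap id (brho N) z).
Proof.
elim/tensor_ind: z => [m n|y z hy hz]; last by rewrite !lmD hy hz.
rewrite tmapG // tassocV_pure /= tliftE // => [v|w] a u v'; first by rewrite !lmP.
elim/tensor_ind: (brho N w) => [c p|y z hy hz]; last by rewrite !lmD hy hz addrACA.
by rewrite !tmapE_idr /= !pure_linearl.
Qed.

Lemma blam_tens M N (m : M) (n : N) :
  blam (tens_bimod M N) (m ⊗ n) = tmap id (purer n) (blam M m).
Proof. by rewrite blam_tensE tmapG // tassoc_purer. Qed.

Lemma brho_tens M N (m : M) (n : N) :
  brho (tens_bimod M N) (m ⊗ n) = tmap (pure m) id (brho N n).
Proof. by rewrite brho_tensE tmapG // tassocV_pure. Qed.

Lemma lam_rho_tens M N : lam_rho_commute (tens_bimod M N).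
Proof.
elim/tensor_ind => [m n|y z hy hz]; last by rewrite !lmD hy hz.
transitivity (sws (brho N n) (fun n' c => sws (blam M m) (fun b m' =>
    b ⊗ ((m' ⊗ n') ⊗ c)))).
  rewrite brho_tens (tmap_sws_idr (pure m)) !sws_lin; apply: eq_sws => n' c.
  rewrite tmapG // blam_tens tmap_sws_idl tassoc_purer sws_lin; apply: eq_sws => b m'.
  by rewrite tmapG.
rewrite sws_exch blam_tens (tmap_sws_idl (purer n)) sws_lin; apply: eq_sws => b m'.
by rewrite tmapG // brho_tens (tmap_sws_idr (pure m')) sws_lin.
Qed.


Hypothesis hB : is_mc B.
Hypothesis hC : is_left (unit_bimod B).
Let bC : bilinear_op (mc_act B) := left_bil hC.

Lemma tens_left M N : is_left M -> is_left N -> is_left (tens_bimod M N).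
Proof.
move=> hM hN; have bM := left_bil hM; have bN := left_bil hN.
split=> [|z|z|x z].
- exact: diag_lmod (left_lmod hM) (left_lmod hN).
- elim/tensor_ind: z => [m n|y z hy hz]; last by rewrite !lmD hy hz.
  rewrite blam_tens.
  have -> : tassoc _ _ _ (tmap (mc_comul B) id (tmap id (purer n) (blam M m))) =
      tmap id (tmap id (purer n)) (tassoc _ _ _ (tmap (mc_comul B) id (blam M m))).
    elim/tensor_ind: (blam M m) => [b m'|y z hy hz]; last by rewrite !lmD hy hz.
    rewrite !tmapG //; elim/tensor_ind: (mc_comul B b) => [c d|y z hy hz].
      by rewrite !tassocE !tmapG //.
    by rewrite !pureDl !lmD hy hz.
  rewrite left_coassoc //.
  elim/tensor_ind: (blam M m) => [b m'|y z hy hz]; last by rewrite !lmD hy hz.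
  by rewrite !tmapG // -blam_tens.
- have eb N0 := @bilinear_scalel k B N0 (mc_counit B).
  elim/tensor_ind: z => [m n|y z hy hz]; last by rewrite !lmD hy hz.
  rewrite blam_tens -{2}(left_counit hM m).
  elim/tensor_ind: (blam M m) => [b m'|y z hy hz].
    rewrite tmapG // !(sws_tlift _ (eb _)) !sws_pure //.
    by rewrite pureZl.
  by rewrite !lmD pureDl hy hz.
- rewrite !blam_tensE.
  have -> : tmap (blam M) id (bact x z) =
      diag_act (diag_act (mc_act B) (@bact k B M)) (@bact k B N) x (tmap (blam M) id z).
    apply: (@diag_tmap _ _ _ _ _ _ _ _ _ _ (blam M) idfun) => //.
      exact: diag_bilinear.
    by move=> y m; apply: left_act.
  exact: diag_assoc.
Qed.

Lemma tens_rho_equivariant M N : is_left M -> is_left N -> rho_equivariant N ->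
  rho_equivariant (tens_bimod M N).
Proof.
move=> hM hN rN x z; have bM := left_bil hM; have bN := left_bil hN.
rewrite !brho_tensE.
have -> : tmap id (brho N) (bact x z) =
    diag_act (@bact k B M) (diag_act (@bact k B N) (mc_act B)) x (tmap id (brho N) z).
  apply: (@diag_tmap _ _ _ _ _ _ _ _ _ _ idfun (brho N)) => //.
  exact: diag_bilinear.
exact: diag_assocV.
Qed.

End LeftObjects.

(** * Stable subspaces and cotensor products *)

Section Stable.
Variables (k : fieldType) (B : modcoalg k).
Implicit Types M N P V : bimod B.
Hypothesis hB : is_mc B.
Hypothesis hC : is_left (unit_bimod B).
Let bC : bilinear_op (mc_act B) := left_bil hC.

Definition left_stable M (N : set M) : Prop :=
  [/\ is_subspace N, forall x u, N u -> N (bact x u) &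
      forall u, N u -> tsub setT N (blam M u)].

Lemma left_stableT M : left_stable [set: M].
Proof. by split=> // u _; apply: tsubT. Qed.

Lemma left_stableI M (N P : set M) :
  left_stable N -> left_stable P -> left_stable (N `&` P).
Proof.
move=> [hN Na Nl] [hP Pa Pl]; split; first exact: subspaceI.
  by move=> x u [Nu Pu]; split; [apply: Na|apply: Pa].
move=> u [Nu Pu]; apply: slice_l_tsub => [|xi]; first exact: subspaceI.
by split; apply: tsub_slice_l; [|apply: Nl| |apply: Pl].
Qed.

Lemma tsub_act M N (A : set M) (D : set N) : is_left M -> is_left N ->
  (forall x a, A a -> A (bact x a)) -> (forall x a, D a -> D (bact x a)) ->
  forall x u, tsub A D u -> tsub A D (@bact k B (tens_bimod M N) x u).
Proof.
move=> hM hN Aa Da x u.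
pose f : {linear M ⨂ N -> M ⨂ N} := diag_act (@bact k B M) (@bact k B N) x.
apply: (@tsub_sub _ _ _ A D (f @^-1` tsub A D)) => [|v w Av Dw].
  exact: subspace_preim (@subspace_tsub _ _ _ _ _).
rewrite /preimage /mkset /f diag_actE; try exact: left_bil.
apply: subspace_sws => [|a b]; first exact: subspace_tsub.
by apply: tsub_pure; [apply: Aa|apply: Da].
Qed.

Lemma left_stable_tsub M N (A : set M) (D : set N) : is_left M -> is_left N ->
  left_stable A -> (forall x a, D a -> D (bact x a)) ->
  left_stable (tsub A D : set (tens_bimod M N)).
Proof.
move=> hM hN [hA Aa Al] Da; split; first exact: subspace_tsub.
  exact: tsub_act.
move=> u; pose P : set (B ⨂ tens_bimod M N) := tsub setT (tsub A D).
apply: (@tsub_sub _ _ _ A D (blam (tens_bimod M N) @^-1` P)) => [|v w Av Dw].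
  exact: subspace_preim (@subspace_tsub _ _ _ _ _).
rewrite /preimage /mkset blam_tens.
apply: (@tsub_map _ _ _ _ _ idfun (purer w) setT A) => //; last exact: Al.
by move=> m Am; apply: tsub_pure.
Qed.

Definition cotens_diff M N : {linear M ⨂ N -> M ⨂ (B ⨂ N)} :=
  ((tassoc _ _ _ \o tmap (brho M) id) \- tmap id (blam N))%R.

Lemma cotensorE M N (u : M ⨂ N) : cotensor M N u <-> cotens_diff M N u = 0.
Proof.
split=> [h|/eqP]; first by apply/eqP; rewrite /cotens_diff /= subr_eq0; apply/eqP.
by rewrite /cotens_diff /= subr_eq0 => /eqP.
Qed.

Lemma subspace_cotensor M N : is_subspace (cotensor M N).
Proof.
have -> : cotensor M N = [set u | cotens_diff M N u = 0].
  by apply/seteqP; split=> u /cotensorE.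
exact: subspace_ker.
Qed.

(** The defect [cotens_diff] of the cotensor condition is equivariant, and the
    left coaction applied before or after it gives the same result. *)
Lemma left_stable_cotensor M N : is_left M -> is_left N -> rho_equivariant M ->
  lam_rho_commute M -> left_stable (cotensor M N : set (tens_bimod M N)).
Proof.
move=> hM hN rM cM; have bM := left_bil hM; have bN := left_bil hN.
split; first exact: subspace_cotensor.
  move=> x u e; rewrite /cotensor /mkset.
  have -> : tmap (brho M) id (@bact k B (tens_bimod M N) x u) =
      diag_act (diag_act (@bact k B M) (mc_act B)) (@bact k B N) x (tmap (brho M) id u).
    apply: (@diag_tmap _ _ _ _ _ _ _ _ _ _ (brho M) idfun) => //.
    exact: diag_bilinear.
  rewrite diag_assoc // e.
  symmetry; apply: (@diag_tmap _ _ _ _ _ _ _ _ _ _ idfun (blam N)) => //.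
    exact: diag_bilinear.
  by move=> y m; apply: left_act.
move=> u /cotensorE e.
have -> : cotensor M N = [set u | cotens_diff M N u = 0].
  by apply/seteqP; split=> v /cotensorE.
suff h : tmap id (cotens_diff M N) (blam (tens_bimod M N) u) = 0.
  exact: (tmap_ker_r h).
pose L : {linear M ⨂ (B ⨂ N) -> B ⨂ (M ⨂ (B ⨂ N))} :=
  tassoc _ _ _ \o tmap (blam M) id.
suff -> : tmap id (cotens_diff M N) (blam (tens_bimod M N) u) = L (cotens_diff M N u).
  by rewrite e lm0.
elim/tensor_ind: u {e} => [m n|y z hy hz]; last first.
  by move: (cotens_diff M N) L hy hz => D L hy hz; rewrite !lmD hy hz.
rewrite /cotens_diff /= blam_tens.
have -> : tmap id ((tassoc _ _ _ \o tmap (brho M) id) \- tmap id (blam N))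
      (tmap id (purer n) (blam M m)) =
    tmap id (tassoc _ _ _ \o purer n) (tmap id (brho M) (blam M m)) -
    tmap id (purer (blam N n)) (blam M m) :> B ⨂ (M ⨂ (B ⨂ N)).
  elim/tensor_ind: (blam M m) => [b m'|y z hy hz].
    by rewrite !tmapG //= !tmapG // -lmB.
  by rewrite !lmD hy hz addrACA.
rewrite !tmapG // 2!lmB -cM; congr (_ - _); last by rewrite tmapG // tassoc_purer.
rewrite tassoc_purer.
elim/tensor_ind: (brho M m) => [m' c|y z hy hz]; last by rewrite !lmD hy hz.
rewrite !tmapG //= tassoc_purer.
elim/tensor_ind: (blam M m') => [b m''|y z hy hz]; last by rewrite !(pureDl, lmD) hy hz.
by rewrite !tassocE !tmapG //= /purer tassocE.
Qed.

Lemma blam_tassoc M N P (u : tens_bimod (tens_bimod M N) P) :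
  blam (tens_bimod M (tens_bimod N P)) (tassoc M N P u) =
  tmap id (tassoc M N P) (blam (tens_bimod (tens_bimod M N) P) u).
Proof.
move: u; apply: (tensor_ext3 (f := blam (tens_bimod M (tens_bimod N P)) \o tassoc M N P)
  (g := tmap id (tassoc M N P) \o blam (tens_bimod (tens_bimod M N) P))) => m n p.
apply: etrans (congr1 (blam (tens_bimod M (tens_bimod N P))) (tassocE m n p)) _.
apply: etrans (@blam_tens k B M (tens_bimod N P) m (n ⊗ p)) _; apply/esym.
apply: etrans (congr1 (tmap id (tassoc M N P)) (@blam_tens k B (tens_bimod M N) P (m ⊗ n) p)) _.
rewrite blam_tens (@tmap_tri _ _ _ _ _ _ _ id id id (purer n) (purer p) (purer p \o purer n)) //.
apply: tmap_tri => // m'; exact: tassocE.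
Qed.

Lemma left_stable_tassoc M N P (S : set (tens_bimod (tens_bimod M N) P)) :
  is_left M -> is_left N -> is_left P -> left_stable S ->
  left_stable (tassoc M N P @` S : set (tens_bimod M (tens_bimod N P))).
Proof.
move=> hM hN hP [hS Sa Sl]; split; first exact: subspace_im.
  move=> x _ [u Su <-]; exists (@bact k B (tens_bimod (tens_bimod M N) P) x u).
    exact: Sa.
  by apply: diag_assoc => //; apply: left_bil.
move=> _ [u Su <-].
rewrite blam_tassoc.
apply: (@tsub_map _ _ _ _ _ idfun (tassoc M N P) setT S) => //.
exact: Sl.
Qed.

Lemma tpow_left V m : is_left V -> is_left (tpow V m).
Proof. by move=> hV; elim: m => //= m IH; apply: tens_left. Qed.

Lemma tcomp_left V n : is_left V -> is_left (tcomp V n).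
Proof. by move=> hV; case: n => //= m; apply: tpow_left. Qed.

Lemma tpow_rho_equivariant V m : is_left V -> rho_equivariant V ->
  rho_equivariant (tpow V m).
Proof.
move=> hV rV; elim: m => //= m IH.
by apply: tens_rho_equivariant => //; apply: tpow_left.
Qed.

Section Powers.
Variable V : bimod B.
Hypothesis hV : is_left V.
Hypothesis rV : rho_equivariant V.
Hypothesis cV : lam_rho_commute V.

Lemma cotensor_pow_stable m : left_stable (@cotensor_pow k B V m).
Proof.
elim: m => [|m [_ IHa _]]; first exact: left_stableT.
have hm := tpow_left m hV.
apply: (@left_stableI (tens_bimod V (tpow V m))); last exact: left_stable_cotensor.
by apply: left_stable_tsub => //; apply: left_stableT.
Qed.

Lemma cotensor_at_stable (R : set (V ⨂ V)) i m :
  left_stable (R : set (tens_bimod V V)) -> (i < m)%N ->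
  left_stable (@cotensor_at k B V R i m).
Proof.
move=> hR; elim: m i => // m IH [_|i lim].
  case: m {IH} => [|m]; first exact: hR.
  have hm := tpow_left m hV; have hVV := tens_left hB hC hV hV.
  apply: (@left_stable_tassoc V V (tpow V m)) => //.
  apply: (@left_stableI (tens_bimod (tens_bimod V V) (tpow V m))).
    by apply: left_stable_tsub => //; case: (cotensor_pow_stable m).
  by apply: left_stable_cotensor => //; [apply: tens_rho_equivariant|apply: lam_rho_tens].
have hm := tpow_left m hV.
apply: (@left_stableI (tens_bimod V (tpow V m))); last exact: left_stable_cotensor.
apply: left_stable_tsub => //; first exact: left_stableT.
by case: (IH i lim).
Qed.

Local Notation TS := (tspace_bimod V).

Lemma bact_inj x n (u : tcomp V n) :
  @bact k B TS x (dinj u) = dinj (bact x u : tcomp V n).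
Proof.
rewrite [LHS]dliftE // => m a v w.
by rewrite (la_linear (left_lmod (tcomp_left m hV))) lmP.
Qed.

Lemma blam_inj n (u : tcomp V n) :
  blam TS (dinj u) = tmap id (@dinj k (tcomp V) n) (blam (tcomp V n) u).
Proof. by rewrite [LHS]dliftE // => m a v w; rewrite !lmP. Qed.

Lemma brho_inj n (u : tcomp V n) :
  brho TS (dinj u) = tmap (@dinj k (tcomp V) n) id (brho (tcomp V n) u).
Proof. by rewrite [LHS]dliftE // => m a v w; rewrite !lmP. Qed.

Lemma tspace_bactD x (y z : TS) : @bact k B TS x (y + z) = bact x y + bact x z.
Proof. exact: lmD. Qed.

Lemma dproj_bact n x (z : TS) :
  dproj (tcomp V) n (bact x z) = bact x (dproj (tcomp V) n z : tcomp V n).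
Proof.
have hn := left_lmod (tcomp_left n hV).
have l0 : bact x (0 : tcomp V n) = 0 by apply: (lm0 (mklin (la_linear hn x))).
have lD (u v : tcomp V n) : bact x (u + v) = bact x u + bact x v.
  exact: (lmD (mklin (la_linear hn x))).
elim/dsum_ind: z => [|m u|y z hy hz].
- have -> : @bact k B TS x 0 = 0 by apply: (lm0 (dlift _)).
  by rewrite lm0 l0.
- rewrite bact_inj; have [e|ne] := eqVneq m n; first by subst m; rewrite !dproj_inj.
  by rewrite !dproj_inj_neq ?l0.
- by rewrite tspace_bactD !lmD lD hy hz.
Qed.

Lemma dproj_blam n (z : TS) :
  blam (tcomp V n) (dproj (tcomp V) n z) = tmap id (dproj (tcomp V) n) (blam TS z).
Proof.
elim/dsum_ind: z => [|m u|y z hy hz]; [by rewrite !lm0| |by rewrite !lmD hy hz].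
rewrite blam_inj; have [e|ne] := eqVneq m n.
  subst m; rewrite dproj_inj.
  elim/tensor_ind: (blam _ u) => [b v|y z hy hz]; last by rewrite !lmD -hy -hz.
  by rewrite !tmapG // dproj_inj.
rewrite dproj_inj_neq // lm0.
elim/tensor_ind: (blam _ u) => [b v|y z hy hz]; last by rewrite !lmD -hy -hz addr0.
by rewrite !tmapG // dproj_inj_neq // pure0r.
Qed.

Lemma tspace_left : is_left TS.
Proof.
apply: (@is_left_family _ _ TS nat (tcomp V) (fun n => dproj (tcomp V) n)) => //.
- by move=> m h; apply: dsum_eq => n; apply: h.
- by move=> n x m; apply: dproj_bact.
- by move=> n m; apply: dproj_blam.
- by move=> n; apply: tcomp_left.
Qed.

Lemma coquad_stable (R : set (V ⨂ V)) :
  left_stable (R : set (tens_bimod V V)) ->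
  left_stable ([set z : TS | forall m i, (i < m)%N -> cotensor_at R i (dcomp z m.+1)]).
Proof.
move=> hR; have st m i (lim : (i < m)%N) := cotensor_at_stable hR lim.
have sN : is_subspace [set z : TS | forall m i, (i < m)%N -> cotensor_at R i (dcomp z m.+1)].
  split=> [m i lim|a u v hu hv m i lim]; case: (st m i lim) => -[h0 hL] _ _ //.
  by apply: hL; [apply: hu|apply: hv].
split=> // [x u hu m i lim|u hu].
  by have := dproj_bact m.+1 x u; rewrite !dprojE => ->; case: (st m i lim) => _ h _; apply/h/hu.
apply: slice_l_tsub => // xi m i lim.
rewrite -dprojE -slice_l_tmap -dproj_blam.
by case: (st m i lim) => h0 _ hl; apply: tsub_slice_l => //; apply: hl (hu _ _ lim).
Qed.

End Powers.
End Stable.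

(** * Relative tensor products and Hopf algebra identities *)

Section QuotientLift.
Variable k : fieldType.

Lemma quo_lift (V X : lmodType k) (G : set V) (g : {linear V -> X}) :
  (forall v, G v -> g v = 0) ->
  exists g' : {linear quo G -> X}, forall v, g' (qproj G v) = g v.
Proof.
move=> hg; have ker : span G `<=` [set v | g v = 0].
  by apply: span_min => //; apply: subspace_ker.
pose g' (z : quo G) : X := g (repr z).
have gE v : g' (qproj G v) = g v.
  apply/eqP; rewrite -subr_eq0 -lmB; apply/eqP/ker/qprojP.
  by rewrite /g' /qproj reprK.
have lg : linear g'.
  move=> a x y; have [u <-] := qproj_surj x; have [v <-] := qproj_surj y.
  by rewrite -lmP !gE lmP.
by exists (mklin lg).
Qed.

Variables (A : Type) (M N : lmodType k) (ra : M -> A -> M) (la : A -> N -> N).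
Local Notation rp := (rpure ra la).

Lemma bilinear_rpure : bilinear_op rp.
Proof.
split=> [m|n] a u v; rewrite /rpure ?pure_linearr ?pure_linearl; exact: lmP.
Qed.

Lemma rpure_balanced m a n : rp (ra m a) n = rp m (la a n).
Proof. by apply/qprojP; apply: sub_span; exists m, a, n. Qed.

Lemma rpureDl m m' n : rp (m + m') n = rp m n + rp m' n.
Proof. by rewrite /rpure pureDl lmD. Qed.
Lemma rpureDr m n n' : rp m (n + n') = rp m n + rp m n'.
Proof. by rewrite /rpure pureDr lmD. Qed.
Lemma rpureZl a m n : rp (a *: m) n = a *: rp m n.
Proof. by rewrite /rpure pureZl lmZ. Qed.
Lemma rpureZr a m n : rp m (a *: n) = a *: rp m n.
Proof. by rewrite /rpure pureZr lmZ. Qed.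

Lemma rtensor_ind (P : rtensor ra la -> Prop) :
  (forall m n, P (rp m n)) -> (forall y z, P y -> P z -> P (y + z)) ->
  forall z, P z.
Proof.
move=> Pp PD z; have [y <-] := qproj_surj z.
elim/tensor_ind: y => [m n|y y' hy hy']; first exact: Pp.
by rewrite lmD; apply: PD.
Qed.

Lemma rtensor_ext (X : lmodType k) (f g : {linear rtensor ra la -> X}) :
  (forall m n, f (rp m n) = g (rp m n)) -> forall z, f z = g z.
Proof. by move=> fg; elim/rtensor_ind => // y z hy hz; rewrite !lmD hy hz. Qed.

Lemma rliftE (X : lmodType k) (f : M -> N -> X) : bilinear_op f ->
  (forall m a n, f (ra m a) n = f m (la a n)) ->
  forall m n, rlift ra la f (rp m n) = f m n.
Proof.
move=> hf bal; have fE m n : tlift f (m ⊗ n) = f m n by case: hf => h1 h2; rewrite tliftE.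
have [|g gE] := @quo_lift _ _ (balanced_rel ra la) (tlift f).
  by move=> _ [m [a [n ->]]]; rewrite lmB !fE bal subrr.
move=> m n; apply: (linextE (g := g) (e := fun p : M * N => rp p.1 p.2) _ (m, n)).
by move=> p; rewrite /rpure gE fE.
Qed.

End QuotientLift.

Lemma sws_linG (k : fieldType) (V W X Y : lmodType k) (g : X -> Y) (z : V ⨂ W)
    (F : V -> W -> X) : linear g -> g (sws z F) = sws z (fun a b => g (F a b)).
Proof. by move=> lg; apply: (sws_lin (mklin lg)). Qed.

Lemma sws_linE (k : fieldType) (V W X Y : lmodType k) (g : X -> Y) (z : V ⨂ W)
    (F : V -> W -> X) x : linear g -> sws z F = x -> sws z (fun a b => g (F a b)) = g x.
Proof. by move=> lg <-; rewrite (sws_linG _ _ lg). Qed.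

Lemma linear_scale (k : fieldType) (V : lmodType k) (a : k) : linear ( *:%R a : V -> V).
Proof. by move=> s u v; rewrite scalerDr !scalerA mulrC. Qed.

Section Hopf.
Variables (k : fieldType) (U : hopfAlg k).
Local Notation Delta := (hdelta U).
Local Notation eps := (heps U).
Local Notation S := (hS U).
Implicit Types X Y : lmodType k.

Lemma linear_mulr (a : U) : linear (fun x : U => x * a).
Proof. by move=> s u v; rewrite mulrDl scalerAl. Qed.
Lemma linear_mull (a : U) : linear (fun x : U => a * x).
Proof. by move=> s u v; rewrite mulrDr scalerAr. Qed.

Lemma h_coassoc Y (F : U -> U -> U -> Y) x : trilinear_op F ->
  sws (Delta x) (fun a b => sws (Delta a) (fun a1 a2 => F a1 a2 b)) =
  sws (Delta x) (fun a b => sws (Delta b) (fun b1 b2 => F a b1 b2)).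
Proof. by move=> hF; apply: sws_coassoc => //; apply: hdelta_coassoc. Qed.

Lemma h_counitl Y (G : U -> Y) x : linear G ->
  sws (Delta x) (fun a b => (eps a : k) *: G b) = G x.
Proof.
move=> lG; rewrite -{2}(heps_counitl x) sws_tlift.
  rewrite (sws_linG _ _ lG); apply: eq_sws => a b.
  exact/esym/(lmZ (mklin lG)).
exact: bilinear_scalel.
Qed.

Lemma h_counitr Y (G : U -> Y) x : linear G ->
  sws (Delta x) (fun a b => (eps b : k) *: G a) = G x.
Proof.
move=> lG; rewrite -{2}(heps_counitr x) sws_tlift.
  rewrite (sws_linG _ _ lG); apply: eq_sws => a b.
  exact/esym/(lmZ (mklin lG)).
exact: bilinear_scaler.
Qed.

Lemma h_deltaM Y (F : U -> U -> Y) x y : bilinear_op F ->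
  sws (Delta (x * y)) F = sws (Delta x) (fun a b => sws (Delta y) (fun c d => F (a * c) (b * d))).
Proof.
move=> hF; rewrite -(sws_tlift _ hF) hdeltaM.
have hb1 a b : bilinear_op (fun c d : U => (a * c) ⊗ (b * d)).
  by split=> ? s u v; rewrite linear_mull ?pure_linearl ?pure_linearr.
rewrite [X in tlift F X]sws_tlift; last first.
  split=> ? s u v; rewrite !sws_tlift //.
    by rewrite (@lin_sws _ _ _ _ _ _ (fun v c d => (_ * c) ⊗ (v * d))) // => ? ? ? ? ?; rewrite linear_mulr pure_linearr.
  by rewrite (@lin_sws _ _ _ _ _ _ (fun v c d => (v * c) ⊗ (_ * d))) // => ? ? ? ? ?; rewrite linear_mulr pure_linearl.
rewrite sws_lin; apply: eq_sws => a b.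
rewrite [X in tlift F X]sws_tlift // sws_lin.
by apply: eq_sws => c d; rewrite sws_tlift // sws_pure.
Qed.

Lemma h_antil x : sws (Delta x) (fun a b => S a * b) = (eps x : k) *: 1.
Proof.
rewrite -hSl sws_tlift //.
by split=> ? s u v; rewrite ?lmP ?linear_mull ?linear_mulr.
Qed.

Lemma h_antir x : sws (Delta x) (fun a b => a * S b) = (eps x : k) *: 1.
Proof.
rewrite -hSr sws_tlift //.
by split=> ? s u v; rewrite ?lmP ?linear_mull ?linear_mulr.
Qed.

(** Both sides are convolution inverse to the multiplication of [U]: insert
    [x_(2) y_(2) S(y_(3)) S(x_(3))] after [S(x_(1) y_(1))]. *)
Lemma antipodeM x y : S (x * y) = S y * S x.
Proof.
have e1 : S (x * y) = sws (Delta x) (fun x1 x2 => sws (Delta y) (fun y1 y2 =>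
    S (x1 * y1) * sws (Delta x2) (fun a b => sws (Delta y2) (fun c d =>
      (a * c) * (S d * S b))))).
  have step x2 y2 : sws (Delta x2) (fun a b => sws (Delta y2) (fun c d =>
      (a * c) * (S d * S b))) = (eps x2 * eps y2 : k) *: 1.
    transitivity (sws (Delta x2) (fun a b => (eps y2 : k) *: (a * S b))).
      apply: eq_sws => a b; have -> : (eps y2 : k) *: (a * S b) = a * ((eps y2 : k) *: 1 * S b).
        by rewrite -scalerAl mul1r -scalerAr.
      rewrite -h_antir.
      rewrite (sws_linG _ _ (linear_mulr (S b))) (sws_linG _ _ (linear_mull a)).
      by apply: eq_sws => c d /=; rewrite !mulrA.
    rewrite -(sws_linG _ _ (@linear_scale _ U (eps y2))) h_antir /=.
    by rewrite scalerA mulrC.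
  transitivity (sws (Delta x) (fun x1 x2 => (eps x2 : k) *:
      sws (Delta y) (fun y1 y2 => (eps y2 : k) *: S (x1 * y1)))).
    rewrite (h_counitr (G := fun x1 => _)); last first.
      apply: lin_sws => a b s u v.
      by rewrite linear_mulr lmP scalerDr !scalerA mulrC.
    rewrite (h_counitr (G := fun y1 => S (x * y1))) // => s u v.
    by rewrite linear_mull lmP.
  apply: eq_sws => x1 x2; rewrite (sws_linG _ _ (@linear_scale _ U (eps x2))).
  by apply: eq_sws => y1 y2; rewrite step /= -scalerAr mulr1 scalerA.
have e2 : S y * S x = sws (Delta x) (fun x1 x2 => sws (Delta y) (fun y1 y2 =>
    sws (Delta x1) (fun a b => sws (Delta y1) (fun c d => S (a * c) * (b * d)))
      * (S y2 * S x2))).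
  have step x1 y1 : sws (Delta x1) (fun a b => sws (Delta y1) (fun c d =>
      S (a * c) * (b * d))) = (eps x1 * eps y1 : k) *: 1.
    have := h_antil (x1 * y1); rewrite h_deltaM ?hepsM //.
    by split=> ? s u v; rewrite ?lmP ?linear_mull ?linear_mulr.
  transitivity (sws (Delta x) (fun x1 x2 => (eps x1 : k) *:
      sws (Delta y) (fun y1 y2 => (eps y1 : k) *: (S y2 * S x2)))).
    rewrite (h_counitl (G := fun x2 => _)); last first.
      apply: lin_sws => a b s u v.
      by rewrite lmP linear_mull scalerDr !scalerA mulrC.
    rewrite (h_counitl (G := fun y2 => S y2 * S x)) // => s u v.
    by rewrite lmP linear_mulr.
  apply: eq_sws => x1 x2; rewrite (sws_linG _ _ (@linear_scale _ U (eps x1))).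
  apply: eq_sws => y1 y2.
  by rewrite step -scalerAl mul1r scalerA.
rewrite e1 e2.
transitivity (sws (Delta x) (fun x1 x2 => sws (Delta x2) (fun a b =>
   sws (Delta y) (fun y1 y2 => sws (Delta y2) (fun c d =>
     S (x1 * y1) * (a * c) * (S d * S b)))))).
  apply: eq_sws => x1 x2; rewrite sws_exch; apply: eq_sws => y1 y2.
  rewrite (sws_linG _ _ (linear_mull (S (x1 * y1)))); apply: eq_sws => a b /=.
  rewrite (sws_linG _ _ (linear_mull (S (x1 * y1)))); apply: eq_sws => c d /=.
  exact: mulrA.
transitivity (sws (Delta x) (fun x1 x2 => sws (Delta x1) (fun a b =>
   sws (Delta y) (fun y1 y2 => sws (Delta y1) (fun c d =>
     S (a * c) * (b * d) * (S y2 * S x2)))))); last first.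
  apply: eq_sws => x1 x2; rewrite sws_exch; apply: eq_sws => y1 y2.
  rewrite (sws_linG _ _ (linear_mulr (S y2 * S x2))); apply: eq_sws => a b /=.
  by rewrite (sws_linG _ _ (linear_mulr (S y2 * S x2))); apply: eq_sws => c d /=.
pose F a b c := sws (Delta y) (fun y1 y2 => sws (Delta y1) (fun p q =>
  S (a * p) * (b * q) * (S y2 * S c))).
rewrite -[RHS]/(sws (Delta x) (fun x1 x2 => sws (Delta x1) (fun a b => F a b x2))).
have lS : forall a : U, linear (fun x => S x * a) by move=> a s u v; rewrite lmP linear_mulr.
rewrite h_coassoc; last first.
  split=> a; split=> b; apply: lin_sws => y1 y2; apply: lin_sws => p q s u v;
    by rewrite ?(linear_mulr, linear_mull, lmP).
apply: eq_sws => x1 x2; apply: eq_sws => a b; symmetry.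
rewrite /F h_coassoc //; split=> p; split=> q s u v;
  by rewrite ?(linear_mulr, linear_mull, lmP).
Qed.

End Hopf.

(** * Descent along the subbialgebra *)

Section Quotient.
Variables (k : fieldType) (U : hopfAlg k) (H : subBialg U).
Local Notation HT := (subalg (sb_set H)).
Local Notation C := (quot_coalg H).
Local Notation B := (UC_modcoalg H).
Local Notation Delta := (hdelta U).
Local Notation eps := (heps U).
Local Notation S := (hS U).
Local Notation cl := (cls H).

Lemma cls_surj (c : C) : exists x, cl x = c.
Proof. exact: qproj_surj. Qed.

Lemma cls_mulH x (h : HT) : cl (x * val h) = (eps (val h) : k) *: cl x.
Proof.
rewrite -lmZ; apply/qprojP; apply: sub_span.
exists x, (h - (eps (val h) : k) *: 1).
have -> : val (h - (eps (val h) : k) *: (1 : HT)) = val h - (eps (val h) : k) *: 1.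
  by rewrite rmorphB linearZ rmorph1.
split; first by rewrite lmB lmZ heps1 [_ *: _]mulr1 subrr.
by rewrite mulrBr -scalerAr mulr1.
Qed.

Lemma cls_lift (X : lmodType k) (g : {linear U -> X}) :
  (forall x (h : HT), eps (val h) = 0 -> g (x * val h) = 0) ->
  forall x, linext cl g (cl x) = g x.
Proof.
move=> hg; have [|g' gE] := @quo_lift k U X [set z : U | exists x (h : HT),
    eps (val h) = 0 /\ z = x * val h] g.
  by move=> _ [x [h [e ->]]]; apply: hg.
exact: (linextE (g := g')).
Qed.

Lemma sws_deltaH (Y : lmodType k) (F : U -> U -> Y) (h : HT) : bilinear_op F ->
  sws (Delta (val h)) F = sws (sb_delta H h) (fun a b => F (val a) (val b)).
Proof.
move=> hF; rewrite -sb_deltaE swsE_tmap //; by move=> a u v; rewrite linearP.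
Qed.

(** The first leg of [h] is absorbed by a class, as [[x h] = eps(h) [x]], and the
    counit then removes it; likewise for the second leg. *)
Lemma sws_cls_l (Y : lmodType k) (F : C -> U -> Y) x (h : HT) : bilinear_op F ->
  sws (Delta (val h)) (fun a b => F (cl (x * a)) b) = F (cl x) (val h).
Proof.
move=> [Fr Fl]; rewrite [LHS]sws_deltaH; last first.
  by split=> ? s u v; rewrite ?Fr // linear_mull lmP Fl.
rewrite -[RHS](h_counitl (G := F (cl x))) // [RHS]sws_deltaH; last first.
  by split=> ? s u v; rewrite ?Fr ?linear_scale // lmP /= scalerDl -scalerA.
by apply: eq_sws => a b; rewrite cls_mulH (linear_funZ _ _ (Fl _)).
Qed.

Lemma sws_cls_r (Y : lmodType k) (F : U -> C -> Y) x (h : HT) : bilinear_op F ->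
  sws (Delta (val h)) (fun a b => F a (cl (x * b))) = F (val h) (cl x).
Proof.
move=> [Fr Fl]; rewrite [LHS]sws_deltaH; last first.
  by split=> ? s u v; rewrite ?Fl // linear_mull lmP Fr.
rewrite -[RHS](h_counitr (G := F^~ (cl x))) // [RHS]sws_deltaH; last first.
  by split=> ? s u v; rewrite ?Fl ?linear_scale // lmP /= scalerDl -scalerA.
by apply: eq_sws => a b; rewrite cls_mulH (linear_funZ _ _ (Fr _)).
Qed.

Lemma C_actE x y : C_act H x (cl y) = cl (x * y).
Proof.
apply: (@cls_lift _ (cl \o mklin (linear_mull x))) => y' h e /=.
by rewrite mulrA cls_mulH e scale0r.
Qed.

Lemma bilinear_cls2 : bilinear_op (fun a b : U => cl a ⊗ cl b).
Proof. by split=> ? s u v; rewrite lmP ?pure_linearl ?pure_linearr. Qed.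

Lemma C_deltaE x : C_delta H (cl x) = sws (Delta x) (fun a b => cl a ⊗ cl b).
Proof.
rewrite -tmap_sws; apply: (@cls_lift _ (tmap cl cl \o Delta)) => y h e.
rewrite /= tmap_sws h_deltaM; last exact: bilinear_cls2.
rewrite /sws big1 // => p _; rewrite -/(sws _ _).
apply: etrans (@sws_cls_l _ (fun c d => c ⊗ cl (p.2 * d)) p.1 h _) _; last first.
  by rewrite cls_mulH e scale0r lm0.
by split=> ? s u v; rewrite ?pure_linearl // linear_mull lmP pure_linearr.
Qed.

Lemma C_epsE x : C_eps H (cl x) = eps x.
Proof. by apply: cls_lift => y h e; rewrite hepsM e mulr0. Qed.

Lemma UC_mc : is_mc B.
Proof.
split; [exact: hdelta_coassoc|exact: hdelta1|].
move=> x y; rewrite [LHS]hdeltaM.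
have hb1 a b : bilinear_op (fun c d : U => (a * c) ⊗ (b * d)).
  by split=> ? s u v; rewrite linear_mull ?pure_linearl ?pure_linearr.
rewrite sws_tlift; first by apply: eq_sws => a b; rewrite sws_tlift.
split=> ? s u v; rewrite !sws_tlift //.
  by rewrite (@lin_sws _ _ _ _ _ _ (fun v c d => (_ * c) ⊗ (v * d))) // => ? ? ? ? ?; rewrite linear_mulr pure_linearr.
by rewrite (@lin_sws _ _ _ _ _ _ (fun v c d => (v * c) ⊗ (_ * d))) // => ? ? ? ? ?; rewrite linear_mulr pure_linearl.
Qed.

Lemma C_lmod : is_lmodule (fun x => C_act H x : C -> C).
Proof.
split=> [x|c|c|x y c]; first exact: linP.
- move=> a u v; have [y <-] := cls_surj c.
  by rewrite !C_actE linear_mulr lmP.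
- by have [y <-] := cls_surj c; rewrite C_actE mul1r.
- by have [z <-] := cls_surj c; rewrite !C_actE mulrA.
Qed.

Lemma UC_unit_left : is_left (unit_bimod B).
Proof.
have hb := lmod_bilinear C_lmod.
have b2 := bilinear_cls2.
split; first exact: C_lmod.
- move=> c; have [x <-] := cls_surj c; rewrite /= C_deltaE.
  rewrite (tmap_sws_idr (C_delta H)) (tmap_sws_idl (C_delta H)).
  pose F (a b c : U) := cl a ⊗ (cl b ⊗ cl c).
  have b3 (c0 : C) (X : lmodType k) (G : C -> X) : linear G -> bilinear_op (fun a b : U => G (cl b) ⊗ cl a) by move=> lG; split=> ? s u v; rewrite lmP ?lG ?pure_linearl ?pure_linearr.
  have e1 : sws (sws (Delta x) (fun a b : U => cl a ⊗ cl b)) (fun a b => C_delta H a ⊗ b) =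
     sws (Delta x) (fun a b => C_delta H (cl a) ⊗ cl b).
    rewrite -(tmap_sws_idr (C_delta H)) sws_lin; apply: eq_sws => a b.
    by rewrite tmapG.
  have e2 : sws (sws (Delta x) (fun a b : U => cl a ⊗ cl b)) (fun a b => a ⊗ C_delta H b) =
     sws (Delta x) (fun a b => cl a ⊗ C_delta H (cl b)).
    rewrite -(tmap_sws_idl (C_delta H)) sws_lin; apply: eq_sws => a b.
    by rewrite tmapG.
  rewrite [X in tassoc _ _ _ X]e1 [RHS]e2 sws_lin.
  transitivity (sws (Delta x) (fun a b => sws (Delta a) (fun a1 a2 => F a1 a2 b))).
    apply: eq_sws => a b; rewrite C_deltaE -[_ ⊗ cl b]/(purer (cl b) _) !sws_lin.
    by apply: eq_sws => a1 a2; rewrite /= /purer tassocE.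
  rewrite h_coassoc; first by apply: eq_sws => a b; rewrite C_deltaE sws_lin.
  by split=> a; split=> b s u v; rewrite /F lmP ?pure_linearl ?pure_linearr //
    ?pure_linearr.
- move=> c; have [x <-] := cls_surj c.
  have eb := @bilinear_scalel k C C (C_eps H).
  rewrite /= C_deltaE sws_lin -[RHS](h_counitl (G := cl)) //.
  by apply: eq_sws => a b; rewrite sws_tlift // sws_pure // C_epsE.
- move=> x c; have [y <-] := cls_surj c.
  rewrite /= C_actE !C_deltaE h_deltaM // [RHS]sws_lin sws_exch; apply: eq_sws => a b.
  by rewrite diag_actE //; apply: eq_sws => p q /=; rewrite !C_actE.
Qed.

Section Canonical.
Variables (M : lmodType k) (aM : U -> M -> M).
Hypothesis hM : is_lmodule aM.
Let bM : bilinear_op aM := lmod_bilinear hM.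
Let hact (h : HT) : M -> M := aM (val h).
Local Notation rp := (rpure (@U_ract k U H) hact).

Lemma H_lmod : is_lmodule hact.
Proof.
split=> [h|m|m|a b m]; rewrite /hact.
- exact: la_linear.
- by move=> a u v; rewrite linearP (la_linearl hM).
- by rewrite rmorph1 (la1 hM).
- by rewrite rmorphM (laM hM).
Qed.

(** The canonical map [U ⊗_H M -> C ⊗ M] of Galois theory for [U / C]. *)
Definition canon_map : {linear rtensor (@U_ract k U H) hact -> C ⨂ M} :=
  rlift (@U_ract k U H) hact (fun x m => sws (Delta x) (fun a b => cl a ⊗ aM b m)).

Lemma canon_mapE x m : canon_map (rp x m) = sws (Delta x) (fun a b => cl a ⊗ aM b m).
Proof.
have [lM rM] := bM.
have hb m' : bilinear_op (fun a b => cl a ⊗ aM b m').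
  by split=> ? s u v; rewrite ?rM ?lmP ?pure_linearl ?pure_linearr.
rewrite [LHS]rliftE //.
  split=> [y|m']; last by move=> s u v; rewrite lmP sws_linear.
  by apply: lin_sws => a b s u v; rewrite lM pure_linearr.
move=> y h m'; rewrite /U_ract h_deltaM //; apply: eq_sws => a b.
apply: etrans (@sws_cls_l _ (fun c d => c ⊗ aM (b * d) m') a h _) _; last by rewrite (laM hM).
by split=> ? s u v; rewrite ?pure_linearl // linear_mull rM pure_linearr.
Qed.

Definition canon_inv_op (c : C) (m : M) : rtensor (@U_ract k U H) hact :=
  linext cl (fun x => tlift (fun x1 x2 => rp x1 (aM (S x2) m)) (Delta x)) c.

Lemma bilinear_canon_inv m : bilinear_op (fun x1 x2 => rp x1 (aM (S x2) m)).
Proof.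
have [lM rM] := bM.
by split=> ? s u v; rewrite ?lmP ?rM ?rpureDl ?rpureDr ?rpureZl ?rpureZr.
Qed.

(** Since [S] reverses products, [x h] goes to the sum of the
    [x_(1) ⊗_H h_(1) S(h_(2)) S(x_(2)) m], which is [eps(h)] times the value at
    [x]; hence the definition descends to [C]. *)
Lemma canon_inv_opE x m :
  canon_inv_op (cl x) m = sws (Delta x) (fun x1 x2 => rp x1 (aM (S x2) m)).
Proof.
have [lM rM] := bM; have hb := bilinear_canon_inv m.
rewrite -sws_tlift //.
apply: (@cls_lift _ (tlift (fun x1 x2 => rp x1 (aM (S x2) m)) \o Delta)) => y h e.
rewrite /= sws_tlift // h_deltaM // /sws big1 // => p _.
pose F (c d : U) := rp (p.1 * c) (aM (S (p.2 * d)) m).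
have hF : bilinear_op F.
  by split=> ? s u v; rewrite /F linear_mull ?lmP ?rM ?rpureDl ?rpureDr ?rpureZl ?rpureZr.
rewrite -/(sws (Delta (subalg_val h)) F) [LHS]sws_deltaH //.
transitivity (sws (sb_delta H h) (fun a b => rp p.1 (aM (val a * S (val b)) (aM (S p.2) m)))).
  apply: eq_sws => a b; rewrite /F -[p.1 * _]/(U_ract p.1 a) rpure_balanced /hact.
  by rewrite antipodeM !(laM hM).
pose G x : rtensor (@U_ract k U H) hact := rp p.1 (aM x (aM (S p.2) m)).
have lG : linear G by move=> s u v; rewrite /G rM rpureDr rpureZr.
rewrite -(sws_deltaH (F := fun a b => G (a * S b))).
  by rewrite (sws_linE lG (h_antir _)) e scale0r; apply: (lm0 (mklin lG)).
by split=> ? s u v; rewrite ?lmP ?linear_mull ?linear_mulr lG.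
Qed.

Definition canon_inv : {linear C ⨂ M -> rtensor (@U_ract k U H) hact} :=
  tlift canon_inv_op.

Lemma canon_invE x m :
  canon_inv (cl x ⊗ m) = sws (Delta x) (fun x1 x2 => rp x1 (aM (S x2) m)).
Proof.
have [lM rM] := bM.
rewrite -canon_inv_opE [LHS]tliftE // => c s u v.
have [y <-] := cls_surj c; rewrite !canon_inv_opE.
rewrite (@lin_sws _ _ _ _ _ _ (fun v a b => rp a (aM (S b) v))) // => a b s' u' v'.
by rewrite lM rpureDr rpureZr.
Qed.

Lemma canon_mapK : cancel canon_map canon_inv.
Proof.
have [lM rM] := bM.
elim/rtensor_ind => [x m|y z hy hz]; last by rewrite !lmD hy hz.
rewrite canon_mapE sws_lin.
pose F (a b c : U) := rp a (aM (S b * c) m).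
transitivity (sws (Delta x) (fun a b => sws (Delta a) (fun a1 a2 => F a1 a2 b))).
  apply: eq_sws => a b; rewrite canon_invE; apply: eq_sws => c d.
  by rewrite /F (laM hM).
rewrite h_coassoc; last first.
  by split=> ?; split=> ? s u v; rewrite /F ?lmP ?linear_mull ?linear_mulr
     ?rM ?rpureDl ?rpureDr ?rpureZl ?rpureZr.
rewrite -[RHS](h_counitr (G := fun a => rp a m)); last first.
  by move=> s u v; rewrite rpureDl rpureZl.
apply: eq_sws => a b; rewrite /F.
have lG : linear (fun z => rp a (aM z m)) by move=> s u v; rewrite rM rpureDr rpureZr.
rewrite (sws_linE lG (h_antil _)).
by apply: etrans (lmZ (mklin lG) _ _) _; rewrite /= (la1 hM).
Qed.

Lemma canon_invK : cancel canon_inv canon_map.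
Proof.
have [lM rM] := bM.
elim/tensor_ind => [c m|y z hy hz]; last by rewrite !lmD hy hz.
have [x <-] := cls_surj c; rewrite canon_invE sws_lin.
pose F (a b c : U) := cl a ⊗ aM (b * S c) m.
transitivity (sws (Delta x) (fun a b => sws (Delta a) (fun a1 a2 => F a1 a2 b))).
  apply: eq_sws => a b; rewrite canon_mapE; apply: eq_sws => p q.
  by rewrite /F (laM hM).
rewrite h_coassoc; last first.
  by split=> ?; split=> ? s u v; rewrite /F ?lmP ?linear_mull ?linear_mulr
     ?rM ?pure_linearl ?pure_linearr.
rewrite -[RHS](h_counitr (G := fun a => cl a ⊗ m)); last first.
  by move=> s u v; rewrite lmP pure_linearl.
apply: eq_sws => a b; rewrite /F.
have lG : linear (fun z => cl a ⊗ aM z m) by move=> s u v; rewrite rM pure_linearr.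
rewrite (sws_linE lG (h_antir _)).
by apply: etrans (lmZ (mklin lG) _ _) _; rewrite /= (la1 hM).
Qed.

End Canonical.

Lemma act_cls1 (M : lmodType k) (aM : U -> M -> M) (h : HT) m : bilinear_op aM ->
  diag_act (B := B) (mc_act B) aM (val h) (cl 1 ⊗ m) = cl 1 ⊗ aM (val h) m.
Proof.
move=> bM; have [lM rM] := bM; have bC := lmod_bilinear C_lmod.
rewrite (diag_actE (B := B) _ _ _ bC bM).
apply: etrans (@sws_cls_l _ (fun c d => c ⊗ aM d m) 1 h _).
  by apply: eq_sws => a b; rewrite mul1r; congr (_ ⊗ _); rewrite /= C_actE mulr1.
by split=> ? s u v; rewrite ?pure_linearl // rM pure_linearr.
Qed.

(** Descent along the inclusion of [H] in [U]: an object is induced from its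
    space of left coinvariants. The coinvariants are the kernel of
    [m |-> blam m - [1] ⊗ m]; flatness keeps this kernel after inducing, where
    the canonical isomorphism [U ⊗_H M ≅ C ⊗ M] turns it into the equalizer of
    [id ⊗ blam] and [Δ ⊗ id], which is a copy of [M]. *)
Section Structure.
Hypothesis flat : rfaithfully_flat (@U_ract k U H).
Variables (M : bimod B) (V : lmodType k) (lV : HT -> V -> V) (j : {linear V -> M}).
Hypothesis hM : is_left M.
Hypothesis hV : is_lmodule lV.
Hypothesis j_inj : injective j.
Hypothesis j_act : forall h v, j (lV h v) = @bact k B M (val h) (j v).
Hypothesis j_coinv : forall v, blam M (j v) = cl 1 ⊗ j v.

Local Notation aM := (@bact k B M).
Local Notation rV := (rpure (@U_ract k U H) lV).

Definition induced_map : {linear rtensor (@U_ract k U H) lV -> M} :=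
  rlift (@U_ract k U H) lV (fun x v => aM x (j v)).

Lemma induced_mapE x v : induced_map (rV x v) = aM x (j v).
Proof.
have [lM rM] := left_bil hM.
rewrite [LHS]rliftE //.
  by split=> [y|w] s u u'; rewrite ?lmP ?lM ?rM.
by move=> y h w; rewrite /U_ract (laM (left_lmod hM)) j_act.
Qed.

Lemma blam_coinv x (m : M) : blam M m = cl 1 ⊗ m ->
  blam M (aM x m) = sws (Delta x) (fun a b => cl a ⊗ aM b m).
Proof.
move=> hm; rewrite (left_act hM) hm diag_actE; last exact: left_bil.
  by apply: eq_sws => a b /=; rewrite C_actE mulr1.
exact: lmod_bilinear C_lmod.
Qed.

Let hact (h : HT) : M -> M := aM (val h).
Local Notation rM := (rpure (@U_ract k U H) hact).

Definition induced_j : {linear rtensor (@U_ract k U H) lV -> rtensor (@U_ract k U H) hact} :=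
  rlift (@U_ract k U H) lV (fun m n => rM m (j n)).

Lemma induced_jE x v : induced_j (rV x v) = rM x (j v).
Proof.
have [hl hr] := bilinear_rpure (@U_ract k U H) hact.
rewrite [LHS]rliftE //; first by split=> [y|w] s u u'; rewrite ?lmP ?hl ?hr.
by move=> y h w; rewrite rpure_balanced j_act.
Qed.

Lemma induced_j_inj : injective induced_j.
Proof.
apply: injective_lin => y hy.
have lM := H_lmod (left_lmod hM).
have ex : exact_at (\0 : {linear V -> V}) j.
  move=> v; split=> [[x <-]|h]; first by rewrite /= lm0.
  by exists 0; rewrite /= (injective0 j_inj h).
have [] := @flat V V M lV lV hact \0 j hV hV lM _ j_act.
  by move=> a n; rewrite /= (linear_fun0 (la_linear hV a)).
move=> /(_ ex) h _; have [_ /(_ hy)[z <-]] := h y.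
suff -> : rlift (@U_ract k U H) lV (fun m n => rV m ((\0 : {linear V -> V}) n)) z = 0 by [].
elim/rtensor_ind: z => [m n|z z' hz hz']; last by rewrite lmD hz hz' addr0.
have r0 m' : rV m' 0 = 0 by rewrite -[0 in LHS](scale0r (0 : V)) rpureZr scale0r.
rewrite rliftE //=.
  by split=> [y'|w] s u u' /=; rewrite !r0 scaler0 addr0.
by move=> *; rewrite !r0.
Qed.

Lemma canon_induced_j y :
  canon_map aM (induced_j y) = blam M (induced_map y).
Proof.
elim/rtensor_ind: y => [x v|y z hy hz]; last by rewrite !lmD hy hz.
rewrite induced_jE induced_mapE blam_coinv // canon_mapE //.
exact: (left_lmod hM).
Qed.

Theorem induced_map_inj : injective induced_map.
Proof.
move=> y z e; apply: induced_j_inj.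
apply: (can_inj (canon_mapK (left_lmod hM))).
by rewrite !canon_induced_j e.
Qed.

Lemma blam_inj_counit : injective (blam M).
Proof. by move=> m m' e; rewrite -[m](left_counit hM) e left_counit. Qed.

Hypothesis j_onto : forall m : M, blam M m = cl 1 ⊗ m -> exists v, j v = m.

Theorem induced_map_surj (m : M) : exists y, induced_map y = m.
Proof.
have lM := left_lmod hM; have baM := left_bil hM; have [aMl aMr] := baM.
have bcM : bilinear_op (mc_act B) := lmod_bilinear C_lmod.
have [cMl cMr] := bcM.
pose aCM x : C ⨂ M -> C ⨂ M := diag_act (mc_act B) aM x.
have lCM : is_lmodule aCM := diag_lmod UC_mc C_lmod lM.
pose g : {linear M -> C ⨂ M} := (blam M \- pure (cl 1))%R.
pose y := canon_inv aM (blam M m).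
have gact (h : HT) (n : M) : g (hact h n) = aCM (val h) (g n).
  rewrite /g /= (left_act hM) /aCM [RHS]lmB; congr (_ - _).
  exact/esym/(act_cls1 h n baM).
have ex : exact_at j g.
  move=> n; split=> [[v <-]|/eqP]; first by rewrite /g /= j_coinv subrr.
  by rewrite /g /= subr_eq0 => /eqP /j_onto.
have := @flat V M (C ⨂ M) lV hact (fun h => aCM (val h)) j g hV (H_lmod lM) (H_lmod lCM) j_act gact.
case=> /(_ ex) h _.
have [_ hy] := h y.
pose Ug : {linear rtensor (@U_ract k U H) hact ->
    rtensor (@U_ract k U H) (fun h : HT => aCM (val h))} :=
  rlift (@U_ract k U H) hact (fun m n => rpure (@U_ract k U H) (fun h : HT => aCM (val h)) m (g n)).
have UgE x n : Ug (rM x n) = rpure (@U_ract k U H) (fun h : HT => aCM (val h)) x (g n).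
  have [hl hr] := bilinear_rpure (@U_ract k U H) (fun h : HT => aCM (val h)).
  rewrite [LHS]rliftE //; first by split=> [y'|w] s u u'; rewrite ?lmP ?hl ?hr.
  by move=> y' h' w; rewrite rpure_balanced gact.
have key z : canon_map aCM (Ug z) =
    tmap id (blam M) (canon_map aM z) - tassoc _ _ _ (tmap (C_delta H) id (canon_map aM z)).
  move: z; apply: (rtensor_ext (f := canon_map aCM \o Ug) (g := ((tmap id (blam M) \o canon_map aM)
    \- (tassoc _ _ _ \o (tmap (C_delta H) id \o canon_map aM)))%R)) => x n.
  apply: etrans (congr1 (canon_map aCM) (UgE x n)) _; apply: etrans (canon_mapE lCM x (g n)) _.
  rewrite /= (canon_mapE lM).
  have -> : sws (Delta x) (fun a b => cl a ⊗ aCM b (g n)) =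
      sws (Delta x) (fun a b => cl a ⊗ blam M (aM b n)) -
      sws (Delta x) (fun a b => cl a ⊗ aCM b (cl 1 ⊗ n)).
    apply/eqP; rewrite eq_sym subr_eq swsD; apply/eqP/eq_sws => a b.
    by rewrite -pureDr -[aCM b _ + _]lmD /g /= subrK (left_act hM).
  rewrite (sws_lin (tmap id (blam M))); congr (_ - _).
    by apply: eq_sws => a b; rewrite tmapG.
  rewrite !sws_lin.
  pose F (a b c : U) := cl a ⊗ (cl b ⊗ aM c n).
  transitivity (sws (Delta x) (fun a b => sws (Delta b) (fun b1 b2 => F a b1 b2))).
    apply: eq_sws => a b; rewrite /aCM diag_actE //.
    by rewrite sws_lin; apply: eq_sws => p q /=; rewrite C_actE mulr1.
  rewrite -h_coassoc; last first.
    by split=> ?; split=> ? s u v; rewrite /F ?lmP ?aMr ?pure_linearl ?pure_linearr //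
      ?pure_linearr.
  apply: eq_sws => a b; rewrite tmapG // C_deltaE -[_ ⊗ aM b n]/(purer _ _) !sws_lin.
  by apply: eq_sws => p q; rewrite /= /purer tassocE.
have Uy : Ug y = 0.
  apply: (can_inj (canon_mapK lCM)); apply: etrans (key y) _.
  apply: etrans _ (esym (lm0 (canon_map aCM))); rewrite /y (canon_invK lM (blam M m)).
  by apply/eqP; rewrite subr_eq0; apply/eqP/esym/(left_coassoc hM).
have [z ez] := hy Uy; exists z; apply: blam_inj_counit.
rewrite -canon_induced_j -[RHS](canon_invK lM) -/y.
by congr (canon_map aM _).
Qed.

End Structure.
End Quotient.

(** * Deconcatenation of words *)

Section Deconcatenation.
Variables (k : fieldType) (B : modcoalg k) (V : bimod B).
Local Notation TS := (tspace V).
Local Notation inj n := (@dinj k (tcomp V) n).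

Lemma tcons_inj0 (v : V) (b : B) : tcons v (inj 0 b) = 0.
Proof.
by rewrite [LHS]dliftE // => -[|m] a x y /=; rewrite ?scaler0 ?addr0 ?lmP.
Qed.

Lemma tcons_injS (v : V) m (u : tpow V m) : tcons v (inj m.+1 u) = inj m.+2 (v ⊗ u).
Proof.
by rewrite [LHS]dliftE // => -[|m'] a x y /=; rewrite ?scaler0 ?addr0 ?lmP.
Qed.

Lemma linear_tcons (z : TS) : linear (fun v => tcons v z).
Proof.
move=> a v w; elim/dsum_ind: z => [|[|m] u|y z hy hz].
- by rewrite !lm0 addr0.
- by rewrite !tcons_inj0 scaler0 addr0.
- by rewrite !tcons_injS pure_linearl lmP.
- by rewrite !lmD hy hz addrACA.
Qed.

Lemma inner_cutsE m (v : V) (u : tpow V m) :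
  inner_cuts V m.+1 (v ⊗ u) = inj 1 v ⊗ inj m.+1 u + tmap (tcons v) id (inner_cuts V m u).
Proof.
have lt (y : TS ⨂ TS) : linear (fun v => tmap (tcons v) id y).
  move=> a x x'; elim/tensor_ind: y => [p q|y z hy hz]; last by rewrite !lmD hy hz addrACA.
  by rewrite !tmapG // linear_tcons pure_linearl.
rewrite /= tliftE // => [x|w] a y z.
  by rewrite !lmP scalerDr addrACA.
by rewrite lt lmP pure_linearl scalerDr addrACA.
Qed.

Definition deconc : {linear TS -> TS ⨂ TS} := comul (tspace_coalg V).
Definition deconc_counit : {linear TS -> B} := counit (tspace_coalg V).

Lemma comul_inj n (u : tcomp V n) :
  deconc (inj n u) = deconc_comp u.
Proof.
rewrite [LHS]dliftE // => -[|m] a x y /=; rewrite !lmP //.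
by rewrite !scalerDr [X in X + _ = _]addrACA [LHS]addrACA.
Qed.

Lemma counit_inj0 (b : B) : deconc_counit (inj 0 b) = b.
Proof.
by rewrite [LHS]dliftE // => -[|m] a x y //; rewrite scaler0 addr0.
Qed.

Lemma counit_injS m (u : tpow V m) : deconc_counit (inj m.+1 u) = 0.
Proof.
by rewrite [LHS]dliftE // => -[|m'] a x y //; rewrite scaler0 addr0.
Qed.

(** The positions are separated because a cut destroys the relations that it
    falls into, and moves the others into one of the factors. *)
Definition rel_at (R : set (V ⨂ V)) i : set TS :=
  [set z | forall m, (i < m)%N -> tensor_at R i (dcomp z m.+1)].

Definition quad_space (R : set (V ⨂ V)) : set TS :=
  [set z | forall m i, (i < m)%N -> tensor_at R i (dcomp z m.+1)].

Variable R : set (V ⨂ V).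
Hypothesis hR : is_subspace R.

Lemma subspace_tensor_at i m : (i < m)%N -> is_subspace (@tensor_at k B V R i m).
Proof.
elim: m i => // m IH [_|i lim]; last exact: subspace_tsub.
case: m {IH} => [|m]; first exact: hR.
exact: subspace_im (subspace_tsub _ _).
Qed.

Lemma subspace_rel_at i : is_subspace (rel_at R i).
Proof.
split=> [m lim|a u v hu hv m lim]; have [h0 hL] := subspace_tensor_at lim => //.
by apply: hL; [apply: hu|apply: hv].
Qed.

Lemma quad_spaceE z : quad_space R z <-> forall i, rel_at R i z.
Proof. by split=> h => [i m|m i]; apply: h. Qed.

Lemma subspace_quad_space : is_subspace (quad_space R).
Proof.
split=> [m i lim|a u v hu hv m i lim]; have [h0 hL] := subspace_tensor_at lim => //.
by apply: hL; [apply: hu|apply: hv].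
Qed.

Lemma rel_at_inj i m (u : tpow V m) :
  ((i < m)%N -> tensor_at R i u) -> rel_at R i (inj m.+1 u).
Proof.
move=> h m' lim; rewrite -dprojE; have [e|ne] := eqVneq m.+1 m'.+1.
  by case: e => e; subst m'; rewrite dproj_inj; apply: h.
by rewrite dproj_inj_neq //; case: (subspace_tensor_at lim).
Qed.

Lemma rel_at_inj0 i b : rel_at R i (inj 0 b).
Proof.
by move=> m lim; rewrite -dprojE dproj_inj_neq //; case: (subspace_tensor_at lim).
Qed.

Lemma quad_space_inj m (u : tpow V m) :
  (forall i, (i < m)%N -> tensor_at R i u) -> quad_space R (inj m.+1 u).
Proof. by move=> h; apply/quad_spaceE => i; apply: rel_at_inj => /h. Qed.

Lemma quad_space_inj0 b : quad_space R (inj 0 b).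
Proof. by apply/quad_spaceE => i; apply: rel_at_inj0. Qed.

Lemma homogeneous_ind (P : set TS) (z : TS) : is_subspace P ->
  (forall n, P (inj n (dcomp z n))) -> P z.
Proof.
move=> hP; have [N hN] := dsum_fin z.
elim: N z hN => [|N IH] z hN hz.
  have -> : z = 0 by apply: dsum_eq => n; rewrite hN.
  by case: hP.
rewrite -[z](subrK (inj N (dcomp z N))); apply: (subspaceD hP); last exact: hz.
have dE n : dcomp (z - inj N (dcomp z N)) n = if N == n then 0 else dcomp z n.
  rewrite -dprojE lmB !dprojE; have [e|ne] := eqVneq N n.
    by subst n; rewrite -[X in _ - X]dprojE dproj_inj subrr.
  by rewrite -[X in _ - X]dprojE dproj_inj_neq // subr0.
apply: IH => n.
  by rewrite dE leq_eqVlt; case: eqVneq => //= _ lNn; apply: hN.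
by rewrite dE; case: eqVneq => [e|_]; [rewrite lm0; case: hP|apply: hz].
Qed.

End Deconcatenation.

Section OverField.
Variables (k : fieldType) (U : hopfAlg k) (H : subBialg U).
Variable V : bimod (Hk_modcoalg H).
Hypothesis lamV : forall v : V, blam V v = (1 : k^o) ⊗ v.
Hypothesis rhoV : forall v : V, brho V v = v ⊗ (1 : k^o).
Local Notation TS := (tspace V).
Local Notation Dl := (deconc V).
Local Notation inj n := (@dinj k (tcomp V) n).

Lemma blam_tpow m (u : tpow V m) : blam (tpow V m) u = (1 : k^o) ⊗ u.
Proof.
case: m u => [|m] u; first exact: lamV.
elim/tensor_ind: u => [v u|y z hy hz]; last by rewrite !lmD hy hz.
by rewrite blam_tens lamV tmapG.
Qed.

Lemma brho_tpow m (u : tpow V m) : brho (tpow V m) u = u ⊗ (1 : k^o).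
Proof.
elim: m u => [|m IH] u; first exact: rhoV.
elim/tensor_ind: u => [v u|y z hy hz]; last by rewrite !lmD hy hz pureDl.
by rewrite brho_tens IH tmapG.
Qed.

Definition tone : TS := inj 0 (1 : k^o).

(** Unlike [tcons] it does not vanish in degree 0, so that all words are
    obtained from [tone]. *)
Definition lcons (v : V) : {linear TS -> TS} :=
  dlift (fun n => match n return tcomp V n -> TS with
                  | 0 => fun c : k^o => inj 1 ((c : k) *: v)
                  | m.+1 => fun u => inj m.+2 (v ⊗ u)
                  end).

Lemma lcons_inj0 (v : V) (c : k^o) : lcons v (inj 0 c) = inj 1 ((c : k) *: v).
Proof.
rewrite [LHS]dliftE // => -[|m] a x y /=; last by rewrite !lmP.
by rewrite scalerDl -scalerA lmP.
Qed.

Lemma lcons_injS (v : V) m (u : tpow V m) : lcons v (inj m.+1 u) = inj m.+2 (v ⊗ u).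
Proof.
rewrite [LHS]dliftE // => -[|m'] a x y /=; last by rewrite !lmP.
by rewrite scalerDl -scalerA lmP.
Qed.

Lemma lcons_tone v : lcons v tone = inj 1 v.
Proof. by rewrite lcons_inj0 scale1r. Qed.

Lemma inj0E (c : k^o) : inj 0 c = (c : k) *: tone.
Proof. by rewrite -lmZ; congr (inj 0 _); rewrite /GRing.scale /= mulr1. Qed.

Lemma linear_lcons (z : TS) : linear (fun v => lcons v z).
Proof.
move=> a v w; elim/dsum_ind: z => [|[|m] u|y z hy hz].
- by rewrite !lm0 addr0.
- by rewrite !lcons_inj0 linear_scale lmP.
- by rewrite !lcons_injS pure_linearl lmP.
- by rewrite !lmD hy hz addrACA.
Qed.

(** The tensor space is generated from [1] by prepending vectors. *)
Lemma tspace_ind (P : set TS) : is_subspace P -> P tone ->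
  (forall v z, P z -> P (lcons v z)) -> forall z, P z.
Proof.
move=> hP P1 PL z; apply: homogeneous_ind => // n.
suff Pm m (u : tpow V m) : P (inj m.+1 u).
  by case: n => [|m]; [rewrite inj0E; apply: subspaceZ|apply: Pm].
elim: m u => [|m IH] u; first by rewrite -lcons_tone; apply: PL.
elim/tensor_ind: u => [v u|y y' hy hy']; last by rewrite lmD; apply: subspaceD.
by rewrite -lcons_injS; apply: PL.
Qed.

Lemma comul_tone : Dl tone = tone ⊗ tone.
Proof. by rewrite comul_inj; apply: (tmapE (inj 0) (inj 0)). Qed.

Lemma tmap_tcons m v (u : tpow V m) :
  tmap (tcons v) id (inner_cuts V m u) = tmap (lcons v) id (inner_cuts V m u).
Proof.
case: m u => [|m] u; first by rewrite /= !lm0.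
elim/tensor_ind: u => [w u|y z hy hz]; last by rewrite !lmD hy hz.
rewrite inner_cutsE !lmD !tmapG // tcons_injS lcons_injS; congr (_ + _).
elim/tensor_ind: (inner_cuts V m u) => [p q|y z hy hz]; last by rewrite !lmD hy hz.
rewrite !tmapG //; congr (_ ⊗ _).
elim/dsum_ind: p => [|[|n] p|y z hy hz]; rewrite ?lm0 // ?tcons_inj0 ?lm0 //.
  by rewrite tcons_injS tcons_injS lcons_injS.
by rewrite !lmD hy hz.
Qed.

Lemma comul_injS m (u : tpow V m) :
  Dl (inj m.+1 u) = tone ⊗ inj m.+1 u + inner_cuts V m u + inj m.+1 u ⊗ tone.
Proof.
rewrite comul_inj /= blam_tpow brho_tpow; congr (_ + _ + _).
  exact: (tmapE (inj 0) (inj m.+1)).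
exact: (tmapE (inj m.+1) (inj 0)).
Qed.

(** Deconcatenation of a word with a new first letter: the cut before it, and
    the cuts after it. *)
Lemma comul_lcons v z :
  Dl (lcons v z) = tone ⊗ lcons v z + tmap (lcons v) id (Dl z).
Proof.
elim/dsum_ind: z => [|[|m] u|y z hy hz]; last first.
- by rewrite !lmD hy hz addrACA.
- rewrite lcons_injS !comul_injS inner_cutsE 2!lmD !(tmapE_idr (lcons v)).
  by rewrite lcons_tone lcons_injS -tmap_tcons !addrA.
- rewrite inj0E !lmZ comul_tone lcons_tone comul_injS (tmapE_idr (lcons v)).
  by rewrite lcons_tone /= addr0 scalerDr.
- by rewrite !lm0 addr0.
Qed.

(** Induction on the first letter: by [comul_lcons] both sides satisfy the same
    recursion. *)
Lemma comul_coassocT z :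
  tassoc _ _ _ (tmap (Dl) id (Dl z)) = tmap id (Dl) (Dl z).
Proof.
pose P := [set z : TS | tassoc _ _ _ (tmap (Dl) id (Dl z)) =
   tmap id (Dl) (Dl z)].
suff : P z by [].
apply: tspace_ind => [||v y]; rewrite /P /mkset.
- split=> [|a u v]; rewrite /mkset ?lm0 // !lmP => -> ->.
  by [].
- by rewrite !comul_tone !tmapG // comul_tone tassocE.
rewrite comul_lcons !lmD !tmapG // comul_tone tassocE comul_lcons pureDr.
rewrite -addrA => IH; congr (_ + _).
have -> : tmap (Dl) id (tmap (lcons v) id (Dl y)) =
    tassocV _ _ _ (tone ⊗ tmap (lcons v) id (Dl y)) +
    tmap (tmap (lcons v) id) id (tmap (Dl) id (Dl y)).
  elim/tensor_ind: (Dl y) => [p q|x z' hx hz].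
    by rewrite !tmapG // comul_lcons tassocVE pureDl.
  by rewrite !lmD hx hz ?pureDr ?lmD addrACA.
rewrite [LHS](lmD (tassoc TS TS TS)); congr (_ + _); first exact: tassocVK.
have -> : tassoc _ _ _ (tmap (tmap (lcons v) id) id (tmap (Dl) id (Dl y))) =
    tmap (lcons v) id (tassoc _ _ _ (tmap (Dl) id (Dl y))).
  move: (tmap (Dl) id (Dl y)) => t.
  elim/tensor_ind: t => [r q|x z' hx hz]; last by rewrite !lmD hx hz.
  elim/tensor_ind: r => [p p'|x z' hx hz]; last by rewrite !(pureDl, lmD) hx hz.
  by rewrite !tmapG // !tassocE !tmapG.
rewrite IH.
by elim/tensor_ind: (Dl y) => [p q|x z' hx hz]; [rewrite !tmapG|rewrite !lmD hx hz].
Qed.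

Definition hcounit : {linear TS -> k^o} := deconc_counit V.

Lemma counit_lcons v z : hcounit (lcons v z) = 0.
Proof.
elim/dsum_ind: z => [|[|m] u|y z hy hz].
- by rewrite !lm0.
- by rewrite lcons_inj0 counit_injS.
- by rewrite lcons_injS counit_injS.
- by rewrite !lmD hy hz addr0.
Qed.

Lemma counit_tone : hcounit tone = (1 : k^o).
Proof. exact: (@counit_inj0 k (Hk_modcoalg H) V (1 : k^o)). Qed.

Lemma comul_counitlT z : tlift (fun a b => (hcounit a : k) *: b) (Dl z) = z.
Proof.
have hb := @bilinear_scalel k TS TS hcounit.
pose P := [set z : TS | tlift (fun a b => (hcounit a : k) *: b) (Dl z) = z].
suff : P z by [].
apply: tspace_ind => [||v y]; rewrite /P /mkset.
- by split=> [|a u v]; rewrite /mkset ?lm0 // !lmP => -> ->.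
- by rewrite comul_tone sws_tlift // sws_pure // counit_tone scale1r.
move=> IH; rewrite comul_lcons lmD.
rewrite sws_tlift // sws_pure // counit_tone scale1r.
rewrite [X in _ + X](_ : _ = 0) ?addr0 //.
elim/tensor_ind: (Dl y) => [p q|x z' hx hz]; last by rewrite !lmD hx hz addr0.
by rewrite tmapG // sws_tlift // sws_pure // counit_lcons scale0r.
Qed.

Lemma comul_counitrT z : tlift (fun a b => (hcounit b : k) *: a) (Dl z) = z.
Proof.
have hb := @bilinear_scaler k TS TS hcounit.
pose P := [set z : TS | tlift (fun a b => (hcounit b : k) *: a) (Dl z) = z].
suff : P z by [].
apply: tspace_ind => [||v y]; rewrite /P /mkset.
- by split=> [|a u v]; rewrite /mkset ?lm0 // !lmP => -> ->.
- by rewrite comul_tone sws_tlift // sws_pure // counit_tone scale1r.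
move=> IH; rewrite comul_lcons lmD.
rewrite sws_tlift // sws_pure // counit_lcons scale0r add0r -{2}IH.
elim/tensor_ind: (Dl y) => [p q|x z' hx hz]; last by rewrite !lmD hx hz.
by rewrite tmapG // !sws_tlift // !sws_pure // lmZ.
Qed.

Variable R : set (V ⨂ V).
Hypothesis hR : is_subspace R.
Local Notation A := (rel_at R).
Local Notation Q := (quad_space R).

Lemma tone_rel i : A i tone. Proof. exact: rel_at_inj0. Qed.

Lemma inj1_rel i v : A i (inj 1 v).
Proof. by apply: rel_at_inj. Qed.

Lemma lcons_rel i v z : A i z -> A i.+1 (lcons v z).
Proof.
move=> hz; pose P := (lcons v) @^-1` (A i.+1); suff : P z by [].
apply: homogeneous_ind => [|[|m]].
- exact: subspace_preim (subspace_rel_at _ _).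
- by rewrite /P /preimage /mkset lcons_inj0; apply: inj1_rel.
rewrite /P /preimage /mkset lcons_injS; apply: rel_at_inj => // lim.
by apply: tsub_pure => //; apply: hz.
Qed.

Definition lcons2 (r : V ⨂ V) (z : TS) : TS := tlift (fun a b => lcons a (lcons b z)) r.

Lemma bilinear_lcons2 (z : TS) : bilinear_op (fun a b => lcons a (lcons b z)).
Proof. by split=> ? s u v; rewrite ?linear_lcons ?lmP. Qed.

Lemma lcons2E a b z : lcons2 (a ⊗ b) z = lcons a (lcons b z).
Proof. by have h := bilinear_lcons2 z; rewrite /lcons2 sws_tlift // sws_pure. Qed.

Lemma lcons2Dl r s z : lcons2 (r + s) z = lcons2 r z + lcons2 s z.
Proof. exact: lmD. Qed.

Lemma linear_lcons2 r : linear (lcons2 r).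
Proof.
move=> a y z; elim/tensor_ind: r => [v w|r s hr hs]; first by rewrite !lcons2E !lmP.
by rewrite !lcons2Dl hr hs scalerDr addrACA.
Qed.

Lemma lcons2_inj r m (u : tpow V m) :
  lcons2 r (inj m.+1 u) = inj m.+3 (tassoc V V (tpow V m) (r ⊗ u)).
Proof.
elim/tensor_ind: r => [v w|r s hr hs]; last by rewrite lcons2Dl hr hs pureDl !lmD.
by rewrite lcons2E !lcons_injS tassocE.
Qed.

Lemma lcons2_tone r : lcons2 r tone = inj 2 r.
Proof.
elim/tensor_ind: r => [v w|r s hr hs]; last by rewrite lcons2Dl hr hs -lmD.
by rewrite lcons2E lcons_tone lcons_injS.
Qed.

Lemma lcons2_rel r z : R r -> A 0 (lcons2 r z).
Proof.
move=> Rr; pose P := (mklin (linear_lcons2 r)) @^-1` (A 0); suff : P z by [].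
apply: homogeneous_ind => [|[|m]].
- exact: subspace_preim (subspace_rel_at _ _).
- rewrite inj0E; apply: (@subspaceZ _ _ P); first exact: subspace_preim (subspace_rel_at _ _).
  by rewrite /P /preimage /mkset /= lcons2_tone; apply: rel_at_inj.
rewrite /P /preimage /mkset /= lcons2_inj; apply: rel_at_inj => // _.
by exists (r ⊗ dcomp z m.+1) => //; apply: tsub_pure.
Qed.

(** The extra term [X] is the cut between the two letters of [r]. Its left factor
    has degree 1, where no relation is imposed. *)
Lemma comul_lcons2 r z : exists2 X : TS ⨂ TS, tsub (A 0) setT X &
  Dl (lcons2 r z) =
  tone ⊗ lcons2 r z + X + sws (Dl z) (fun p q => lcons2 r p ⊗ q).
Proof.
elim/tensor_ind: r => [a b|r s [X hX eX] [Y hY eY]].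
  exists (inj 1 a ⊗ lcons b z); first by apply: tsub_pure => //; apply: inj1_rel.
  rewrite lcons2E comul_lcons -addrA; congr (_ + _).
  rewrite comul_lcons lmD tmapG // lcons_tone; congr (_ + _).
  rewrite (tmap_sws_idr (lcons b)) sws_lin; apply: eq_sws => p q.
  by rewrite tmapG // lcons2E.
exists (X + Y); first exact: (subspaceD (@subspace_tsub _ _ _ _ _)).
rewrite lcons2Dl lmD eX eY pureDr.
have -> : sws (Dl z) (fun p q => lcons2 (r + s) p ⊗ q) =
   sws (Dl z) (fun p q => lcons2 r p ⊗ q) + sws (Dl z) (fun p q => lcons2 s p ⊗ q).
  by rewrite swsD; apply: eq_sws => p q; rewrite lcons2Dl pureDl.
by rewrite addrACA [X in X + _]addrACA.
Qed.

Lemma comul_lcons2_rel r z : R r -> tsub (A 0) setT (Dl (lcons2 r z)).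
Proof.
move=> Rr; have hT := @subspace_tsub k _ _ (A 0) [set: TS].
have [X hX ->] := comul_lcons2 r z; apply: (subspaceD hT).
  by apply: (subspaceD hT) => //; apply: tsub_pure => //; apply: tone_rel.
by apply: subspace_sws => // p q; apply: tsub_pure => //; apply: lcons2_rel.
Qed.

Lemma comul_inj0_rel i c : tsub (A i) setT (Dl (inj 0 c)).
Proof.
rewrite inj0E lmZ comul_tone; apply: (subspaceZ _ (@subspace_tsub _ _ _ _ _)).
by apply: tsub_pure => //; apply: tone_rel.
Qed.

Lemma comul_inj1 v : Dl (inj 1 v) = tone ⊗ inj 1 v + inj 1 v ⊗ tone.
Proof. by rewrite -lcons_tone comul_lcons comul_tone tmapG. Qed.

(** A cut to the right of the relation leaves it in the left factor, and for any
    other cut the left factor is too short to carry a relation at this position. *)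
Lemma comul_rel i z : A i z -> tsub (A i) setT (Dl z).
Proof.
have sT j : is_subspace (tsub (A j) [set: TS]) by apply: subspace_tsub.
have sP j : is_subspace (Dl @^-1` (tsub (A j) setT)).
  exact: (subspace_preim (Dl) (sT j)).
elim: i z => [|i IH] z hz; apply: (homogeneous_ind (sP _)) => -[|[|m]];
  rewrite /preimage /mkset; try exact: comul_inj0_rel.
- rewrite comul_inj1; apply: (subspaceD (sT _)); apply: tsub_pure => //.
    exact: tone_rel.
  exact: inj1_rel.
- have := hz m.+1 isT; move: (dcomp z m.+2) => u; case: m u => [|m] u.
    by move=> Ru; rewrite -lcons2_tone; apply: comul_lcons2_rel.
  case=> s hs <-.
  have lf : linear (fun s => Dl (inj m.+3 (tassoc V V (tpow V m) s))).
    by move=> a x y; rewrite [tassoc _ _ _ _]lmP [inj _ _]lmP lmP.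
  pose f := mklin lf.
  apply: (@tsub_sub _ _ _ R setT (f @^-1` (tsub (A 0) setT))) hs.
    exact: (subspace_preim f (sT 0%N)).
  by move=> r w Rr _; rewrite /f /preimage /mkset /= -lcons2_inj; apply: comul_lcons2_rel.
- rewrite comul_inj1; apply: (subspaceD (sT _)); apply: tsub_pure => //.
    exact: tone_rel.
  exact: inj1_rel.
- have := hz m.+1; move: (dcomp z m.+2) => u hu.
  have {}hu : tsub setT [set w : tpow V m | A i (inj m.+1 w)] u.
    have [lim|nlim] := boolP (i < m)%N; last first.
      apply: tsub_mono (tsubT u) => // w _; apply: rel_at_inj => // lim.
      by rewrite lim in nlim.
    by apply: tsub_mono (hu lim) => // w hw; apply: rel_at_inj.
  pose i2 : {linear V ⨂ tpow V m -> TS} := mklin (@dinj_linear k (tcomp V) m.+2).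
  pose f : {linear V ⨂ tpow V m -> TS ⨂ TS} := Dl \o i2.
  apply: (@tsub_sub _ _ _ setT _ (f @^-1` (tsub (A i.+1) setT))) hu.
    exact: (subspace_preim f (sT i.+1)).
  move=> v w _ /IH hw; rewrite /f /i2 /preimage /mkset /= -lcons_injS comul_lcons.
  apply: (subspaceD (sT _)); first by apply: tsub_pure => //; apply: tone_rel.
  apply: (@tsub_map _ _ _ _ _ (lcons v) idfun _ _ _ _ _ _ _ hw) => // p.
  exact: lcons_rel.
Qed.

(** All relations at once, since the positions shift in the right factor; cuts
    after the first letter come from the word without it. *)
Lemma comul_quad_r z : Q z -> tsub setT Q (Dl z).
Proof.
have sT : is_subspace (tsub [set: TS] Q) by apply: subspace_tsub.
move=> hz; apply: (homogeneous_ind (subspace_preim Dl sT)) => -[|m]; rewrite /preimage /mkset.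
  rewrite inj0E lmZ comul_tone; apply: (subspaceZ _ sT).
  by apply: tsub_pure => //; apply: quad_space_inj0.
have := hz m; move: (dcomp z m.+1) => u {z hz}.
elim: m u => [|m IH] u hu.
  rewrite comul_inj1; apply: (subspaceD sT) => //; apply: tsub_pure => //.
    exact: quad_space_inj.
  exact: quad_space_inj0.
have hu' : tsub setT [set w : tpow V m | forall i, (i < m)%N -> tensor_at R i w] u.
  apply: slice_l_tsub => [|xi i lim].
    split=> [i lim|a x y hx hy i lim]; have [h0 hL] := subspace_tensor_at hR lim => //.
    by apply: hL; [apply: hx|apply: hy].
  by apply: tsub_slice_l (hu i.+1 lim); apply: subspace_tensor_at.
have -> : Dl (inj m.+2 u) = tone ⊗ inj m.+2 u + (Dl (inj m.+2 u) - tone ⊗ inj m.+2 u).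
  by rewrite addrC subrK.
apply: (subspaceD sT) => //; first by apply: tsub_pure => //; apply: quad_space_inj.
pose i2 : {linear V ⨂ tpow V m -> TS} := mklin (@dinj_linear k (tcomp V) m.+2).
pose f : {linear V ⨂ tpow V m -> TS ⨂ TS} := ((Dl \o i2) \- (pure tone \o i2))%R.
apply: (@tsub_sub _ _ _ setT _ (f @^-1` (tsub setT Q))) hu'.
  exact: (subspace_preim f sT).
move=> v w _ /IH hw; rewrite /f /i2 /preimage /mkset /= -lcons_injS comul_lcons.
rewrite addrC addKr.
exact: (@tsub_map _ _ _ _ _ (lcons v) idfun _ _ _ _ _ _ _ hw).
Qed.

Lemma comul_quad z : Q z -> tsub Q Q (Dl z).
Proof.
move=> hz; have sQ := subspace_quad_space hR.
apply: tsubI => //; last exact: comul_quad_r.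
apply: slice_r_tsub => // xi; apply/quad_spaceE => i.
apply: tsub_slice_r (comul_rel _); first exact: subspace_rel_at.
by move/quad_spaceE: hz.
Qed.

End OverField.

(** * Equivariance of deconcatenation *)

Section Equivariance.
Variables (k : fieldType) (B : modcoalg k).
Hypothesis hB : is_mc B.
Hypothesis hC : is_left (unit_bimod B).
Let bC : bilinear_op (mc_act B) := left_bil hC.
Variable V : bimod B.
Hypothesis hV : is_left V.
Hypothesis rV : rho_equivariant V.
Local Notation TS := (tspace_bimod V).
Local Notation inj n := (@dinj k (tcomp V) n).
Local Notation aS := (@bact k B TS).
Local Notation aV := (@bact k B V).
Local Notation delta := (mc_delta B).

Let hS : is_left TS := tspace_left hB hC hV.
Let bS : bilinear_op aS := left_bil hS.
Let bV : bilinear_op aV := left_bil hV.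

Lemma act_tcons x v (z : TS) :
  aS x (tcons v z) = sws (delta x) (fun a b => tcons (aV a v) (aS b z)).
Proof.
have [lS rS] := bS.
elim/dsum_ind: z => [|[|m] u|y z hy hz].
- rewrite lm0 (linear_fun0 (lS x)) /sws big1 // => p _.
  by rewrite (linear_fun0 (lS _)) lm0.
- rewrite tcons_inj0 (linear_fun0 (lS x)) /sws big1 // => p _.
  by rewrite (bact_inj hB hC hV) tcons_inj0.
- rewrite tcons_injS (bact_inj hB hC hV).
  have hm := left_bil (tpow_left hB hC m hV).
  rewrite [bact x _](diag_actE _ _ _ bV hm) sws_lin; apply: eq_sws => a b.
  by rewrite (bact_inj hB hC hV) tcons_injS.
- rewrite lmD (linear_funD _ _ (lS x)) hy hz swsD; apply: eq_sws => a b.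
  by rewrite (linear_funD _ _ (lS b)) lmD.
Qed.

(** The cuts of [v ⊗ u] are the one after [v] and those of [u], so that
    coassociativity of the acting bialgebra gives the induction step. *)
Lemma act_inner_cuts m x (u : tpow V m) :
  inner_cuts V m (bact x u) = diag_act aS aS x (inner_cuts V m u).
Proof.
have [lS rS] := bS; have [lV' rV'] := bV.
elim: m u x => [|m IH] u x; first by rewrite /= lm0.
have hm := left_bil (tpow_left hB hC m hV); have [lm rm] := hm.
elim/tensor_ind: u => [v u|y z hy hz]; last first.
  by rewrite [bact x _]lmD !lmD hy hz.
rewrite [bact x _](diag_actE _ _ _ bV hm) sws_lin inner_cutsE lmD (diag_actE _ _ _ bS bS).
transitivity (sws (delta x) (fun a b => inj 1 (aV a v) ⊗ inj m.+1 (bact b u)) +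
   sws (delta x) (fun a b => tmap (tcons (aV a v)) id (diag_act aS aS b (inner_cuts V m u)))).
  by rewrite swsD; apply: eq_sws => a b; rewrite inner_cutsE IH.
congr (_ + _).
  by apply: eq_sws => a b; rewrite !(bact_inj hB hC hV).
elim/tensor_ind: (inner_cuts V m u) => [p q|y z hy hz]; last first.
  rewrite !lmD -hy -hz swsD; apply: eq_sws => a b.
  by rewrite !lmD.
rewrite tmapG // (diag_actE _ _ _ bS bS).
pose F a b c : TS ⨂ TS := tcons (aV a v) (aS b p) ⊗ aS c q.
transitivity (sws (delta x) (fun a b => sws (delta b) (fun b1 b2 => F a b1 b2))).
  apply: eq_sws => a b; rewrite (diag_actE _ _ _ bS bS) sws_lin; apply: eq_sws => c d.
  by rewrite tmapG.
rewrite -(sws_mc_coassoc hB); last first.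
  split=> ?; split=> ? s w w'.
  - by rewrite /F rS pure_linearr.
  - by rewrite /F rS lmP pure_linearl.
  - by rewrite /F rS lmP pure_linearl.
  - by rewrite /F rV' linear_tcons pure_linearl.
apply: eq_sws => a b; rewrite act_tcons.
by rewrite -[_ ⊗ aS b q]/(purer (aS b q) _) sws_lin.
Qed.

Lemma act_deconc x (z : TS) : deconc V (aS x z) = diag_act aS aS x (deconc V z).
Proof.
have [lS rS] := bS.
elim/dsum_ind: z => [|n u|y z hy hz].
- by rewrite (linear_fun0 (lS x)) !lm0.
- rewrite (bact_inj hB hC hV) !comul_inj; case: n u => [|m] u.
    rewrite [LHS](congr1 (tmap (inj 0) (inj 0)) (left_act hC x u)).
    apply: (@diag_tmap _ _ _ _ _ _ _ _ _ _ (inj 0) (inj 0)) => // y b;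
      exact/esym/(bact_inj hB hC hV y (b : tcomp V 0)).
  have hm := tpow_left hB hC m hV; have bm := left_bil hm.
  rewrite /deconc_comp 2!lmD; congr (_ + _ + _).
  + rewrite (left_act hm).
    apply: (@diag_tmap _ _ _ _ _ _ _ _ _ _ (inj 0) (inj m.+1)) => // y b.
      exact/esym/(bact_inj hB hC hV y (b : tcomp V 0)).
    exact/esym/(bact_inj hB hC hV y (b : tcomp V m.+1)).
  + exact: act_inner_cuts.
  + rewrite (tpow_rho_equivariant hB hC hV rV).
    apply: (@diag_tmap _ _ _ _ _ _ _ _ _ _ (inj m.+1) (inj 0)) => // y b.
      exact/esym/(bact_inj hB hC hV y (b : tcomp V m.+1)).
    exact/esym/(bact_inj hB hC hV y (b : tcomp V 0)).
- by rewrite (linear_funD _ _ (lS x)) !lmD hy hz.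
Qed.

Hypothesis rC : rho_equivariant (unit_bimod B).

Lemma tspace_rho_equivariant : rho_equivariant TS.
Proof.
have [lS rS] := bS.
move=> x z; elim/dsum_ind: z => [|n u|y z hy hz].
- by rewrite (linear_fun0 (lS x)) !lm0.
- have hn := tcomp_left hB hC n hV.
  have rn : rho_equivariant (tcomp V n).
    by case: n {u hn} => [|m]; [exact: rC|exact: tpow_rho_equivariant].
  rewrite (bact_inj hB hC hV) !brho_inj rn.
  apply: (@diag_tmap _ _ _ _ _ _ _ _ _ _ (inj n) idfun) => //; first exact: left_bil.
  by move=> y v; rewrite (bact_inj hB hC hV).
- by rewrite (linear_funD _ _ (lS x)) !lmD hy hz.
Qed.

Lemma act_deconc_counit x (z : TS) :
  deconc_counit V (aS x z) = mc_act B x (deconc_counit V z).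
Proof.
have [lS rS] := bS; have [lC _] := bC.
elim/dsum_ind: z => [|[|m] u|y z hy hz].
- by rewrite (linear_fun0 (lS x)) !lm0 (linear_fun0 (lC x)).
- by rewrite (bact_inj hB hC hV) !counit_inj0.
- by rewrite (bact_inj hB hC hV) !counit_injS (linear_fun0 (lC x)).
- by rewrite (linear_funD _ _ (lS x)) !lmD (linear_funD _ _ (lC x)) hy hz.
Qed.

End Equivariance.

(** * Coinvariants of cotensor powers *)

Section Coinvariants.
Variables (k : fieldType) (U : hopfAlg k) (H : subBialg U).
Local Notation HT := (subalg (sb_set H)).
Local Notation HB := (Hk_modcoalg H).
Variable B : modcoalg k.
Hypothesis hB : is_mc B.
Hypothesis hC : is_left (unit_bimod B).
Variables (one : B) (iH : {linear HT -> mc_alg B}).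
Hypothesis one_comul : mc_comul B one = one ⊗ one.
Hypothesis one_counit : mc_counit B one = (1 : k^o).
Hypothesis counitr : forall c : B,
  tlift (fun a b => (mc_counit B b : k) *: a) (mc_comul B c) = c.
Hypothesis iH_delta : forall h, mc_delta B (iH h) = tmap iH iH (sb_delta H h).
Hypothesis iH_one : forall h, mc_act B (iH h) one = (heps U (val h) : k) *: one.
Let bC : bilinear_op (mc_act B) := left_bil hC.

Definition coinv (M : bimod B) : set M := [set m | blam M m = one ⊗ m].

Lemma subspace_coinv M : is_subspace (@coinv M).
Proof.
split=> [|a u v]; rewrite /coinv /mkset; first by rewrite !lm0.
by rewrite !lmP => -> ->.
Qed.

Definition coinv_diff (M : bimod B) : {linear M -> B ⨂ M} := (blam M \- pure one)%R.

Lemma coinv_ker (M : bimod B) : @coinv M = [set m | coinv_diff M m = 0].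
Proof.
apply/seteqP; split=> m; rewrite /coinv /coinv_diff /mkset /= => h.
  by rewrite h subrr.
by apply/eqP; rewrite -subr_eq0 h.
Qed.

(** A coinvariant of a tensor product has its first factor coinvariant; if the
    right coaction is trivial on coinvariants, the cotensor condition then makes
    the second factor coinvariant too. *)
Lemma coinv_cotensor (M N : bimod B) (A : set M) (D : set N) (u : M ⨂ N) :
  is_subspace A -> is_subspace D ->
  (forall a, A a -> coinv a -> brho M a = a ⊗ one) ->
  tsub A D u -> cotensor M N u -> @coinv (tens_bimod M N) u ->
  tsub (A `&` @coinv M) (D `&` @coinv N) u.
Proof.
move=> hA hD hrho hu cu iu.
have hcM := @subspace_coinv M; have hcN := @subspace_coinv N.
have uA : tsub A setT u by apply: tsub_mono hu.
have uD : tsub setT D u by apply: tsub_mono hu.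
have uI : tsub (@coinv M) setT u.
  pose d := coinv_diff M; rewrite coinv_ker -/d.
  apply: tmap_ker_l.
  have : tassoc _ _ _ (tmap d id u) = 0.
    have -> : tassoc _ _ _ (tmap d id u) = blam (tens_bimod M N) u - one ⊗ u.
      rewrite blam_tensE.
      elim/tensor_ind: u {hu cu iu uA uD} => [m n|y z hy hz].
        rewrite (tmapE_idr d) (tmapE_idr (blam M)) -[d m ⊗ n]/(purer n (d m)).
        rewrite [d m]/(blam M m - one ⊗ m) (lmB (purer n)) (lmB (tassoc B M N)) /purer.
        by rewrite (tassocE one m n).
      by rewrite !lmD hy hz addrACA.
    by apply/eqP; rewrite subr_eq0; apply/eqP.
  by move=> e; apply: (can_inj (@tassocK _ _ _ _)); rewrite e lm0.
have uAI : tsub (A `&` @coinv M) setT u.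
  apply: slice_r_tsub => [|xi]; first exact: subspaceI.
  by split; apply: tsub_slice_r (_ : tsub _ setT u).
have uN : tsub setT (@coinv N) u.
  pose d := coinv_diff N; rewrite coinv_ker -/d.
  apply: tmap_ker_r.
  have -> : tmap id d u = tmap id (blam N) u - tassoc _ _ _ (tmap (brho M) id u).
    pose P : set (M ⨂ N) := [set u | tmap id d u = tmap id (blam N) u - tassoc _ _ _ (tmap (brho M) id u)].
    suff : tsub (A `&` @coinv M) setT `<=` P by apply.
    apply: tsub_sub => [|m n [Am im] _].
      split=> [|a y z]; rewrite /P /mkset; first by rewrite !lm0 addr0.
      by rewrite !lmP => -> ->; rewrite !scalerDr addrACA.
    rewrite /P /mkset (tmapE_idl d) (tmapE_idl (blam N)) (tmapE_idr (brho M)) hrho //.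
    by rewrite tassocE -(lmB (pure m)).
  by apply/eqP; rewrite subr_eq0; apply/eqP/esym.
apply: tsubI => //; try exact: subspaceI.
apply: slice_l_tsub => [|xi]; first exact: subspaceI.
by split; apply: tsub_slice_l (_ : tsub setT _ u).
Qed.

Variables (T : bimod HB) (W : bimod B) (j : {linear T -> W}).
Variables (RT : set (T ⨂ T)) (RW : set (W ⨂ W)).
Hypothesis hT : is_lmodule (@bact k HB T).
Hypothesis lamT : forall t : T, blam T t = (1 : k^o) ⊗ t.
Hypothesis rhoT : forall t : T, brho T t = t ⊗ (1 : k^o).
Hypothesis hW : is_left W.
Hypothesis rW : rho_equivariant W.
Hypothesis cW : lam_rho_commute W.
Hypothesis j_inj : injective j.
Hypothesis j_act : forall (h : HT) t, j (@bact k HB T h t) = @bact k B W (iH h) (j t).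
Hypothesis j_coinv : forall t, coinv (j t).
Hypothesis j_rho : forall t, brho W (j t) = j t ⊗ one.
Hypothesis j_onto : forall w : W, coinv w -> exists t, j t = w.
Hypothesis sRT : is_subspace RT.
Hypothesis sRW : left_stable (RW : set (tens_bimod W W)).
Hypothesis RWcot : RW `<=` cotensor W W.
Hypothesis RTW : forall r, RT r <-> RW (tmap j j r).

Fixpoint jpow (m : nat) : {linear tpow T m -> tpow W m} :=
  match m return {linear tpow T m -> tpow W m} with
  | 0 => j
  | m'.+1 => tmap j (jpow m')
  end.

Lemma jone_linear : linear (fun c : k^o => (c : k) *: one).
Proof. by move=> a x y; rewrite scalerDl -scalerA. Qed.

Definition jcomp (n : nat) : {linear tcomp T n -> tcomp W n} :=
  match n return {linear tcomp T n -> tcomp W n} with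
  | 0 => mklin jone_linear
  | m.+1 => jpow m
  end.

Local Notation injT n := (@dinj k (tcomp T) n).
Local Notation injW n := (@dinj k (tcomp W) n).

(** The embedding of words in [T] into words in [W]: [one] in degree 0 and the
    powers of [j] in positive degrees. *)
Definition jsp : {linear tspace T -> tspace W} := dlift (fun n u => injW n (jcomp n u)).

Lemma jsp_inj n u : jsp (injT n u) = injW n (jcomp n u).
Proof. by rewrite [LHS]dliftE // => m a x y; rewrite !lmP. Qed.

Lemma dcomp_jsp z n : dcomp (jsp z) n = jcomp n (dcomp z n).
Proof.
rewrite -dprojE -[dcomp z n]dprojE.
elim/dsum_ind: z => [|m u|y z hy hz]; [by rewrite !lm0| |by rewrite !lmD hy hz].
rewrite jsp_inj; have [e|ne] := eqVneq m n; first by subst m; rewrite !dproj_inj.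
by rewrite !dproj_inj_neq // lm0.
Qed.

Lemma jpow_inj m : injective (jpow m).
Proof. by elim: m => //= m IH; apply: tmap_inj. Qed.

Lemma one_neq0 : one != 0.
Proof.
apply/eqP => e; have := one_counit; rewrite e lm0 => /esym/eqP.
by rewrite oner_eq0.
Qed.

Lemma jcomp_inj n : injective (jcomp n).
Proof.
case: n => [|m]; last exact: jpow_inj.
apply: injective_lin => c /= /eqP; rewrite scaler_eq0 (negPf one_neq0) orbF.
by move/eqP.
Qed.

Lemma jsp_injective : injective jsp.
Proof.
apply: injective_lin => z e; apply: dsum_eq => n.
by apply: (@jcomp_inj n); rewrite -dcomp_jsp e lm0.
Qed.

Lemma jpow_coinv m u : coinv (jpow m u).
Proof.
case: m u => [|m] u; first exact: j_coinv.
rewrite /coinv /mkset.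
elim/tensor_ind: u => [t u|y z hy hz]; last by rewrite !lmD hy hz.
by rewrite /= tmapG // blam_tens j_coinv tmapG.
Qed.

Lemma jpow_rho m u : brho (tpow W m) (jpow m u) = jpow m u ⊗ one.
Proof.
elim: m u => [|m IH] u; first exact: j_rho.
elim/tensor_ind: u => [t u|y z hy hz]; last by rewrite !lmD hy hz pureDl.
by rewrite [jpow _ _](tmapE j (jpow m)) brho_tens IH tmapG.
Qed.

Lemma jcomp_coinv n u : coinv (jcomp n u).
Proof.
case: n u => [|m] u; last exact: jpow_coinv.
rewrite /coinv /mkset /= [LHS](lmZ (mc_comul B)) one_comul.
by rewrite -pureZr.
Qed.

Lemma jcomp_rho n u : brho (tcomp W n) (jcomp n u) = jcomp n u ⊗ one.
Proof.
case: n u => [|m] u; last exact: jpow_rho.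
rewrite /= [LHS](lmZ (mc_comul B)) one_comul.
by rewrite -pureZl.
Qed.

Lemma jsp_coinv z : @coinv (tspace_bimod W) (jsp z).
Proof.
rewrite /coinv /mkset.
elim/dsum_ind: z => [|n u|y z hy hz]; [by rewrite !lm0| |by rewrite !lmD hy hz].
by rewrite jsp_inj (blam_inj) jcomp_coinv tmapG.
Qed.

Lemma jsp_rho z : brho (tspace_bimod W) (jsp z) = jsp z ⊗ one.
Proof.
elim/dsum_ind: z => [|n u|y z hy hz]; last by rewrite !lmD hy hz pureDl.
  by rewrite !lm0 pure0l.
by rewrite jsp_inj brho_inj jcomp_rho tmapG.
Qed.

Let bT : bilinear_op (@bact k HB T) := lmod_bilinear hT.

Lemma jpow_act m (h : HT) u :
  jpow m (@bact k HB (tpow T m) h u) = @bact k B (tpow W m) (iH h) (jpow m u).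
Proof.
elim: m h u => [|m IH] h u; first exact: j_act.
have hm := tpow_left hB hC m hW.
have bm := left_bil hm; have bW := left_bil hW; have [_ rm] := bm; have [_ rWW] := bW.
have bmT : bilinear_op (@bact k HB (tpow T m)).
  elim: (m) => [|p IHp]; first exact: bT.
  exact: (@diag_bilinear k HB).
rewrite [LHS]/(tmap j (jpow m) _).
elim/tensor_ind: u => [t u|y z hy hz].
  have eT : @bact k HB (tens_bimod T (tpow T m)) h (t ⊗ u) =
      sws (sb_delta H h) (fun a b => @bact k HB T a t ⊗ @bact k HB (tpow T m) b u).
    exact: (@diag_actE k HB _ _ _ _ h t u bT bmT).
  apply: etrans (congr1 (tmap j (jpow m)) eT) _; rewrite sws_lin.
  rewrite [jpow _ _](tmapE j (jpow m)) [RHS](diag_actE _ _ _ bW bm) iH_delta.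
  rewrite swsE_tmap //; last by split=> ? s x y; rewrite ?rm ?rWW ?pure_linearl ?pure_linearr.
  by apply: eq_sws => a b; rewrite tmapG // j_act IH.
have actD (a b : tens_bimod T (tpow T m)) : 
    @bact k HB (tens_bimod T (tpow T m)) h (a + b) =
    @bact k HB (tens_bimod T (tpow T m)) h a + @bact k HB (tens_bimod T (tpow T m)) h b.
  exact: lmD.
apply: etrans (congr1 (tmap j (jpow m)) (actD y z)) _.
apply: etrans (lmD (tmap j (jpow m)) _ _) _; apply: etrans (congr2 +%R hy hz) _.
symmetry; apply: etrans (congr1 (@bact k B (tpow W m.+1) (iH h)) (lmD (jpow m.+1) y z)) _.
exact: lmD.
Qed.

Lemma bact_tpowT_linear m h : linear (@bact k HB (tpow T m) h).
Proof. by case: m => [|m]; [case: bT|apply: linP]. Qed.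

Lemma bact_tcompT_linear n h : linear (@bact k HB (tcomp T n) h).
Proof.
case: n => [|m]; last exact: bact_tpowT_linear.
by move=> a x y /=; rewrite mulrDr [_ * (a *: x)]mulrCA.
Qed.

Lemma bactT_inj n (h : HT) u :
  @bact k HB (tspace_bimod T) h (injT n u) = injT n (@bact k HB (tcomp T n) h u).
Proof. by rewrite [LHS]dliftE // => m a x y; rewrite bact_tcompT_linear lmP. Qed.

Lemma jsp_act (h : HT) z :
  jsp (@bact k HB (tspace_bimod T) h z) = @bact k B (tspace_bimod W) (iH h) (jsp z).
Proof.
have lS := (left_bil (tspace_left hB hC hW)).1.
elim/dsum_ind: z => [|n u|y z hy hz].
- have -> : @bact k HB (tspace_bimod T) h 0 = 0 by apply: (lm0 (dlift _)).
  by rewrite lm0 (linear_fun0 (lS _)).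
- rewrite bactT_inj !jsp_inj (bact_inj hB hC hW); congr (injW n _).
  case: n u => [|m] u; last exact: jpow_act.
  rewrite /= [RHS](linear_funZ _ _ ((left_bil hC).1 (iH h))) /= iH_one.
  by rewrite scalerA mulrC.
- have -> : @bact k HB (tspace_bimod T) h (y + z) =
      @bact k HB (tspace_bimod T) h y + @bact k HB (tspace_bimod T) h z.
    by apply: (lmD (dlift _)).
  by rewrite !lmD (linear_funD _ _ (lS _)) -hy -hz.
Qed.

Lemma jsp_tcons t z : tcons (j t) (jsp z) = jsp (tcons t z).
Proof.
elim/dsum_ind: z => [|[|m] u|y z hy hz]; [by rewrite !lm0| | |by rewrite !lmD hy hz].
  by rewrite jsp_inj !tcons_inj0 lm0.
by rewrite jsp_inj !tcons_injS jsp_inj /= tmapG.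
Qed.

Lemma jpow_inner_cuts m u : inner_cuts W m (jpow m u) = tmap jsp jsp (inner_cuts T m u).
Proof.
elim: m u => [|m IH] u; first by rewrite /= lm0.
elim/tensor_ind: u => [t u|y z hy hz]; last by rewrite !lmD hy hz.
rewrite [jpow _ _](tmapE j (jpow m)) !inner_cutsE lmD tmapG // !jsp_inj; congr (_ + _).
rewrite IH; elim/tensor_ind: (inner_cuts T m u) => [p q|y z hy hz]; last by rewrite !lmD hy hz.
by rewrite !tmapG // jsp_tcons.
Qed.

Lemma jsp_deconc z : deconc W (jsp z) = tmap jsp jsp (deconc T z).
Proof.
elim/dsum_ind: z => [|n u|y z hy hz]; [by rewrite !lm0| |by rewrite !lmD hy hz].
rewrite jsp_inj.
have j1 : jsp (tone T) = injW 0 (one) by rewrite jsp_inj /= scale1r.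
case: n u => [|m] u.
  rewrite [X in deconc T X]inj0E (lmZ (deconc T)) comul_tone (lmZ (tmap jsp jsp)).
  rewrite (tmapE jsp jsp) j1 (lmZ (injW 0)) (lmZ (deconc W)); congr (_ *: _).
  by rewrite comul_inj /= one_comul; apply: (tmapE (injW 0) (injW 0)).
rewrite (comul_injS lamT rhoT) comul_inj /deconc_comp [jcomp _ _]/(jpow m u).
rewrite jpow_coinv jpow_rho 2!lmD jpow_inner_cuts.
rewrite (tmapE (injW 0) (injW m.+1)) (tmapE (injW m.+1) (injW 0)).
by rewrite !(tmapE jsp jsp) j1 jsp_inj.
Qed.

Lemma jsp_counit z : deconc_counit W (jsp z) = (hcounit T z : k) *: one.
Proof.
elim/dsum_ind: z => [|n u|y z hy hz].
- by rewrite !lm0 scale0r.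
- rewrite jsp_inj; case: n u => [|m] u.
    by rewrite counit_inj0 /hcounit [deconc_counit T _]counit_inj0.
  by rewrite counit_injS /hcounit [deconc_counit T _]counit_injS scale0r.
- by rewrite !lmD hy hz scalerDl.
Qed.

(** Letters that are coinvariant on both sides satisfy every cotensor condition. *)
Lemma jpow_cotensor m (u : T ⨂ tpow T m) : cotensor W (tpow W m) (tmap j (jpow m) u).
Proof.
rewrite /cotensor /mkset.
elim/tensor_ind: u => [t u|y z hy hz]; last by rewrite !lmD hy hz.
by rewrite (tmapE j (jpow m)) (tmapE_idr (brho W)) (tmapE_idl (blam (tpow W m))) j_rho tassocE jpow_coinv.
Qed.

Lemma jpow_cotensor_pow m u : @cotensor_pow k B W m (jpow m u).
Proof.
elim: m u => // m IH u; split; last exact: jpow_cotensor.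
exact: (@tsub_map _ _ _ _ _ j (jpow m) setT setT _ _ _ _ _ (tsubT u)).
Qed.

Lemma tmapjj_cotensor2 m (s : (T ⨂ T) ⨂ tpow T m) :
  cotensor (tens_bimod W W) (tpow W m) (tmap (tmap j j) (jpow m) s).
Proof.
pose f := tmap (tmap j j) (jpow m).
move: s; apply: (tensor_ext3 (f := tassoc _ _ _ \o (tmap (brho (tens_bimod W W)) id \o f))
  (g := tmap id (blam (tpow W m)) \o f)) => t t' u.
have e : f ((t ⊗ t') ⊗ u) = (j t ⊗ j t') ⊗ jpow m u.
  by rewrite (tmapE (tmap j j) (jpow m)) (tmapE j j).
apply: etrans (congr1 (tassoc _ _ _) (congr1 (tmap (brho (tens_bimod W W)) id) e)) _.
apply: etrans _ (esym (congr1 (tmap id (blam (tpow W m))) e)).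
rewrite (tmapE_idl (blam (tpow W m))) jpow_coinv (tmapE_idr (brho (tens_bimod W W))).
by rewrite brho_tens j_rho (tmapE_idr (pure (j t))) tassocE.
Qed.

Lemma jpow_rel i m u : (i < m)%N -> tensor_at RT i u -> cotensor_at RW i (jpow m u).
Proof.
elim: m i u => // m IH [|i] u lim /=.
  case: m {IH lim} u => [|m] u; first by move/RTW.
  case=> s hs <-; exists (tmap (tmap j j) (jpow m) s); last first.
    by rewrite tassoc_nat.
  split; last exact: tmapjj_cotensor2.
  apply: (@tsub_map _ _ _ _ _ (tmap j j) (jpow m) RT setT _ _ _ _ _ hs) => [r /RTW //|w _].
  exact: jpow_cotensor_pow.
move=> hu; split; last exact: jpow_cotensor.
apply: (@tsub_map _ _ _ _ _ j (jpow m) setT (@tensor_at k HB T RT i m) _ _ _ _ _ hu) => // w.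
exact: IH.
Qed.

Lemma coinv_rho (w : W) : coinv w -> brho W w = w ⊗ one.
Proof. by move=> /j_onto[t <-]. Qed.

Lemma tsub_coinv_im m (D : set (tpow W m)) (D' : set (tpow T m)) u :
  (forall w, D w -> exists2 u', D' u' & jpow m u' = w) ->
  tsub (@coinv W) D u -> exists2 u', tsub setT D' u' & tmap j (jpow m) u' = u.
Proof.
move=> hD hu; apply: im_tmap; apply: tsub_mono hu => [w /j_onto[t <-]|w /hD[u' hu' <-]].
  by exists t.
by exists u'.
Qed.

Lemma coinv_cotensor_pow m u : @cotensor_pow k B W m u -> coinv u ->
  exists u', jpow m u' = u.
Proof.
elim: m u => [|m IH] u; first by move=> _; apply: j_onto.
case=> hu cu iu.
have hp : is_subspace (@cotensor_pow k B W m) by case: (cotensor_pow_stable hB hC hW rW cW m).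
have := coinv_cotensor (subspaceT _) hp (fun a _ => @coinv_rho a) hu cu iu.
move=> h; have [||u' _ e] := @tsub_coinv_im m (@cotensor_pow k B W m `&` @coinv _) setT u.
- by move=> w [h1 h2]; have [u' e] := IH w h1 h2; exists u'.
- by apply: tsub_mono h => w [].
by exists u'.
Qed.

Lemma coinv_RW r : RW r -> @coinv (tens_bimod W W) r -> exists2 r', RT r' & tmap j j r' = r.
Proof.
move=> hr ir.
have [|r' e] := @coinv_cotensor_pow 1 r _ ir.
  by split; [apply: tsubT|apply: RWcot].
by exists r' => //; apply/RTW; move: hr; rewrite -e.
Qed.

(** Induction on the number of letters by [coinv_cotensor]. At position 0 the
    factor [RW] is split off instead of a single letter. *)
Lemma coinv_cotensor_at i m u : (i < m)%N -> @cotensor_at k B W RW i m u -> coinv u ->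
  exists2 u', tensor_at RT i u' & jpow m u' = u.
Proof.
elim: m i u => // m IH [|i] u lim.
  case: m {IH lim} u => [|m] u; first exact: coinv_RW.
  case=> s [hs cs] <- is_.
  have hp : is_subspace (@cotensor_pow k B W m) by case: (cotensor_pow_stable hB hC hW rW cW m).
  have sRW' : is_subspace RW by case: sRW.
  have is' : @coinv (tens_bimod (tens_bimod W W) (tpow W m)) s.
    apply: (@tmap_inj_r _ B _ _ (tassoc W W (tpow W m))).
      exact: (can_inj (@tassocK _ _ _ _)).
    apply: etrans (esym (blam_tassoc s)) _; apply: etrans is_ _.
    exact/esym/(tmapE_idl (tassoc W W (tpow W m))).
  have hr' a : RW a -> @coinv (tens_bimod W W) a -> brho (tens_bimod W W) a = a ⊗ one.
    move=> hr ir; have [r' _ <-] := coinv_RW hr ir.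
    elim/tensor_ind: r' => [t t'|y z hy hz]; last by rewrite !(lmD, pureDl) hy hz.
    by rewrite (tmapE j j) brho_tens j_rho (tmapE_idr (pure (j t))).
  have hs' := @coinv_cotensor (tens_bimod W W) (tpow W m) RW _ s sRW' hp hr' hs cs is'.
  have [|s' hs1 e] := @im_tmap _ _ _ _ _ (tmap j j) (jpow m) RT setT s.
    apply: tsub_mono hs' => [r [hr ir]|w [hw iw]].
      by have [r' h1 h2] := coinv_RW hr ir; exists r'.
    by have [w' h2] := coinv_cotensor_pow hw iw; exists w'.
  exists (tassoc T T (tpow T m) s'); first by exists s'.
  by rewrite -e tassoc_nat.
case=> hu cu iu.
have hp : is_subspace (@cotensor_at k B W RW i m) by case: (@cotensor_at_stable k B hB hC W hW rW cW RW i m sRW lim).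
have := coinv_cotensor (subspaceT _) hp (fun a _ => @coinv_rho a) hu cu iu.
move=> h; have [||u' h1 h2] := @tsub_coinv_im m (@cotensor_at k B W RW i m `&` @coinv _) (@tensor_at k HB T RT i m) u.
- by move=> w [h1 h2]; apply: IH.
- by apply: tsub_mono h => w [].
by exists u'.
Qed.

Definition coquad_space : set (tspace W) :=
  [set z | forall m i, (i < m)%N -> cotensor_at RW i (dcomp z m.+1)].

Lemma quad_coquad z : quad_space RT z <-> coquad_space (jsp z).
Proof.
split=> h m i lim; have := h m i lim; rewrite dcomp_jsp; first exact: jpow_rel.
move=> h'; have [u' hu' e] := coinv_cotensor_at lim h' (jpow_coinv _).
by rewrite -(jpow_inj e).
Qed.

Lemma coinv_coquad z : coquad_space z -> @coinv (tspace_bimod W) z ->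
  exists2 q, quad_space RT q & jsp q = z.
Proof.
move=> hz iz.
have ic n : coinv (dcomp z n : tcomp W n).
  by rewrite /coinv /mkset -dprojE dproj_blam iz tmapG.
have ex n : exists u, jcomp n u = dcomp z n.
  have := ic n; case: n => [|[|m]] in_.
  - move: (dcomp z 0%N) in_ => c ic'; exists (mc_counit B c).
    rewrite /= -[RHS]counitr [mc_comul B c]ic' sws_tlift; last first.
      split=> a s u v; first by rewrite lmP /= scalerDl -scalerA.
      by rewrite linear_scale.
    rewrite sws_pure //.
    split=> a s u v; first by rewrite lmP /= scalerDl -scalerA.
    by rewrite linear_scale.
  - exact: j_onto.
  - have [u' _ e] := coinv_cotensor_at (ltn0Sn m) (hz m.+1 0%N (ltn0Sn m)) in_.
    by exists u'.
pose q n := projT1 (cid (ex n)).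
have qE n : jcomp n (q n) = dcomp z n := projT2 (cid (ex n)).
have fin : exists N, forall n, (N <= n)%N -> q n = 0.
  have [N hN] := dsum_fin z; exists N => n /hN e.
  by apply: (@jcomp_inj n); rewrite qE e lm0.
have e : jsp (DSum fin) = z by apply: dsum_eq => n; rewrite dcomp_jsp /= qE.
by exists (DSum fin) => //; apply/quad_coquad; rewrite e.
Qed.

End Coinvariants.

(** * Induced coalgebras *)

Section Ulin.
Variables (k : fieldType) (B : modcoalg k).
Local Notation X := (mc_alg B).
Implicit Types M N P : lmodType k.

Definition ulin M N (aM : X -> M -> M) (aN : X -> N -> N) (f : M -> N) :=
  forall x m, f (aM x m) = aN x (f m).

Lemma ulin_comp M N P (aM : X -> M -> M) (aN : X -> N -> N) (aP : X -> P -> P)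
    (f : M -> N) (g : N -> P) :
  ulin aM aN f -> ulin aN aP g -> ulin aM aP (fun m => g (f m)).
Proof. by move=> hf hg x m; rewrite hf hg. Qed.

Lemma ulin_tmap M N M' N' (aM : X -> M -> M) (aN : X -> N -> N)
    (aM' : X -> M' -> M') (aN' : X -> N' -> N')
    (f : {linear M -> M'}) (g : {linear N -> N'}) :
  bilinear_op aM -> bilinear_op aN -> bilinear_op aM' -> bilinear_op aN' ->
  ulin aM aM' f -> ulin aN aN' g ->
  ulin (diag_act aM aN) (diag_act aM' aN') (tmap f g).
Proof. by move=> hM hN hM' hN' hf hg x z; apply: diag_tmap. Qed.

Lemma ulin_tassoc M N P (aM : X -> M -> M) (aN : X -> N -> N) (aP : X -> P -> P) :
  is_mc B -> bilinear_op aM -> bilinear_op aN -> bilinear_op aP ->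
  ulin (diag_act (diag_act aM aN) aP) (diag_act aM (diag_act aN aP)) (tassoc M N P).
Proof. by move=> hB hM hN hP x z; apply: diag_assoc. Qed.

Lemma ulin_assoc_l M P N P1 P2 (aM : X -> M -> M) (aP : X -> P -> P) (aN : X -> N -> N)
    (a1 : X -> P1 -> P1) (a2 : X -> P2 -> P2) (f : {linear M -> P ⨂ N}) (g : {linear P -> P1 ⨂ P2}) :
  is_mc B -> bilinear_op aP -> bilinear_op aN -> bilinear_op a1 -> bilinear_op a2 ->
  ulin aM (diag_act aP aN) f -> ulin aP (diag_act a1 a2) g ->
  ulin aM (diag_act a1 (diag_act a2 aN)) (tassoc _ _ _ \o (tmap g id \o f)).
Proof.
move=> hB bP bN b1 b2 hf hg; apply: ulin_comp (ulin_tassoc hB b1 b2 bN).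
apply: ulin_comp hf _.
exact: (ulin_tmap (g := idfun) bP bN (diag_bilinear b1 b2) bN hg).
Qed.

Lemma ulin_assoc_r M P N P1 P2 (aM : X -> M -> M) (aP : X -> P -> P) (aN : X -> N -> N)
    (a1 : X -> P1 -> P1) (a2 : X -> P2 -> P2) (f : {linear M -> N ⨂ P}) (g : {linear P -> P1 ⨂ P2}) :
  bilinear_op aP -> bilinear_op aN -> bilinear_op a1 -> bilinear_op a2 ->
  ulin aM (diag_act aN aP) f -> ulin aP (diag_act a1 a2) g ->
  ulin aM (diag_act aN (diag_act a1 a2)) (tmap id g \o f).
Proof.
move=> bP bN b1 b2 hf hg; apply: ulin_comp hf _.
exact: (ulin_tmap (f := idfun) bN bP bN (diag_bilinear b1 b2) _ hg).
Qed.

End Ulin.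

Section Induced.
Variables (k : fieldType) (U : hopfAlg k) (H : subBialg U).
Local Notation HT := (subalg (sb_set H)).
Local Notation C := (quot_coalg H).
Local Notation B := (UC_modcoalg H).
Local Notation HB := (Hk_modcoalg H).
Local Notation Delta := (hdelta U).
Local Notation cl := (cls H).
Variable D : coalg HB.
Local Notation aD := (@bact k HB D).
Hypothesis hD : is_lmodule aD.
Hypothesis comul_act : forall (h : HT) d, comul D (aD h d) = @diag_act k HB D D aD aD h (comul D d).
Hypothesis counit_act : forall (h : HT) d,
  counit D (aD h d) = (heps U (val h) * (counit D d : k^o) : k^o).
Hypothesis Dcoassoc : forall d,
  tassoc _ _ _ (tmap (comul D) id (comul D d)) = tmap id (comul D) (comul D d).
Hypothesis Dcounitl : forall d, tlift (fun a b : D => (counit D a : k) *: b) (comul D d) = d.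
Hypothesis Dcounitr : forall d, tlift (fun a b : D => (counit D b : k) *: a) (comul D d) = d.

Let bD : bilinear_op aD := lmod_bilinear hD.
Let hB : is_mc B := UC_mc H.
Let bC : bilinear_op (fun x => C_act H x : C -> C) := lmod_bilinear (C_lmod H).

Local Notation E := (ind_car D).
Local Notation EC := (ind_coalg D).
Local Notation rp := (rpure (@U_ract k U H) aD).

(** The structure maps of [ind_coalg D] at the types that they reduce to, so that
    they can be composed. *)
Definition ind_act (y : U) : {linear E -> E} :=
  rlift (@U_ract k U H) aD (fun x d => rp (y * x) d).
Definition ind_lam : {linear E -> C ⨂ E} := blam EC.
Definition ind_rho : {linear E -> E ⨂ C} := brho EC.
Definition ind_comul : {linear E -> E ⨂ E} := comul EC.
Definition ind_counit : {linear E -> C} := counit EC.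
Local Notation aE := (fun y : U => ind_act y : E -> E).
Local Notation aC := (fun x => C_act H x : C -> C).

Lemma bil_rp : bilinear_op rp.
Proof. exact: bilinear_rpure. Qed.

Lemma ind_actE y x d : ind_act y (rp x d) = rp (y * x) d.
Proof.
have [rl rr] := bil_rp.
rewrite [LHS]rliftE //.
  by split=> ? s u v; rewrite ?linear_mull ?rl ?rr.
by move=> x' h d'; rewrite /U_ract mulrA -rpure_balanced.
Qed.

Lemma bil_lam d : bilinear_op (fun a b => cl a ⊗ rp b d).
Proof.
have [rl rr] := bil_rp.
by split=> ? s u v; rewrite ?lmP ?rr ?pure_linearl ?pure_linearr.
Qed.

Lemma bil_rho d : bilinear_op (fun a b => rp a d ⊗ cl b).
Proof.
have [rl rr] := bil_rp.
by split=> ? s u v; rewrite ?lmP ?rr ?pure_linearl ?pure_linearr.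
Qed.

Lemma ind_lamE x d : ind_lam (rp x d) = sws (Delta x) (fun a b => cl a ⊗ rp b d).
Proof.
have [rl rr] := bil_rp; have hb := bil_lam.
rewrite -(sws_tlift _ (hb d)) [LHS]rliftE //.
  split=> [y|d'] s u v; last by rewrite !lmP.
  rewrite !(sws_tlift _ (hb _)).
  rewrite (@lin_sws _ _ _ _ _ _ (fun v a b => cl a ⊗ rp b v)) // => a b s' u' v'.
  by rewrite rl pure_linearr.
move=> y h d'; rewrite !(sws_tlift _ (hb _)) /U_ract h_deltaM //; apply: eq_sws => a b.
apply: etrans (@sws_cls_l _ _ _ _ (fun c e => c ⊗ rp (b * e) d') a h _) _.
  by split=> ? s u v; rewrite ?pure_linearl // linear_mull rr pure_linearr.
by rewrite -[b * _]/(U_ract b h) rpure_balanced.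
Qed.

Lemma ind_rhoE x d : ind_rho (rp x d) = sws (Delta x) (fun a b => rp a d ⊗ cl b).
Proof.
have [rl rr] := bil_rp; have hb := bil_rho.
rewrite -(sws_tlift _ (hb d)) [LHS]rliftE //.
  split=> [y|d'] s u v; last by rewrite !lmP.
  rewrite !(sws_tlift _ (hb _)).
  rewrite (@lin_sws _ _ _ _ _ _ (fun v a b => rp a v ⊗ cl b)) // => a b s' u' v'.
  by rewrite rl pure_linearl.
move=> y h d'; rewrite !(sws_tlift _ (hb _)) /U_ract h_deltaM //; apply: eq_sws => a b.
apply: etrans (@sws_cls_r _ _ _ _ (fun c e => rp (a * c) d' ⊗ e) b h _) _.
  by split=> ? s u v; rewrite ?pure_linearr // linear_mull rr pure_linearl.
by rewrite -[a * _]/(U_ract a h) rpure_balanced.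
Qed.

Lemma bil_comul2 a b : bilinear_op (fun p q => rp a p ⊗ rp b q).
Proof.
have [rl rr] := bil_rp.
by split=> ? s u v; rewrite ?rl ?pure_linearl ?pure_linearr.
Qed.

Lemma bil_comul1 z : bilinear_op (fun a b => sws z (fun p q => rp a p ⊗ rp b q)).
Proof.
have [rl rr] := bil_rp.
by split=> ?; apply: lin_sws => p q s u v; rewrite ?rr ?pure_linearl ?pure_linearr.
Qed.

Lemma ind_comulE x d : ind_comul (rp x d) =
  sws (Delta x) (fun a b => sws (comul D d) (fun p q => rp a p ⊗ rp b q)).
Proof.
have [rl rr] := bil_rp.
have hb d' : (fun a b => tlift (fun d1 d2 => rp a d1 ⊗ rp b d2) (comul D d')) =
    (fun a b => sws (comul D d') (fun p q => rp a p ⊗ rp b q)).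
  by apply/funext => a; apply/funext => b; rewrite sws_tlift //; apply: bil_comul2.
have e y d' : tlift (fun a b => tlift (fun d1 d2 => rp a d1 ⊗ rp b d2) (comul D d')) (Delta y)
   = sws (Delta y) (fun a b => sws (comul D d') (fun p q => rp a p ⊗ rp b q)).
  by rewrite hb sws_tlift //; apply: bil_comul1.
rewrite -e [LHS]rliftE //.
  split=> [y|d'] s u v; last by rewrite !lmP.
  rewrite !e (@lin_sws _ _ _ _ _ _ (fun v a b => sws (comul D v) (fun p q => rp a p ⊗ rp b q))) // => a b s' u' v'.
  by rewrite lmP (sws_linear (bil_comul2 a b)).
move=> y h d'; rewrite !e /U_ract h_deltaM; last exact: bil_comul1.
apply: eq_sws => a b; rewrite comul_act.
rewrite sws_deltaH; last first.
  split=> ?; apply: lin_sws => p q s u v;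
  by rewrite !linear_mull ?rr ?pure_linearl ?pure_linearr.
have -> : @diag_act k HB D D aD aD h (comul D d') =
    sws (comul D d') (fun p q => sws (sb_delta H h) (fun c e => aD c p ⊗ aD e q)).
  rewrite {1}(swsE (comul D d')) sws_lin; apply: eq_sws => p q.
  exact: diag_actE.
rewrite sws_exch -[RHS](sws_tlift _ (bil_comul2 a b)) sws_lin; apply: eq_sws => p q.
rewrite sws_lin; apply: eq_sws => c e'.
rewrite (sws_tlift _ (bil_comul2 a b)) sws_pure; last exact: bil_comul2.
by rewrite -!rpure_balanced.
Qed.

Lemma ind_counitE x d : ind_counit (rp x d) = (counit D d : k) *: cl x.
Proof.
rewrite [LHS]rliftE //.
  split=> ? s u v; last by rewrite lmP linear_scale.
  by rewrite lmP scalerDl -scalerA.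
by move=> y h d'; rewrite counit_act cls_mulH scalerA mulrC.
Qed.

Lemma ind_lmod : is_lmodule aE.
Proof.
have [rl rr] := bil_rp.
split=> [x|e|e|x y e]; first exact: linP.
- move=> a u v; elim/rtensor_ind: e => [x d|y z hy hz].
    by rewrite !ind_actE linear_mulr rr.
  by rewrite !lmD hy hz addrACA.
- elim/rtensor_ind: e => [x d|y z hy hz]; first by rewrite ind_actE mul1r.
  by rewrite lmD hy hz.
- elim/rtensor_ind: e => [z d|z z' hz hz']; first by rewrite !ind_actE mulrA.
  by rewrite !lmD hz hz'.
Qed.

Let bE : bilinear_op aE := lmod_bilinear ind_lmod.

Definition ind_unit : {linear D -> E} := mklin (bil_rp.1 1).
Local Notation i1 := ind_unit.

Lemma ind_unitE x d : rp x d = ind_act x (i1 d).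
Proof. by rewrite ind_actE mulr1. Qed.

(** An induced module is generated by the [1 ⊗_H d]. So every axiom, being an
    identity of equivariant maps, reduces to the same axiom for [D]. *)
Lemma ind_ext (X : lmodType k) (aX : U -> X -> X) (f g : {linear E -> X}) :
  ulin (B := B) aE aX f -> ulin (B := B) aE aX g ->
  (forall d, f (i1 d) = g (i1 d)) -> forall e, f e = g e.
Proof.
move=> hf hg fg; elim/rtensor_ind => [x d|y z hy hz]; last by rewrite !lmD hy hz.
by rewrite ind_unitE hf hg fg.
Qed.

Lemma C_delta_one : C_delta H (cl 1) = cl 1 ⊗ cl 1.
Proof.
rewrite C_deltaE hdelta1; apply: (@sws_pure _ _ _ _ 1 1 (fun a b => cl a ⊗ cl b)).
exact: bilinear_cls2.
Qed.

Lemma lam1 d : ind_lam (i1 d) = cl 1 ⊗ i1 d.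
Proof. by rewrite ind_lamE hdelta1; apply: (sws_pure _ _ (bil_lam d)). Qed.

Lemma rho1 d : ind_rho (i1 d) = i1 d ⊗ cl 1.
Proof. by rewrite ind_rhoE hdelta1; apply: (sws_pure _ _ (bil_rho d)). Qed.

Lemma comul1 d : ind_comul (i1 d) = tmap i1 i1 (comul D d).
Proof.
rewrite ind_comulE hdelta1 tmap_sws.
exact: (sws_pure _ _ (bil_comul1 (comul D d))).
Qed.

Lemma counit1 d : ind_counit (i1 d) = (counit D d : k) *: cl 1.
Proof. exact: ind_counitE. Qed.

Lemma ulin_lam : ulin (B := B) aE (diag_act (B := B) aC aE) (ind_lam).
Proof.
move=> y; elim/rtensor_ind => [x d|z z' hz hz']; last by rewrite !lmD hz hz'.
rewrite ind_actE !ind_lamE (h_deltaM _ _ (bil_lam d)) [RHS]sws_lin sws_exch; apply: eq_sws => a b.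
rewrite (diag_actE (B := B)) //; apply: eq_sws => c e.
by rewrite C_actE ind_actE.
Qed.

Lemma ulin_rho : ulin (B := B) aE (diag_act (B := B) aE aC) (ind_rho).
Proof.
move=> y; elim/rtensor_ind => [x d|z z' hz hz']; last by rewrite !lmD hz hz'.
rewrite ind_actE !ind_rhoE (h_deltaM _ _ (bil_rho d)) [RHS]sws_lin sws_exch; apply: eq_sws => a b.
rewrite (diag_actE (B := B)) //; apply: eq_sws => c e.
by rewrite C_actE ind_actE.
Qed.

Lemma ulin_comul : ulin (B := B) aE (diag_act (B := B) aE aE) (ind_comul).
Proof.
move=> y; elim/rtensor_ind => [x d|z z' hz hz']; last by rewrite !lmD hz hz'.
rewrite ind_actE !ind_comulE (h_deltaM _ _ (bil_comul1 _)) [RHS]sws_lin sws_exch.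
apply: eq_sws => a b; rewrite [RHS]sws_lin sws_exch; apply: eq_sws => p q.
rewrite (diag_actE (B := B)) //; apply: eq_sws => c e.
by rewrite !ind_actE.
Qed.

Lemma ulin_counit : ulin (B := B) aE aC (ind_counit).
Proof.
move=> y; elim/rtensor_ind => [x d|z z' hz hz']; last by rewrite !lmD hz hz'.
by rewrite ind_actE !ind_counitE lmZ C_actE.
Qed.

Lemma ulin_Cdelta : ulin (B := B) aC (diag_act (B := B) aC aC) (C_delta H).
Proof. by move=> x c; apply: (left_act (UC_unit_left H)). Qed.

Local Notation dg := (diag_act (B := B)).


Lemma ind_lam_coassoc e :
  tassoc _ _ _ (tmap (C_delta H) id (ind_lam e)) = tmap id ind_lam (ind_lam e).
Proof.
pose f : {linear E -> C ⨂ (C ⨂ E)} := tassoc _ _ _ \o (tmap (C_delta H) id \o ind_lam).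
pose g : {linear E -> C ⨂ (C ⨂ E)} := tmap id ind_lam \o ind_lam.
apply: (@ind_ext _ (dg aC (dg aC aE)) f g).
- exact: (ulin_assoc_l (B := B) hB bC bE bC bC ulin_lam ulin_Cdelta).
- exact: (ulin_assoc_r (B := B) bE bC bC bE ulin_lam ulin_lam).
- by move=> d; rewrite /f /g /= lam1 (tmapE_idr (C_delta H)) (tmapE_idl ind_lam) C_delta_one lam1 tassocE.
Qed.

Lemma ind_rho_coassoc e :
  tassoc _ _ _ (tmap ind_rho id (ind_rho e)) = tmap id (C_delta H) (ind_rho e).
Proof.
pose f : {linear E -> E ⨂ (C ⨂ C)} := tassoc _ _ _ \o (tmap ind_rho id \o ind_rho).
pose g : {linear E -> E ⨂ (C ⨂ C)} := tmap id (C_delta H) \o ind_rho.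
apply: (@ind_ext _ (dg aE (dg aC aC)) f g).
- exact: (ulin_assoc_l (B := B) hB bE bC bE bC ulin_rho ulin_rho).
- exact: (ulin_assoc_r (B := B) bC bE bC bC ulin_rho ulin_Cdelta).
- by move=> d; rewrite /f /g /= rho1 (tmapE_idr ind_rho) (tmapE_idl (C_delta H)) C_delta_one rho1 tassocE.
Qed.

Lemma ind_lam_rho e :
  tassoc _ _ _ (tmap ind_lam id (ind_rho e)) = tmap id ind_rho (ind_lam e).
Proof.
pose f : {linear E -> C ⨂ (E ⨂ C)} := tassoc _ _ _ \o (tmap ind_lam id \o ind_rho).
pose g : {linear E -> C ⨂ (E ⨂ C)} := tmap id ind_rho \o ind_lam.
apply: (@ind_ext _ (dg aC (dg aE aC)) f g).
- exact: (ulin_assoc_l (B := B) hB bE bC bC bE ulin_rho ulin_lam).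
- exact: (ulin_assoc_r (B := B) bE bC bE bC ulin_lam ulin_rho).
- by move=> d; rewrite /f /g /= rho1 lam1 !tmapG // rho1 lam1 tassocE.
Qed.

Lemma ind_lam_counit e : tlift (fun b n => (C_eps H b : k) *: n) (ind_lam e) = e.
Proof.
have [rl rr] := bil_rp; have hb := @bilinear_scalel k C E (C_eps H).
elim/rtensor_ind: e => [x d|y z hy hz]; last by rewrite !lmD hy hz.
rewrite ind_lamE sws_lin -[RHS](h_counitl (G := fun b => rp b d)) //.
by apply: eq_sws => a b; rewrite (tlift_pure _ _ hb) C_epsE.
Qed.

Lemma ind_rho_counit e : tlift (fun n b => (C_eps H b : k) *: n) (ind_rho e) = e.
Proof.
have [rl rr] := bil_rp; have hb := @bilinear_scaler k E C (C_eps H).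
elim/rtensor_ind: e => [x d|y z hy hz]; last by rewrite !lmD hy hz.
rewrite ind_rhoE sws_lin -[RHS](h_counitr (G := fun b => rp b d)) //.
by apply: eq_sws => a b; rewrite (tlift_pure _ _ hb) C_epsE.
Qed.

Lemma ind_comul_lam e :
  tassoc _ _ _ (tmap ind_lam id (ind_comul e)) = tmap id ind_comul (ind_lam e).
Proof.
pose f : {linear E -> C ⨂ (E ⨂ E)} := tassoc _ _ _ \o (tmap ind_lam id \o ind_comul).
pose g : {linear E -> C ⨂ (E ⨂ E)} := tmap id ind_comul \o ind_lam.
apply: (@ind_ext _ (dg aC (dg aE aE)) f g).
- exact: (ulin_assoc_l (B := B) hB bE bE bC bE ulin_comul ulin_lam).
- exact: (ulin_assoc_r (B := B) bE bC bE bE ulin_lam ulin_comul).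
- move=> d; rewrite /f /g /= lam1 tmapG // comul1.
  elim/tensor_ind: (comul D d) => [p q|y z hy hz]; last by rewrite !lmD hy hz.
  by rewrite !tmapG // lam1 tassocE.
Qed.

Lemma ind_comul_rho e :
  tassocV _ _ _ (tmap id ind_rho (ind_comul e)) = tmap ind_comul id (ind_rho e).
Proof.
suff key : tmap id ind_rho (ind_comul e) = tassoc _ _ _ (tmap ind_comul id (ind_rho e)).
  by rewrite key; apply: tassocK.
pose f : {linear E -> E ⨂ (E ⨂ C)} := tmap id ind_rho \o ind_comul.
pose g : {linear E -> E ⨂ (E ⨂ C)} := tassoc _ _ _ \o (tmap ind_comul id \o ind_rho).
apply: (@ind_ext _ (dg aE (dg aE aC)) f g).
- exact: (ulin_assoc_r (B := B) bE bE bE bC ulin_comul ulin_rho).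
- exact: (ulin_assoc_l (B := B) hB bE bC bE bE ulin_rho ulin_comul).
- move=> d; rewrite /f /g /= rho1 tmapG // comul1.
  elim/tensor_ind: (comul D d) => [p q|y z hy hz]; last by rewrite !(lmD, pureDl) hy hz.
  by rewrite !tmapG // rho1 tassocE.
Qed.

Lemma ind_comul_cotensor e :
  tassoc _ _ _ (tmap ind_rho id (ind_comul e)) = tmap id ind_lam (ind_comul e).
Proof.
pose f : {linear E -> E ⨂ (C ⨂ E)} := tassoc _ _ _ \o (tmap ind_rho id \o ind_comul).
pose g : {linear E -> E ⨂ (C ⨂ E)} := tmap id ind_lam \o ind_comul.
apply: (@ind_ext _ (dg aE (dg aC aE)) f g).
- exact: (ulin_assoc_l (B := B) hB bE bE bE bC ulin_comul ulin_rho).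
- exact: (ulin_assoc_r (B := B) bE bE bC bE ulin_comul ulin_lam).
- move=> d; rewrite /f /g /= comul1.
  elim/tensor_ind: (comul D d) => [p q|y z hy hz]; last by rewrite !lmD hy hz.
  by rewrite !tmapG // rho1 lam1 tassocE.
Qed.

Lemma ind_coassoc e :
  tassoc _ _ _ (tmap ind_comul id (ind_comul e)) = tmap id ind_comul (ind_comul e).
Proof.
pose f : {linear E -> E ⨂ (E ⨂ E)} := tassoc _ _ _ \o (tmap ind_comul id \o ind_comul).
pose g : {linear E -> E ⨂ (E ⨂ E)} := tmap id ind_comul \o ind_comul.
apply: (@ind_ext _ (dg aE (dg aE aE)) f g).
- exact: (ulin_assoc_l (B := B) hB bE bE bE bE ulin_comul ulin_comul).
- exact: (ulin_assoc_r (B := B) bE bE bE bE ulin_comul ulin_comul).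
- move=> d; rewrite /f /g /= comul1.
  have eR z : tmap id ind_comul (tmap i1 i1 z) = tmap i1 (tmap i1 i1) (tmap id (comul D) z).
    elim/tensor_ind: z => [p q|y z hy hz]; last by rewrite !lmD hy hz.
    rewrite (tmapE i1 i1) (tmapE_idl ind_comul) (tmapE_idl (comul D)) comul1.
    by rewrite (tmapE i1 (tmap i1 i1)).
  have eL z : tassoc _ _ _ (tmap ind_comul id (tmap i1 i1 z)) =
      tmap i1 (tmap i1 i1) (tassoc _ _ _ (tmap (comul D) id z)).
    elim/tensor_ind: z => [p q|y z hy hz]; last by rewrite !lmD hy hz.
    rewrite (tmapE i1 i1) (tmapE_idr ind_comul) (tmapE_idr (comul D)) comul1.
    elim/tensor_ind: (comul D p) => [r s|y z hy hz]; last by rewrite !(lmD, pureDl) hy hz.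
    by rewrite (tmapE i1 i1) !tassocE (tmapE i1 (tmap i1 i1)) (tmapE i1 i1).
  by rewrite eR eL Dcoassoc.
Qed.

Lemma ind_comul_counitl e : tmap ind_counit id (ind_comul e) = ind_lam e.
Proof.
have hb := @bilinear_scalel k D D (counit D).
pose f : {linear E -> C ⨂ E} := tmap ind_counit id \o ind_comul.
apply: (@ind_ext _ (dg aC aE) f ind_lam); last 1 first.
- move=> d; rewrite /f /= comul1 lam1 -[d in RHS]Dcounitl.
  elim/tensor_ind: (comul D d) => [p q|y z hy hz].
    by rewrite !tmapG // counit1 (tlift_pure _ _ hb) pureZl lmZ pureZr.
  by rewrite !lmD hy hz.
- apply: (ulin_comp (B := B)) ulin_comul _.
  exact: (ulin_tmap (B := B) (g := idfun) bE bE bC bE ulin_counit).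
- exact: ulin_lam.
Qed.

Lemma ind_comul_counitr e : tmap id ind_counit (ind_comul e) = ind_rho e.
Proof.
have hb := @bilinear_scaler k D D (counit D).
pose f : {linear E -> E ⨂ C} := tmap id ind_counit \o ind_comul.
apply: (@ind_ext _ (dg aE aC) f ind_rho); last 1 first.
- move=> d; rewrite /f /= comul1 rho1 -[d in RHS]Dcounitr.
  elim/tensor_ind: (comul D d) => [p q|y z hy hz].
    by rewrite !tmapG // counit1 (tlift_pure _ _ hb) pureZr lmZ pureZl.
  by rewrite !lmD hy hz pureDl.
- apply: (ulin_comp (B := B)) ulin_comul _.
  exact: (ulin_tmap (B := B) (f := idfun) bE bE bE bC _ ulin_counit).
- exact: ulin_rho.
Qed.

Lemma ind_counit_lam e : C_delta H (ind_counit e) = tmap id ind_counit (ind_lam e).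
Proof.
pose f : {linear E -> C ⨂ C} := C_delta H \o ind_counit.
pose g : {linear E -> C ⨂ C} := tmap id ind_counit \o ind_lam.
apply: (@ind_ext _ (dg aC aC) f g).
- exact: (ulin_comp (B := B)) ulin_counit ulin_Cdelta.
- apply: (ulin_comp (B := B)) ulin_lam _.
  exact: (ulin_tmap (B := B) (f := idfun) bC bE bC bC _ ulin_counit).
- by move=> d; rewrite /f /g /= lam1 tmapG // counit1 lmZ C_delta_one pureZr.
Qed.

Lemma ind_counit_rho e : C_delta H (ind_counit e) = tmap ind_counit id (ind_rho e).
Proof.
pose f : {linear E -> C ⨂ C} := C_delta H \o ind_counit.
pose g : {linear E -> C ⨂ C} := tmap ind_counit id \o ind_rho.
apply: (@ind_ext _ (dg aC aC) f g).
- exact: (ulin_comp (B := B)) ulin_counit ulin_Cdelta.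
- apply: (ulin_comp (B := B)) ulin_rho _.
  exact: (ulin_tmap (B := B) (g := idfun) bE bC bC bC ulin_counit).
- by move=> d; rewrite /f /g /= rho1 tmapG // counit1 lmZ C_delta_one pureZl.
Qed.


Theorem ind_is_coalg : is_coalg EC.
Proof.
split.
- split; try exact: (la_linear ind_lmod); try exact: (la_linearl ind_lmod).
  + exact: (la1 ind_lmod).
  + exact: (laM ind_lmod).
  + exact: ind_lam_coassoc.
  + exact: ind_lam_counit.
  + exact: ind_rho_coassoc.
  + exact: ind_rho_counit.
  + exact: ind_lam_rho.
  + exact: ulin_lam.
  + exact: ulin_rho.
- split.
  + exact: ulin_comul.
  + move=> e; exact: etrans (@blam_tensE k B EC EC (ind_comul e)) (ind_comul_lam e).
  + move=> e; exact: etrans (@brho_tensE k B EC EC (ind_comul e)) (ind_comul_rho e).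
- exact: ind_comul_cotensor.
- split.
  + exact: ulin_counit.
  + exact: ind_counit_lam.
  + exact: ind_counit_rho.
- exact: ind_coassoc.
- exact: ind_comul_counitl.
- exact: ind_comul_counitr.
Qed.

End Induced.

(** * Transport of coalgebra structures *)

Section Transport.
Variables (k : fieldType) (B : modcoalg k) (E D : coalg B) (F : {linear E -> D}).
Hypothesis bC : bilinear_op (mc_act B).
Hypothesis hE : is_coalg E.
Hypothesis F_bij : bijective F.
Hypothesis F_mor : is_bimod_mor F.
Hypothesis F_comul : forall e, comul D (F e) = tmap F F (comul E e).
Hypothesis F_counit : forall e, counit D (F e) = counit E e.

Let F_inj : injective F := bij_inj F_bij.
Let surj (d : D) : exists e, F e = d.
Proof. by case: F_bij => G _ GK; exists (G d). Qed.
Let oE := coalg_bimod hE.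
Let bE : bilinear_op (@bact k B E).
Proof. by split; [apply: bact_linear|apply: bact_linearl]. Qed.
Let bDD : bilinear_op (@bact k B D).
Proof.
split=> [x|m] a u v.
  have [u' <-] := surj u; have [v' <-] := surj v.
  by rewrite -lmP -!(mor_act F_mor) (bact_linear oE) lmP.
by have [e <-] := surj m; rewrite -!(mor_act F_mor) (bact_linearl oE) lmP.
Qed.
Let lam e : blam D (F e) = tmap id F (blam E e) := mor_lam F_mor e.
Let rho e : brho D (F e) = tmap F id (brho E e) := mor_rho F_mor e.

Lemma transport_bimod : is_bimod D.
Proof.
split; try exact: bDD.1; try exact: bDD.2.
- by move=> m; have [e <-] := surj m; rewrite -(mor_act F_mor) (bact1 oE).
- by move=> x y m; have [e <-] := surj m; rewrite -!(mor_act F_mor) (bactM oE).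
- move=> m; have [e <-] := surj m; rewrite lam.
  rewrite (@tmap_sq _ _ _ _ _ _ _ _ _ id (mc_comul B) (mc_comul B) (tmap id id) F id id F) //;
    last by move=> c; rewrite tmap_id.
  rewrite (@tassoc_nat _ _ _ _ _ _ _ idfun idfun F) (blam_coassoc oE).
  by apply: tmap_sq.
- move=> m; have [e <-] := surj m; rewrite lam -[in RHS](blam_counit oE e).
  have eb (N : lmodType k) := @bilinear_scalel k B N (mc_counit B).
  elim/tensor_ind: (blam E e) => [b n|y z hy hz]; last by rewrite !lmD hy hz.
  by rewrite tmapG // !(tlift_pure _ _ (eb _)) lmZ.
- move=> m; have [e <-] := surj m; rewrite rho.
  rewrite (@tmap_sq _ _ _ _ _ _ _ _ _ F (brho D) (brho E) (tmap F id) id id id id) //.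
  rewrite (@tassoc_nat _ _ _ _ _ _ _ F idfun idfun) (brho_coassoc oE).
  by apply: tmap_sq => // c; rewrite tmap_id.
- move=> m; have [e <-] := surj m; rewrite rho -[in RHS](brho_counit oE e).
  have eb (N : lmodType k) := @bilinear_scaler k N B (mc_counit B).
  elim/tensor_ind: (brho E e) => [b n|y z hy hz]; last by rewrite !lmD hy hz.
  by rewrite tmapG // !(tlift_pure _ _ (eb _)) lmZ.
- move=> m; have [e <-] := surj m; rewrite rho lam.
  rewrite (@tmap_sq _ _ _ _ _ _ _ _ _ F (blam D) (blam E) (tmap id F) id id id id) //.
  rewrite (@tassoc_nat _ _ _ _ _ _ _ idfun F idfun) (blam_brho oE).
  by apply: tmap_sq.
- move=> x m; have [e <-] := surj m; rewrite -(mor_act F_mor) !lam (blam_act oE).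
  by apply: (@diag_tmap _ _ _ _ _ _ _ _ _ _ idfun F) => // y e'; apply: (mor_act F_mor).
- move=> x m; have [e <-] := surj m; rewrite -(mor_act F_mor) !rho (brho_act oE).
  by apply: (@diag_tmap _ _ _ _ _ _ _ _ _ _ F idfun) => // y e'; apply: (mor_act F_mor).
Qed.

Lemma transport_coalg : is_coalg D.
Proof.
split.
- exact: transport_bimod.
- split.
  + move=> x m; have [e <-] := surj m.
    rewrite -(mor_act F_mor) !F_comul (mor_act (comul_mor hE)).
    by apply: diag_tmap => // y e'; apply: (mor_act F_mor).
  + move=> m; have [e <-] := surj m; rewrite lam !F_comul blam_tensE.
    rewrite (@tmap_sq _ _ _ _ _ _ _ _ _ F (blam D) (blam E) (tmap id F) F id id F) //.
    rewrite (@tassoc_nat _ _ _ _ _ _ _ idfun F F).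
    have := mor_lam (comul_mor hE) e; rewrite blam_tensE => ->.
    by apply: tmap_sq => // e'; rewrite F_comul.
  + move=> m; have [e <-] := surj m; rewrite rho !F_comul brho_tensE.
    rewrite (@tmap_sq _ _ _ _ _ _ _ _ _ F id id F F (brho D) (brho E) (tmap F id)) //.
    have nat z : tassocV D D B (tmap F (tmap F id) z) = tmap (tmap F F) id (tassocV E E B z).
      apply: (can_inj (@tassocK _ _ _ _)); rewrite (@tassoc_nat _ _ _ _ _ _ _ F F idfun).
      by rewrite (tassocVK _ : tassoc _ _ _ (tassocV E E B z) = z); apply: tassocVK.
    rewrite nat; have := mor_rho (comul_mor hE) e; rewrite brho_tensE => ->.
    by apply: tmap_sq => // e'; rewrite F_comul.
- move=> m; have [e <-] := surj m; rewrite F_comul /cotensor /mkset.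
  rewrite (@tmap_sq _ _ _ _ _ _ _ _ _ F (brho D) (brho E) (tmap F id) F id id F) //.
  rewrite (@tassoc_nat _ _ _ _ _ _ _ F idfun F) (comul_cotensor hE e).
  by apply: tmap_sq.
- split.
  + move=> x m; have [e <-] := surj m.
    by rewrite -(mor_act F_mor) !F_counit (mor_act (counit_mor hE)).
  + move=> m; have [e <-] := surj m; rewrite lam F_counit (mor_lam (counit_mor hE)).
    by apply/esym/tmap_tri.
  + move=> m; have [e <-] := surj m; rewrite rho F_counit (mor_rho (counit_mor hE)).
    by apply/esym/tmap_tri.
- move=> m; have [e <-] := surj m; rewrite F_comul.
  rewrite (@tmap_sq _ _ _ _ _ _ _ _ _ F (comul D) (comul E) (tmap F F) F id id F) //.
  rewrite (@tassoc_nat _ _ _ _ _ _ _ F F F) (comul_coassoc hE).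
  by apply: tmap_sq.
- move=> m; have [e <-] := surj m; rewrite F_comul lam -(comul_counitl hE).
  by apply: tmap_sq.
- move=> m; have [e <-] := surj m; rewrite F_comul rho -(comul_counitr hE).
  by apply: tmap_sq.
Qed.

(** A bijection commuting with all structure maps carries the axioms over, and
    its inverse is an isomorphism. *)
Theorem transport_isomorphic : coalg_isomorphic D E.
Proof.
split=> //; first exact: transport_coalg.
case: (F_bij) => G FG GF.
have lG : linear G by move=> a u v; apply: F_inj; rewrite lmP !GF.
exists (mklin lG); split.
- by exists F.
- split=> [x m|m|m] /=.
  + by apply: F_inj; rewrite (mor_act F_mor) !GF.
  + apply: (tmap_inj_r F_inj); rewrite -lam GF.
    by rewrite (@tmap_tri _ _ _ _ _ _ _ id id id G F id) // ?tmap_id.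
  + apply: (tmap_inj_l F_inj); rewrite -rho GF.
    by rewrite (@tmap_tri _ _ _ _ _ _ _ G F id id id id) // ?tmap_id.
- move=> d /=; apply: (tmap_inj F_inj F_inj); rewrite -F_comul GF.
  by rewrite (@tmap_tri _ _ _ _ _ _ _ G F id G F id) // ?tmap_id.
- by move=> d /=; rewrite -F_counit GF.
Qed.

End Transport.

(** * From coinvariant relations to the coalgebra isomorphism *)

Section Quadratic.
Variables (k : fieldType) (U : hopfAlg k) (H : subBialg U).
Local Notation HT := (subalg (sb_set H)).
Local Notation C := (quot_coalg H).
Local Notation B := (UC_modcoalg H).
Local Notation HB := (Hk_modcoalg H).
Local Notation Delta := (hdelta U).
Local Notation cl := (cls H).
Let hB : is_mc B := UC_mc H.
Let hC : is_left (unit_bimod B) := UC_unit_left H.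
Let bC : bilinear_op (mc_act B) := left_bil hC.

Definition H_incl : {linear HT -> U} := val.

Lemma H_incl_delta (h : HT) : Delta (val h) = tmap H_incl H_incl (sb_delta H h).
Proof. by rewrite sb_deltaE. Qed.

Lemma C_act_one (h : HT) : C_act H (val h) (cl 1) = (heps U (val h) : k) *: cl 1.
Proof. by rewrite C_actE mulr1 -[val h]mul1r cls_mulH mul1r. Qed.

Lemma C_eps_one : C_eps H (cl 1) = (1 : k^o).
Proof. by rewrite C_epsE heps1. Qed.

Lemma C_counitr (c : C) : tlift (fun a b => (C_eps H b : k) *: a) (C_delta H c) = c.
Proof.
have [x <-] := cls_surj c.
have eb := @bilinear_scaler k C C (C_eps H).
rewrite C_deltaE sws_lin -[RHS](h_counitr (G := cl)) //.
by apply: eq_sws => a b; rewrite (tlift_pure _ _ eb) C_epsE.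
Qed.

Lemma UC_unit_rho : rho_equivariant (unit_bimod B).
Proof. by move=> x c; apply: (left_act hC). Qed.

Hypothesis flat : rfaithfully_flat (@U_ract k U H).
Variables (T : bimod HB) (W : bimod B) (j : {linear T -> W}).
Variables (RT : set (T ⨂ T)) (RW : set (W ⨂ W)).
Hypothesis hT : is_lmodule (@bact k HB T).
Hypothesis lamT : forall t : T, blam T t = (1 : k^o) ⊗ t.
Hypothesis rhoT : forall t : T, brho T t = t ⊗ (1 : k^o).
Hypothesis hW : is_left W.
Hypothesis rW : rho_equivariant W.
Hypothesis cW : lam_rho_commute W.
Hypothesis j_inj : injective j.
Hypothesis j_act : forall (h : HT) t, j (@bact k HB T h t) = @bact k B W (val h) (j t).
Hypothesis j_coinv : forall t, blam W (j t) = cl 1 ⊗ j t.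
Hypothesis j_rho : forall t, brho W (j t) = j t ⊗ cl 1.
Hypothesis j_onto : forall w : W, blam W w = cl 1 ⊗ w -> exists t, j t = w.
Hypothesis sRT : is_subspace RT.
Hypothesis sRW : left_stable (RW : set (tens_bimod W W)).
Hypothesis RWcot : RW `<=` cotensor W W.
Hypothesis RTW : forall r, RT r <-> RW (tmap j j r).

Local Notation TT := (tspace T).
Local Notation WS := (tspace W).
Local Notation Q := (quad_space RT).
Local Notation N := (coquad_space RW).
Local Notation D := (quad_coalg RT).
Local Notation WC := (coquad_coalg RW).
Local Notation J := (jsp (B := B) (cl 1) j).
Local Notation aW := (@bact k B (tspace_bimod W)).
Local Notation aT := (@bact k HB (tspace_bimod T)).

Let J_inj : injective J := @jsp_injective k U H B (cl 1) C_eps_one T W j j_inj.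

Lemma J_act (h : HT) z : J (aT h z) = aW (val h) (J z).
Proof. exact: (@jsp_act k U H B hB hC _ H_incl H_incl_delta C_act_one _ _ _ hT hW j_act). Qed.

Lemma J_coinv z : blam (tspace_bimod W) (J z) = cl 1 ⊗ J z.
Proof. exact: (@jsp_coinv k U H B (cl 1) (C_delta_one H) _ _ _ j_coinv). Qed.

Lemma J_rho z : brho (tspace_bimod W) (J z) = J z ⊗ cl 1.
Proof. exact: (@jsp_rho k U H B (cl 1) (C_delta_one H) _ _ _ j_rho). Qed.

Lemma J_quad z : Q z <-> N (J z).
Proof.
exact: (@quad_coquad k U H B hB hC (cl 1) _ _ j RT RW hW rW cW j_inj j_coinv j_rho j_onto sRW RWcot RTW).
Qed.

Lemma J_onto z : N z -> blam (tspace_bimod W) z = cl 1 ⊗ z -> exists2 q, Q q & J q = z.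
Proof.
exact: (@coinv_coquad k U H B hB hC (cl 1) C_eps_one C_counitr T W j RT RW hW rW cW j_inj j_coinv j_rho j_onto sRW RWcot RTW).
Qed.

Lemma J_deconc z : deconc W (J z) = tmap J J (deconc T z).
Proof. exact: (@jsp_deconc k U H B (cl 1) (C_delta_one H) _ _ j lamT rhoT j_coinv j_rho). Qed.

Lemma J_counit z : deconc_counit W (J z) = (hcounit T z : k) *: cl 1.
Proof. exact: jsp_counit. Qed.

Let sQ : is_subspace Q := subspace_quad_space sRT.
Let stN : left_stable (N : set (tspace_bimod W)) := coquad_stable hB hC hW rW cW sRW.
Let hWS : is_left (tspace_bimod W) := tspace_left hB hC hW.
Let bWS : bilinear_op aW := left_bil hWS.

Lemma quad_act_stable (h : HT) z : Q z -> Q (aT h z).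
Proof.
move=> /J_quad hz; apply/J_quad; rewrite J_act.
by case: stN => _ Na _; apply: Na.
Qed.

Definition quad_incl : {linear D -> TT} := val : subsp Q -> TT.
Local Notation iD := quad_incl.

Lemma quad_incl_inj : injective iD. Proof. exact: val_inj. Qed.

Lemma quad_inclP (d : D) : Q (iD d). Proof. exact: (@subspP _ _ Q d sQ). Qed.

Lemma quad_incl_act (h : HT) (d : D) : iD (@bact k HB D h d) = aT h (iD d).
Proof.
have lb : linear (fun d => aT h (iD d)) by move=> a u v; rewrite lmP; apply: lmP.
apply: (@linfacP _ _ _ _ iD (mklin lb) quad_incl_inj) => d'.
by exists (insubsp (quad_act_stable h (quad_inclP d'))).
Qed.

Lemma quad_incl_comul (d : D) : tmap iD iD (comul D d) = deconc T (iD d).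
Proof.
apply: (@linfacP _ _ _ _ (tmap iD iD) (deconc T \o iD)) => [|d'].
  by apply: tmap_inj; apply: quad_incl_inj.
have Qim : Q `<=` iD @` setT by move=> q hq; exists (insubsp hq).
have h : tsub (iD @` setT) (iD @` setT) (deconc T (iD d')).
  exact: (tsub_mono Qim Qim (comul_quad lamT rhoT sRT (quad_inclP d'))). 
by have [y _ e] := im_tmap h; exists y.
Qed.

(** The action on the quadratic coalgebra and its compatibility with the
    comultiplication are read off in the words in [W], where [act_deconc] holds. *)
Definition quad_emb : {linear D -> WS} := J \o iD.
Local Notation th := quad_emb.

Lemma quad_emb_inj : injective th.
Proof. by move=> x y /J_inj /quad_incl_inj. Qed.

Lemma quad_emb_act (h : HT) (d : D) : th (@bact k HB D h d) = aW (val h) (th d).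
Proof. by apply: etrans (congr1 J (quad_incl_act h d)) _; apply: J_act. Qed.

Lemma quad_lmod : is_lmodule (@bact k HB D).
Proof.
have [lW rW'] := bWS; have hl := left_lmod hWS.
split=> [h|d|d|h h' d].
- move=> a u v; apply: quad_emb_inj.
  by rewrite lmP !quad_emb_act lmP (lW (val h)).
- move=> a h h'; apply: quad_emb_inj.
  by rewrite lmP !quad_emb_act linearP (rW' (th d)).
- by apply: quad_emb_inj; rewrite quad_emb_act rmorph1 (la1 hl).
- by apply: quad_emb_inj; rewrite !quad_emb_act rmorphM (laM hl).
Qed.

Lemma quad_emb_comul (d : D) : tmap th th (comul D d) = deconc W (th d).
Proof.
rewrite /quad_emb /= J_deconc -quad_incl_comul.
by rewrite (@tmap_tri _ _ _ _ _ _ _ iD J th iD J th).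
Qed.

Lemma quad_emb_diag (h : HT) z :
  tmap th th (@diag_act k HB D D (@bact k HB D) (@bact k HB D) h z) =
  diag_act (B := B) aW aW (val h) (tmap th th z).
Proof.
have bD := lmod_bilinear quad_lmod; have [lW rW'] := bWS.
elim/tensor_ind: z => [d d'|y z hy hz]; last first.
  by rewrite !lmD hy hz.
rewrite (@diag_actE k HB _ _ _ _ h d d' bD bD) (tmapE th th) sws_lin.
rewrite (diag_actE (B := B) _ _ _ bWS bWS).
rewrite [RHS](sws_deltaH (F := fun a b => aW a (th d) ⊗ aW b (th d'))).
  by apply: eq_sws => a b; rewrite (tmapE th th) !quad_emb_act.
by split=> ? s x y; rewrite ?rW' ?pure_linearl ?pure_linearr.
Qed.

Lemma quad_comul_act (h : HT) (d : D) :
  comul D (@bact k HB D h d) =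
  @diag_act k HB D D (@bact k HB D) (@bact k HB D) h (comul D d).
Proof.
apply: (tmap_inj quad_emb_inj quad_emb_inj).
rewrite quad_emb_diag !quad_emb_comul quad_emb_act.
exact: act_deconc.
Qed.

Lemma quad_emb_counit (d : D) : deconc_counit W (th d) = (counit D d : k) *: cl 1.
Proof. exact: J_counit. Qed.

Lemma quad_counit_act (h : HT) (d : D) :
  counit D (@bact k HB D h d) = (heps U (val h) * (counit D d : k^o) : k^o).
Proof.
have := quad_emb_counit (@bact k HB D h d).
rewrite quad_emb_act act_deconc_counit // quad_emb_counit.
rewrite [LHS](lmZ (C_act H (val h))) C_act_one scalerA mulrC => e.
have := congr1 (C_eps H) e; rewrite !lmZ C_eps_one /GRing.scale /= !mulr1.
by move=> <-.
Qed.

Lemma quad_coassoc (d : D) :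
  tassoc _ _ _ (tmap (comul D) id (comul D d)) = tmap id (comul D) (comul D d).
Proof.
apply: (@tmap_inj _ _ _ _ _ iD (tmap iD iD)).
- exact: quad_incl_inj.
- by apply: tmap_inj; apply: quad_incl_inj.
rewrite -tassoc_nat.
have -> : tmap (tmap iD iD) iD (tmap (comul D) id (comul D d)) =
    tmap (deconc T) id (tmap iD iD (comul D d)).
  by apply: tmap_sq => // v; rewrite quad_incl_comul.
have -> : tmap iD (tmap iD iD) (tmap id (comul D) (comul D d)) =
    tmap id (deconc T) (tmap iD iD (comul D d)).
  by apply: tmap_sq => // v; rewrite quad_incl_comul.
by rewrite quad_incl_comul comul_coassocT.
Qed.

Lemma quad_counitl (d : D) : tlift (fun a b : D => (counit D a : k) *: b) (comul D d) = d.
Proof.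
have hb := @bilinear_scalel k D D (counit D).
have hbT := @bilinear_scalel k TT TT (hcounit T).
apply: quad_incl_inj; rewrite -[RHS](comul_counitlT lamT rhoT) -quad_incl_comul.
elim/tensor_ind: (comul D d) => [p q|y z hy hz]; last by rewrite !lmD hy hz.
by rewrite (tmapE iD iD) (tlift_pure _ _ hb) (tlift_pure _ _ hbT) lmZ.
Qed.

Lemma quad_counitr (d : D) : tlift (fun a b : D => (counit D b : k) *: a) (comul D d) = d.
Proof.
have hb := @bilinear_scaler k D D (counit D).
have hbT := @bilinear_scaler k TT TT (hcounit T).
apply: quad_incl_inj; rewrite -[RHS](comul_counitrT lamT rhoT) -quad_incl_comul.
elim/tensor_ind: (comul D d) => [p q|y z hy hz]; last by rewrite !lmD hy hz.
by rewrite (tmapE iD iD) (tlift_pure _ _ hb) (tlift_pure _ _ hbT) lmZ.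
Qed.

Local Notation EC := (ind_coalg D).
Local Notation E := (ind_car D).
Local Notation rp := (rpure (@U_ract k U H) (@bact k HB D)).

Theorem ind_quad_is_coalg : is_coalg EC.
Proof.
exact: (ind_is_coalg quad_lmod quad_comul_act quad_counit_act quad_coassoc quad_counitl quad_counitr).
Qed.

Local Notation M := (cobj WC).

Let sN : is_subspace N. Proof. by case: stN. Qed.

Let subM := let: And3 h1 h2 h3 := stN in sub_bimod_left bC hWS h1 h2 h3.

Lemma M_left : is_left M. Proof. by case: subM. Qed.

Definition coquad_incl : {linear M -> WS} := val : subsp N -> WS.
Local Notation iM := coquad_incl.
Lemma coquad_incl_inj : injective iM. Proof. exact: val_inj. Qed.

Lemma coquad_incl_act x (m : M) : iM (@bact k B M x m) = aW x (iM m).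
Proof. by have [_ h _] := subM; apply: h. Qed.

Lemma coquad_incl_lam (m : M) : tmap id iM (blam M m) = blam (tspace_bimod W) (iM m).
Proof. by case: subM. Qed.

Lemma quad_emb_in (d : D) : N (th d).
Proof. by apply/J_quad; apply: quad_inclP. Qed.

Lemma quad_lift_linear : linear (fun d : D => insubsp (quad_emb_in d) : M).
Proof. by move=> a u v; apply: val_inj; rewrite /= -lmP. Qed.

Definition quad_lift : {linear D -> M} := mklin quad_lift_linear.
Local Notation jM := quad_lift.

Lemma quad_liftE d : iM (jM d) = th d. Proof. by []. Qed.

Lemma quad_lift_inj : injective jM.
Proof. by move=> x y e; apply: quad_emb_inj; rewrite -!quad_liftE e. Qed.

Lemma quad_lift_act (h : HT) d : jM (@bact k HB D h d) = @bact k B M (val h) (jM d).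
Proof. by apply: coquad_incl_inj; rewrite coquad_incl_act !quad_liftE quad_emb_act. Qed.

Lemma quad_lift_coinv d : blam M (jM d) = cl 1 ⊗ jM d.
Proof.
apply: (tmap_inj_r coquad_incl_inj); rewrite coquad_incl_lam (tmapE_idl iM) quad_liftE.
exact: J_coinv.
Qed.

Lemma quad_lift_onto (m : M) : blam M m = cl 1 ⊗ m -> exists d, jM d = m.
Proof.
move=> e; have := coquad_incl_lam m; rewrite e (tmapE_idl iM) => /esym e'.
have [q hq eq] := J_onto (@subspP _ _ N m sN) e'.
by exists (insubsp hq); apply: coquad_incl_inj; rewrite quad_liftE /quad_emb /=.
Qed.

(** The isomorphism [x ⊗_H d |-> x d] onto the relations in [W], by descent from
    their coinvariants. *)
Definition coalg_map : {linear E -> M} := induced_map (@bact k HB D) jM.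
Local Notation F := coalg_map.

Lemma coalg_mapE x d : F (rp x d) = @bact k B M x (jM d).
Proof. exact: (induced_mapE M_left quad_lift_act). Qed.

Lemma coalg_map_bij : bijective F.
Proof.
have inj : injective F.
  exact: (induced_map_inj flat M_left quad_lmod quad_lift_inj quad_lift_act quad_lift_coinv).
have surj m : exists e, F e = m.
  exact: (induced_map_surj flat M_left quad_lmod quad_lift_act quad_lift_coinv quad_lift_onto).
exists (fun m => projT1 (cid (surj m))) => e; last exact: projT2 (cid (surj e)).
by apply: inj; apply: projT2 (cid (surj (F e))).
Qed.

Definition coalg_map_val : {linear E -> WS} := iM \o F.
Local Notation Fv := coalg_map_val.

Lemma coalg_map_valE x d : Fv (rp x d) = aW x (th d).
Proof.
by apply: etrans (congr1 iM (coalg_mapE x d)) _; apply: coquad_incl_act.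
Qed.

Lemma coalg_map_val_act y e : Fv (ind_act D y e) = aW y (Fv e).
Proof.
have [lW _] := bWS.
elim/rtensor_ind: e => [x d|e e' he he']; last by rewrite !lmD he he' (linear_funD _ _ (lW y)).
rewrite ind_actE !coalg_map_valE.
exact: (laM (left_lmod hWS)).
Qed.

Lemma coalg_map_val_lam e : blam (tspace_bimod W) (Fv e) = tmap id Fv (ind_lam D e).
Proof.
elim/rtensor_ind: e => [x d|e e' he he']; last by rewrite !lmD he he'.
rewrite ind_lamE sws_lin coalg_map_valE.
rewrite (blam_coinv hWS); last exact: J_coinv.
by apply: eq_sws => a b; rewrite (tmapE_idl Fv) coalg_map_valE.
Qed.

Lemma coalg_map_val_rho e : brho (tspace_bimod W) (Fv e) = tmap Fv id (ind_rho D e).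
Proof.
elim/rtensor_ind: e => [x d|e e' he he']; last by rewrite !lmD he he'.
rewrite ind_rhoE sws_lin coalg_map_valE.
rewrite (tspace_rho_equivariant hB hC hW rW UC_unit_rho) J_rho.
rewrite (diag_actE (B := B) _ _ _ bWS bC).
apply: eq_sws => a b; rewrite (tmapE_idr Fv) coalg_map_valE; congr (_ ⊗ _).
by apply: etrans (C_actE H _ _) _; rewrite mulr1.
Qed.

Lemma coalg_map_val_comul e : deconc W (Fv e) = tmap Fv Fv (ind_comul D e).
Proof.
elim/rtensor_ind: e => [x d|e e' he he']; last by rewrite !lmD he he'.
rewrite (ind_comulE quad_lmod quad_comul_act) sws_lin coalg_map_valE.
rewrite (act_deconc hB hC hW rW) -quad_emb_comul.
transitivity (sws (Delta x) (fun a b => sws (comul D d) (fun p q => aW a (th p) ⊗ aW b (th q)))).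
  rewrite {1}(swsE (comul D d)) !sws_lin sws_exch; apply: eq_sws => p q.
  by rewrite (tmapE th th) (diag_actE (B := B) _ _ _ bWS bWS).
apply: eq_sws => a b; rewrite sws_lin; apply: eq_sws => p q.
by rewrite (tmapE Fv Fv) !coalg_map_valE.
Qed.

Lemma coalg_map_val_counit e : deconc_counit W (Fv e) = ind_counit D e.
Proof.
elim/rtensor_ind: e => [x d|e e' he he']; last by rewrite !lmD he he'.
rewrite (ind_counitE quad_counit_act) coalg_map_valE act_deconc_counit // quad_emb_counit.
by rewrite [LHS](lmZ (C_act H x)) C_actE mulr1.
Qed.

Lemma coalg_map_surj (m : M) : exists e, F e = m.
Proof. by case: coalg_map_bij => G _ GF; exists (G m). Qed.

(** That the relations in [W] are stable under the right coaction, and below under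
    the comultiplication, follows from surjectivity of [coalg_map]: its source is a
    coalgebra, and its structure maps supply preimages. *)
Lemma coquad_incl_rho (m : M) : tmap iM id (brho M m) = brho (tspace_bimod W) (iM m).
Proof.
apply: (@linfacP _ _ _ _ (tmap iM id) (brho (tspace_bimod W) \o iM)) => [|m'].
  exact: (tmap_inj_l coquad_incl_inj).
have [e <-] := coalg_map_surj m'; exists (tmap F id (ind_rho D e)).
rewrite [RHS](coalg_map_val_rho e).
by rewrite (@tmap_tri _ _ _ _ _ _ _ F iM Fv id id id).
Qed.

Lemma coquad_incl_comul (m : M) : tmap iM iM (comul WC m) = deconc W (iM m).
Proof.
apply: (@linfacP _ _ _ _ (tmap iM iM) (deconc W \o iM)) => [|m'].
  exact: (tmap_inj coquad_incl_inj coquad_incl_inj).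
have [e <-] := coalg_map_surj m'; exists (tmap F F (ind_comul D e)).
rewrite [RHS](coalg_map_val_comul e).
by rewrite (@tmap_tri _ _ _ _ _ _ _ F iM Fv F iM Fv).
Qed.

Lemma coalg_map_act x e : F (ind_act D x e) = @bact k B M x (F e).
Proof. by apply: coquad_incl_inj; rewrite coquad_incl_act; apply: coalg_map_val_act. Qed.

Lemma coalg_map_lam e : blam M (F e) = tmap id F (ind_lam D e).
Proof.
apply: (tmap_inj_r coquad_incl_inj); apply: etrans (coquad_incl_lam (F e)) _.
by rewrite (@tmap_tri _ _ _ _ _ _ _ id id id F iM Fv); first exact: coalg_map_val_lam.
Qed.

Lemma coalg_map_rho e : brho M (F e) = tmap F id (ind_rho D e).
Proof.
apply: (tmap_inj_l coquad_incl_inj); apply: etrans (coquad_incl_rho (F e)) _.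
by rewrite (@tmap_tri _ _ _ _ _ _ _ F iM Fv id id id); first exact: coalg_map_val_rho.
Qed.

Lemma coalg_map_comul e : comul WC (F e) = tmap F F (ind_comul D e).
Proof.
apply: (tmap_inj coquad_incl_inj coquad_incl_inj).
apply: etrans (coquad_incl_comul (F e)) _.
by rewrite (@tmap_tri _ _ _ _ _ _ _ F iM Fv F iM Fv); first exact: coalg_map_val_comul.
Qed.

Theorem coquad_isomorphic : coalg_isomorphic WC EC.
Proof.
apply: (@transport_isomorphic k B EC WC F bC ind_quad_is_coalg coalg_map_bij).
- by split; [exact: coalg_map_act|exact: coalg_map_lam|exact: coalg_map_rho].
- exact: coalg_map_comul.
- exact: coalg_map_val_counit.
Qed.

End Quadratic.

(** * Coinvariants of the calculus *)

Section Tangent.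
Variables (k : fieldType) (U : hopfAlg k) (H : subBialg U) (W : focc H).
Local Notation HT := (subalg (sb_set H)).
Local Notation C := (quot_coalg H).
Local Notation B := (UC_modcoalg H).
Local Notation Delta := (hdelta U).
Local Notation eps := (heps U).
Local Notation cl := (cls H).
Local Notation delta := (fo_delta W).
Local Notation aW := (@bact k B W).
Let hB : is_mc B := UC_mc H.
Let hC : is_left (unit_bimod B) := UC_unit_left H.
Let bC : bilinear_op (mc_act B) := left_bil hC.

Lemma fo_left : is_left W. Proof. exact: is_bimod_left (fo_is_bimod W). Qed.
Let hW := fo_left.
Let bW : bilinear_op aW := left_bil hW.
Lemma fo_rho_equivariant : rho_equivariant W. Proof. exact: brho_act (fo_is_bimod W). Qed.
Lemma fo_lam_rho : lam_rho_commute W. Proof. exact: blam_brho (fo_is_bimod W). Qed.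

(** Applying [eps ⊗ eps] to the coderivation identity gives
    [eps(delta w) = eps(delta w) + eps(delta w)]. *)
Lemma fo_eps w : C_eps H (delta w) = 0 :> k^o.
Proof.
pose f : {linear C ⨂ C -> k^o} := tlift (fun a b => (C_eps H a : k) *: (C_eps H b : k^o)).
have b2 : bilinear_op (fun a b : C => (C_eps H a : k) *: (C_eps H b : k^o)).
  by split=> ? s u v; rewrite ?lmP /= ?scalerDl ?scalerA // scalerDr !scalerA mulrC.
have eb (N : lmodType k) := @bilinear_scalel k C N (C_eps H).
have er (N : lmodType k) := @bilinear_scaler k N C (C_eps H).
have fl (N : lmodType k) (g : {linear N -> C}) z :
    f (tmap id g z) = C_eps H (g (tlift (fun b n => (C_eps H b : k) *: n) z)).
  elim/tensor_ind: z => [b n|y z hy hz]; last by rewrite !lmD hy hz.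
  rewrite tmapE_idl [LHS](tlift_pure _ _ b2) (tlift_pure _ _ (eb N)).
  by rewrite (lmZ g) (lmZ (C_eps H)).
have fr (N : lmodType k) (g : {linear N -> C}) z :
    f (tmap g id z) = C_eps H (g (tlift (fun n b => (C_eps H b : k) *: n) z)).
  elim/tensor_ind: z => [n b|y z hy hz]; last by rewrite !lmD hy hz.
  rewrite tmapE_idr [LHS](tlift_pure _ _ b2) (tlift_pure _ _ (er N)) (lmZ g) (lmZ (C_eps H)).
  exact: mulrC.
have e0 : f (C_delta H (delta w)) = C_eps H (delta w).
  apply: etrans (congr1 f (esym (tmap_id (C_delta H (delta w))))) _.
  apply: etrans (fl C idfun (C_delta H (delta w))) _.
  exact: (congr1 (C_eps H) (left_counit hC (delta w))).
have e1 : f (C_delta H (delta w)) = C_eps H (delta w) + C_eps H (delta w) :> k^o.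
  apply: etrans (congr1 f (fo_coderivation w)) _; apply: etrans (lmD f _ _) _.
  congr (_ + _).
    exact: etrans (fr W delta _) (congr1 (C_eps H \o delta) (brho_counit (fo_is_bimod W) w)).
  exact: etrans (fl W delta _) (congr1 (C_eps H \o delta) (left_counit hW w)).
by apply: (addIr (C_eps H (delta w))); rewrite add0r -e1.
Qed.

Local Notation V := (@coinv k B (cl 1) W).
Local Notation coinv_defect := (@coinv_diff k B (cl 1) W).

Lemma coinv_act (h : HT) w : V w -> V (aW (val h) w).
Proof.
by move=> hw; rewrite /coinv /mkset (left_act hW) hw act_cls1.
Qed.

(** On coinvariants the injective map [w |-> w_(-1) ⊗ delta(w_(0))] of the
    calculus is [w |-> [1] ⊗ delta w]. *)
Lemma delta_coinv_inj v w : V v -> V w -> delta v = delta w -> v = w.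
Proof.
move=> hv hw e; apply: (fo_injective (f := W)) => /=.
by rewrite hv hw !tmapE_idl e.
Qed.

Lemma tangentE : tangent W = delta @` V.
Proof.
apply/seteqP; split=> [c [w [hw ->]]|_ [w hw <-]]; first by exists w.
by exists w.
Qed.

Lemma subspace_tangent : is_subspace (tangent W).
Proof. by rewrite tangentE; apply: subspace_im (@subspace_coinv k B (cl 1) W). Qed.

Definition coinv_delta : {linear subsp V -> C} := delta \o (val : subsp V -> W).

Lemma coinv_delta_inj : injective coinv_delta.
Proof.
move=> v w e; apply: val_inj; apply: delta_coinv_inj e; exact: subspP (@subspace_coinv k B (cl 1) W).
Qed.

Definition tval : {linear T_car W -> C} := val.

(** The inverse of [delta] on coinvariants. *)
Definition tangent_lift : {linear T_car W -> W} :=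
  (val : subsp V -> W) \o linfac coinv_delta tval.
Local Notation j := tangent_lift.

Lemma delta_lift t : delta (j t) = val t.
Proof.
apply: (linfacP (f := tval) coinv_delta_inj) => t'.
have [w [hw e]] := @subspP _ _ (tangent W) t' subspace_tangent.
by exists (insubsp (G := V) hw).
Qed.

Lemma lift_coinv t : blam W (j t) = cl 1 ⊗ j t.
Proof. exact: (@subspP _ _ V _ (@subspace_coinv k B (cl 1) W)). Qed.

Lemma lift_inj : injective j.
Proof. by move=> s t e; apply: val_inj; rewrite -!delta_lift e. Qed.

Lemma lift_onto w : blam W w = cl 1 ⊗ w -> exists t, j t = w.
Proof.
move=> hw; have ht : tangent W (delta w) by exists w.
exists (insubsp ht); apply: delta_coinv_inj => //; first exact: lift_coinv.
exact: delta_lift.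
Qed.

Lemma T_actE (h : HT) (t : T_car W) : val (T_act W h t) = C_act H (val h) (val t).
Proof.
apply: (@linfacP _ _ _ _ tval (C_act H (val h) \o tval)) => [|t']; first exact: val_inj.
have ht : tangent W (delta (aW (val h) (j t'))).
  by exists (aW (val h) (j t')); split=> //; apply: coinv_act; apply: lift_coinv.
exists (insubsp ht); rewrite /tval /= fo_deltaM.
by congr (C_act H _ _); apply: delta_lift.
Qed.

Lemma lift_act (h : HT) t : j (T_act W h t) = aW (val h) (j t).
Proof.
apply: delta_coinv_inj; first exact: lift_coinv.
  by apply: coinv_act; apply: lift_coinv.
by rewrite fo_deltaM !delta_lift T_actE.
Qed.

Lemma T_lmodule : is_lmodule (T_act W).
Proof.
have [lW rW'] := bW; have hl := left_lmod hW.
split=> [h|t|t|h h' t].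
- exact: linP.
- by move=> a h h'; apply: lift_inj; rewrite lmP !lift_act linearP (rW' (j t)).
- by apply: lift_inj; rewrite lift_act rmorph1 (la1 hl).
- by apply: lift_inj; rewrite !lift_act rmorphM (laM hl).
Qed.

Lemma cplus_linear : linear (@cplus k U H).
Proof.
move=> a c d; rewrite /cplus lmP scalerDl scalerBr opprD addrACA -scalerA.
by [].
Qed.

Lemma cplus1 : cplus (cl 1) = 0.
Proof. by rewrite /cplus C_epsE heps1 scale1r subrr. Qed.

Lemma cplus_delta w : cplus (delta w) = delta w.
Proof. by rewrite /cplus fo_eps scale0r subr0. Qed.

Hypothesis triv : trivial_right_coaction W.

(** Both sides lie in [V ⊗ C], on which [delta ⊗ id] is injective; and
    [delta ⊗ id] maps the left hand side to [delta(j t)_(1)^+ ⊗ delta(j t)_(2)],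
    by the coderivation property. *)
Lemma lift_rho t : brho W (j t) = j t ⊗ cl 1.
Proof.
pose w := j t; have hw : V w := lift_coinv t.
have tp (y : W ⨂ C) : tassoc _ _ _ (tmap (pure (cl 1)) id y) = cl 1 ⊗ y.
  elim/tensor_ind: y => [v c|y z hy hz]; last by rewrite !lmD hy hz.
  by rewrite tmapE_idr tassocE.
have ker (y : W ⨂ C) : tassoc _ _ _ (tmap (blam W) id y) = cl 1 ⊗ y ->
    tsub V setT y.
  move=> e; have ed : tmap coinv_defect id y = 0.
    apply: (can_inj (@tassocK _ _ _ _)); rewrite lm0.
    have -> : tmap coinv_defect id y = tmap (blam W) id y - tmap (pure (cl 1)) id y.
      elim/tensor_ind: (y) => [v c|y1 y2 h1 h2]; last by rewrite !lmD h1 h2 addrACA.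
      by rewrite !tmapE_idr /coinv_defect /= -[in LHS]/(purer _ _) lmB.
    by rewrite lmB e tp subrr.
  by rewrite coinv_ker; apply: tmap_ker_l.
have k1 : tsub V setT (brho W w) by apply: ker; rewrite fo_lam_rho hw tmapE_idl.
have k2 : tsub V setT (w ⊗ cl 1) by apply: tsub_pure.
have kz : tsub V setT (brho W w - w ⊗ cl 1) by apply: (subspaceB (@subspace_tsub _ _ _ _ _)).
have [z _ ez] := tsub_val_l kz.
have e1 : tmap delta id (brho W w) = delta w ⊗ cl 1.
  have := triv t; rewrite -delta_lift -/w fo_coderivation hw (tmapE_idl delta).
  rewrite -[tmap (@cplus k U H) id]/(tmap (mklin cplus_linear) id) lmD (tmapE_idr (mklin cplus_linear)).
  rewrite [mklin _ _]cplus1 pure0l addr0 => <-; symmetry.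
  by apply: tmap_tri => // v; apply: cplus_delta.
have z0 : z = 0.
  apply: (tmap_inj_l coinv_delta_inj); rewrite lm0.
  rewrite -(@tmap_tri _ _ _ _ _ _ _ (val : subsp V -> W) delta coinv_delta id id id) //.
  by rewrite ez lmB tmapE_idr e1 subrr.
by apply/eqP; rewrite -subr_eq0 -ez z0 lm0.
Qed.

(** * Admissible relations in degree two *)

Definition lam_delta : {linear W -> C ⨂ C} := tmap id delta \o blam W.

Definition differentials : set (C ⨂ C) := lam_delta @` setT.
Local Notation L := differentials.
Local Notation aCC := (diag_act (B := B) (mc_act B) (mc_act B)).

Lemma subspace_differentials : is_subspace L.
Proof. exact: subspace_im (@subspaceT _ _). Qed.

Lemma lam_delta_act x w : lam_delta (aW x w) = aCC x (lam_delta w).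
Proof.
rewrite /lam_delta /= (left_act hW).
by apply: (@diag_tmap _ _ _ _ _ _ _ _ _ _ idfun delta) => // y v; apply: fo_deltaM.
Qed.

Lemma differentials_act x c : L c -> L (aCC x c).
Proof. by case=> w _ <-; rewrite -lam_delta_act; exists (aW x w). Qed.

Lemma delta2_act x (u : W ⨂ W) :
  tmap delta delta (@bact k B (tens_bimod W W) x u) = aCC x (tmap delta delta u).
Proof.
by apply: (@diag_tmap _ _ _ _ _ _ _ _ _ _ delta delta) => // y v; apply: fo_deltaM.
Qed.

Lemma epsr_delta (N : lmodType k) (f : {linear N -> C}) (z : N ⨂ W) :
  tlift (fun c d => (C_eps H d : k) *: c) (tmap f delta z) = 0.
Proof.
elim/tensor_ind: z => [n w|y z hy hz]; last by rewrite !lmD hy hz addr0.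
by rewrite tmapE (tlift_pure _ _ (@bilinear_scaler k C C (C_eps H))) fo_eps scale0r.
Qed.

(** [c ⊗ d |-> c ⊗ d - eps(d) Delta(c)] vanishes on the image of [Delta] and
    fixes [C ⊗ C^+], which contains both representatives. *)
Lemma phi_rangeE (u : W ⨂ W) :
  range (@phi k U H W) (W1u_cls H (tmap delta delta u)) <-> L (tmap delta delta u).
Proof.
pose Th : {linear C ⨂ C -> C ⨂ C} :=
  (idfun \- (C_delta H \o tlift (fun c d => (C_eps H d : k) *: c)))%R.
have Thd (N : lmodType k) (f : {linear N -> C}) z : Th (tmap f delta z) = tmap f delta z.
  by rewrite /Th /= epsr_delta lm0 subr0.
split=> [[w _ /qprojP e]|[w _ e]]; last by exists w; rewrite // /phi -e.
exists w => //; apply/eqP; rewrite -subr_eq0.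
have <- : Th (lam_delta w - tmap delta delta u) = lam_delta w - tmap delta delta u.
  by rewrite lmB Thd /lam_delta (Thd _ idfun).
apply/eqP; move: e; apply: (@span_min _ _ _ [set c | Th c = 0]); first exact: subspace_ker.
by move=> _ [c _ <-]; rewrite /mkset /Th /= C_counitr subrr.
Qed.

Local Notation WW := (tens_bimod W W).
Local Notation aWW := (@bact k B WW).

Lemma WW_left : is_left WW. Proof. exact: (tens_left hB hC hW hW). Qed.
Let hWW := WW_left.

Lemma W2_admissibleE N : W2_admissible N <->
  [/\ is_subbicomodule N, N `<=` cotensor W W &
      forall u, N u -> L (tmap delta delta u)].
Proof.
split=> -[h1 h2 h3]; split=> // u hu; first exact/phi_rangeE/h3.
exact/phi_rangeE/h3.
Qed.

Definition act_span (S : set WW) : set WW :=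
  span [set z | exists x u, S u /\ z = aWW x u].

Lemma act_span_sub S : S `<=` act_span S.
Proof. by move=> u Su; apply: sub_span; exists 1, u; split=> //; rewrite (la1 (left_lmod hWW)). Qed.

Lemma act_span_min S (N : set WW) : is_subspace N -> S `<=` N ->
  (forall x u, N u -> N (aWW x u)) -> act_span S `<=` N.
Proof. by move=> hN SN Na; apply: span_min => // _ [x [u [Su ->]]]; apply: Na; apply: SN. Qed.

Lemma act_span_act S x u : act_span S u -> act_span S (aWW x u).
Proof.
pose f := mklin (la_linear (left_lmod hWW) x).
apply: (@span_min _ _ _ (f @^-1` act_span S)).
  exact: (subspace_preim f (@is_subspace_span _ _ _)).
move=> _ [y [v [Sv ->]]]; apply: sub_span; exists (x * y), v; split=> //.
exact/esym/(laM (left_lmod hWW)).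
Qed.

(** All conditions on admissible subspaces are stable under the action, so that
    admissibility may be tested on generators. Applied to an admissible subspace
    this makes [W2max] stable; applied to lifts of tensors it bounds [W2max] from
    below. *)
Lemma act_span_admissible (S : set WW) : S `<=` cotensor W W ->
  (forall u, S u -> L (tmap delta delta u)) ->
  (forall u, S u -> tsub setT S (blam WW u)) ->
  (forall u, S u -> tsub S setT (brho WW u)) ->
  W2_admissible (act_span S).
Proof.
move=> Scot SL Sl Sr; apply/W2_admissibleE.
have sA : is_subspace (act_span S) := @is_subspace_span _ _ _.
have [sc ca _] := left_stable_cotensor hB hC hW hW fo_rho_equivariant fo_lam_rho.
split; last 1 first.
- apply: act_span_min => [|//|x u].
    exact: (subspace_preim (tmap delta delta) subspace_differentials).
  by rewrite /mkset delta2_act; apply: differentials_act.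
- split=> //.
  + apply: act_span_min => [|u /Sl|x u].
    * exact: (subspace_preim (blam WW) (@subspace_tsub _ _ _ _ _)).
    * by apply: tsub_mono => //; apply: act_span_sub.
    * rewrite /mkset (left_act hWW).
      exact: (tsub_act (M := unit_bimod B) (N := WW) hC hWW (fun _ _ _ => I) (@act_span_act S)).
  + apply: act_span_min => [|u /Sr|x u].
    * exact: (subspace_preim (brho WW) (@subspace_tsub _ _ _ _ _)).
    * by apply: tsub_mono => //; apply: act_span_sub.
    * rewrite /mkset (tens_rho_equivariant hB hC hW hW fo_rho_equivariant).
      exact: (tsub_act (M := WW) (N := unit_bimod B) hWW hC (@act_span_act S) (fun _ _ _ => I)).
- exact: act_span_min.
Qed.

Lemma W2max_sup N : W2_admissible N -> N `<=` W2max (W := W).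
Proof. by move=> hN u Nu; apply: sub_span; exists N. Qed.

Lemma W2max_cotensor : W2max (W := W) `<=` cotensor W W.
Proof. by apply: span_min => [|u [N [_ h _]] /h]; first exact: subspace_cotensor. Qed.

Lemma W2max_delta u : W2max (W := W) u -> L (tmap delta delta u).
Proof.
apply: (@span_min _ _ _ (tmap delta delta @^-1` L)) => [|v [N /W2_admissibleE[_ _ h]] /h //].
exact: (subspace_preim (tmap delta delta) subspace_differentials).
Qed.

Lemma W2max_stable : left_stable (W2max (W := W) : set WW).
Proof.
have sA : is_subspace (W2max (W := W)) := @is_subspace_span _ _ _.
split=> // [x u|u].
- pose f := mklin (la_linear (left_lmod hWW) x).
  apply: (@span_min _ _ _ (f @^-1` W2max (W := W))); first exact: (subspace_preim f sA).
  move=> v [N hN Nv]; have [[_ Nl Nr] Nc NL] := (W2_admissibleE N).1 hN.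
  apply: (W2max_sup (act_span_admissible Nc NL Nl Nr)).
  by apply: sub_span; exists x, v.
- apply: (@span_min _ _ _ (blam WW @^-1` tsub setT (W2max (W := W)))).
    exact: (subspace_preim (blam WW) (@subspace_tsub _ _ _ _ _)).
  move=> v [N hN Nv]; have [[_ Nl _] _ _] := hN.
  by move: (Nl v Nv); apply: tsub_mono => //; apply: W2max_sup.
Qed.

Lemma lift2_W2max (r : T_car W ⨂ T_car W) :
  L (tmap tval tval r) <-> W2max (W := W) (tmap j j r).
Proof.
have jj s : tmap delta delta (tmap j j s) = tmap tval tval s.
  by apply: tmap_tri => // t; apply: delta_lift.
split=> [h|/W2max_delta]; last by rewrite jj.
pose S : set WW := [set u | exists2 s, L (tmap tval tval s) & tmap j j s = u].
have lamS s : blam WW (tmap j j s) = cl 1 ⊗ tmap j j s.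
  elim/tensor_ind: s => [t t'|y z hy hz]; last by rewrite !lmD hy hz.
  by rewrite tmapE blam_tens lift_coinv (tmapE_idl (purer (j t'))).
have rhoS s : brho WW (tmap j j s) = tmap j j s ⊗ cl 1.
  elim/tensor_ind: s => [t t'|y z hy hz]; last by rewrite !lmD hy hz pureDl.
  by rewrite tmapE brho_tens lift_rho (tmapE_idr (pure (j t))).
apply: (W2max_sup (act_span_admissible (S := S) _ _ _ _)).
- move=> _ [s _ <-]; rewrite /cotensor /mkset.
  elim/tensor_ind: s => [t t'|y z hy hz]; last by rewrite !lmD hy hz.
  by rewrite tmapE (tmapE_idr (brho W)) (tmapE_idl (blam W)) lift_rho lift_coinv tassocE.
- by move=> _ [s hs <-]; rewrite jj.
- by move=> _ [s hs <-]; rewrite lamS; apply: tsub_pure => //; exists s.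
- by move=> _ [s hs <-]; rewrite rhoS; apply: tsub_pure => //; exists s.
- by apply: act_span_sub; exists r.
Qed.

(** * Relations on the tangent space *)

Definition cpval : {linear Cplus H -> C} := val.

Lemma subspace_Cplus : is_subspace [set c : C | C_eps H c = 0].
Proof. exact: subspace_ker. Qed.

Lemma C_eps_act x c : C_eps H (C_act H x c) = (eps x * (C_eps H c : k^o) : k^o).
Proof. by have [y <-] := cls_surj c; rewrite C_actE !C_epsE hepsM. Qed.

Lemma cpval_inj : injective cpval. Proof. exact: val_inj. Qed.

Lemma Cplus_actE x c : cpval (Cplus_act H x c) = C_act H x (cpval c).
Proof.
apply: (@linfacP _ _ _ _ cpval (C_act H x \o cpval) cpval_inj) => c'.
have hc : C_eps H (C_act H x (cpval c')) = 0 :> k^o.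
  have := @subspP _ _ _ c' subspace_Cplus; rewrite /mkset C_eps_act => ->.
  exact: mulr0.
by exists (insubsp (G := [set c : C | C_eps H c = 0]) hc).
Qed.

Lemma Cplus_lmodule : is_lmodule (fun x => Cplus_act H x : Cplus H -> Cplus H).
Proof.
have hl := C_lmod H; split=> [x|c|c|x y c]; first exact: linP.
- move=> a x y; apply: cpval_inj; rewrite lmP !Cplus_actE.
  exact: (la_linearl hl).
- by apply: cpval_inj; rewrite Cplus_actE (la1 hl).
- by apply: cpval_inj; rewrite !Cplus_actE (laM hl).
Qed.

Lemma T_CplusE t : cpval (T_Cplus W t) = tval t.
Proof.
apply: (linfacP (f := tval) cpval_inj) => t'.
have ht : C_eps H (tval t') = 0 :> k^o.
  by apply: etrans (fo_eps (j t')); rewrite delta_lift.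
by exists (insubsp (G := [set c : C | C_eps H c = 0]) ht).
Qed.

Local Notation CP := (fun x => Cplus_act H x : Cplus H -> Cplus H).
Local Notation hP := Cplus_lmodule.
Local Notation canon := (canon_map H CP).

Lemma delta0E r : delta0 W r = canon_inv H CP (tmap tval (T_Cplus W) r).
Proof.
have opE c m : canon_inv_op (H := H) CP c m = canon_inv H CP (c ⊗ m).
  by have [x <-] := cls_surj c; rewrite (canon_invE H hP) (canon_inv_opE H hP).
move: r; apply: (tensor_ext (g := canon_inv H CP \o tmap tval (T_Cplus W))) => s t.
transitivity (canon_inv_op (H := H) CP (tval s) (T_Cplus W t)); last first.
  by rewrite opE; apply/esym; apply: congr1 (tmapE _ _ _ _).
apply: (tlift_pure s t (F := fun s t => canon_inv_op (H := H) CP (tval s) (T_Cplus W t))).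
split=> [s'|t'] a u v; rewrite !opE.
  by rewrite (lmP (T_Cplus W)) pure_linearr; apply: lmP.
by rewrite (lmP tval) pure_linearl; apply: lmP.
Qed.

(** The canonical isomorphism for [C^+] turns [delta0] into the inclusion of
    [T ⊗ T] in [C ⊗ C^+]. *)
Lemma canon_delta0 r : tmap id cpval (canon (delta0 W r)) = tmap tval tval r.
Proof.
apply: etrans (congr1 (tmap id cpval \o canon) (delta0E r)) _.
apply: etrans (congr1 (tmap id cpval) (canon_invK hP _)) _.
by apply: tmap_tri => // t; apply: T_CplusE.
Qed.

Hypothesis flat : rfaithfully_flat (@U_ract k U H).

Lemma canon_gen x t :
  tmap id cpval (canon (rpure (@U_ract k U H) (@Cplus_hact k U H) x (T_Cplus W t))) =
  lam_delta (aW x (j t)).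
Proof.
apply: etrans (congr1 (tmap id cpval) (canon_mapE H hP x (T_Cplus W t))) _.
symmetry; apply: etrans (congr1 (tmap id delta) (blam_coinv hW x (lift_coinv t))) _.
rewrite !sws_lin; apply: eq_sws => a b.
by rewrite (tmapE_idl delta) (tmapE_idl cpval) Cplus_actE T_CplusE fo_deltaM delta_lift.
Qed.

(** By descent [W] is spanned by the [x (j t)], and the canonical isomorphism takes
    [x ⊗_H t] to the element of [C ⊗ C^+] that [lam_delta] attaches to [x (j t)]. *)
Lemma UT_differentials z : UT W z <-> L (tmap id cpval (canon z)).
Proof.
split.
  apply: (@span_min _ _ _ ((tmap id cpval \o canon) @^-1` L)).
    exact: (subspace_preim (tmap id cpval \o canon) subspace_differentials).
  move=> _ [x [t ->]]; rewrite /preimage /mkset /= [X in L X]canon_gen.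
  by exists (aW x (j t)).
case=> w _ e.
have [y ey] := induced_map_surj flat hW T_lmodule lift_act lift_coinv lift_onto w.
have : exists2 z', UT W z' & tmap id cpval (canon z') = lam_delta w.
  rewrite -ey; elim/rtensor_ind: (y) => [x t|y1 y2 [z1 h1 e1] [z2 h2 e2]].
    exists (rpure (@U_ract k U H) (@Cplus_hact k U H) x (T_Cplus W t)).
      by apply: sub_span; exists x, t.
    apply: etrans (canon_gen x t) _; apply: congr1.
    exact/esym/(induced_mapE hW lift_act).
  exists (z1 + z2); first by apply: (subspaceD (@is_subspace_span _ _ _)).
  apply: etrans (lmD (tmap id cpval \o canon) z1 z2) _.
  apply: etrans (f_equal2 +%R e1 e2) _; apply/esym.
  exact: (lmD (lam_delta \o induced_map (T_act W) j)).
case=> z' hz' e'; suff -> : z = z' by [].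
apply: (can_inj (canon_mapK hP)); apply: (tmap_inj_r cpval_inj).
by rewrite e' e.
Qed.

Lemma RcheckE r : Rcheck (W := W) r <-> L (tmap tval tval r).
Proof. by rewrite -canon_delta0; apply: UT_differentials. Qed.

Lemma subspace_Rcheck : is_subspace (Rcheck (W := W)).
Proof. exact: (subspace_preim (delta0 W) (@is_subspace_span _ _ _)). Qed.

Theorem Wmax_isomorphic :
  coalg_isomorphic (Wmax W) (ind_coalg (@quad_coalg k _ (T_bimod W) (Rcheck (W := W)))).
Proof.
apply: (@coquad_isomorphic k U H flat (T_bimod W) W tangent_lift).
- exact: T_lmodule.
- by [].
- by [].
- exact: hW.
- exact: fo_rho_equivariant.
- exact: fo_lam_rho.
- exact: lift_inj.
- exact: lift_act.
- exact: lift_coinv.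
- exact: lift_rho.
- exact: lift_onto.
- exact: subspace_Rcheck.
- exact: W2max_stable.
- exact: W2max_cotensor.
- by move=> r; rewrite RcheckE; apply: lift2_W2max.
Qed.

End Tangent.

Theorem theorem5p10 (k : fieldType) (hchar : 2%N \notin [pchar k]%R)
    (U : hopfAlg k) (H : subBialg U)
    (hflatr : rfaithfully_flat (@U_ract k U H))
    (hflatl : lfaithfully_flat (@U_lact k U H))
    (W : focc H)
    (hT : finite_dim (T_car W))
    (htriv : trivial_right_coaction W) :
  coalg_isomorphic (Wmax W) (ind_coalg (@quad_coalg k _ (T_bimod W) (Rcheck (W := W)))).
Proof. exact: Wmax_isomorphic. Qed.
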